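(* Suppose there exists a locally universal $\mathrm{C}^*$-algebra $B$ which has a computable presentation $B^\dagger$. Then every computably weakly stable presentation $A^\dagger$ of a $\mathrm{C}^*$-algebra $A$ is computable.
   Context: All $\mathrm{C}^*$-algebras are unital and all $*$-homomorphisms are unital. A presentation of a $\mathrm{C}^*$-algebra $C$ is a pair $C^\dagger=(C,(a_n)_{n\in\mathbb N})$ where $\{a_n\}$ generates $C$ as a $\mathrm{C}^*$-algebra; its rational points are the elements $p(a_{i_1},\ldots,a_{i_k})$ with $p$ a $*$-polynomial with coefficients in $\mathbb Q(i)$ (a rational polynomial). $C^\dagger$ is computable if there is an algorithm which, on input a rational point $p$ of $C^\dagger$ and $k\in\mathbb N$, returns a rational $q$ with $|\|p\|-q|<2^{-k}$. Given generators $\bar x$ and a set $\mathcal R$ of relations $\|p(x_1,\ldots,x_n)\|\le a$ ($p$ a $*$-polynomial without constant term, $a\ge 0$; with a relation $\|x\|\le M$ for every generator, and a distinguished generator with relations making it the unit), $C^*\langle\bar x\mid\mathcal R\rangle$ denotes the universal $\mathrm{C}^*$-algebra of these generators and relations, and its standard presentation has the generators $\bar x$ as special points. A relation is rational if $p$ is a rational polynomial and $a$ a nonnegative dyadic rational; ''$p=0$'' means $\|p\|\le 0$. A presentation is finitely c.e. if it is the standard presentation of $C^*\langle\bar x\mid\mathcal R\rangle$ for finite $\bar x$ and a finite set $\mathcal R$ of rational relations. A finitely c.e. presentation $A^\dagger=C^*\langle x_1,\ldots,x_j\mid p_i(\bar x)=0\ (i=1,\ldots,r),\ \|x_k\|\le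 C_k\ (k=1,\ldots,j)\rangle$ is computably weakly stable if there is an algorithm which, given $n\in\mathbb N$, returns $m\in\mathbb N$ such that for every $\mathrm{C}^*$-algebra $D$ and every $\bar z\in D$ with $\|p_i(\bar z)\|\le 2^{-m}$ for all $i$ and $\|z_k\|\le C_k+2^{-m}$ for all $k$, there is a $*$-homomorphism $\varphi:A\to D$ with $\|\varphi(x_k)-z_k\|<2^{-n}$ for all $k$. A $\mathrm{C}^*$-algebra $B$ is locally universal if every $\mathrm{C}^*$-algebra embeds into an ultrapower $B^{\mathcal U}$ of $B$ with respect to a nonprincipal ultrafilter $\mathcal U$ on $\mathbb N$. *)

(* Defs.v *)
From HB Require Import structures.
From mathcomp Require Import all_boot all_order all_algebra.
From mathcomp Require Import complex.
From mathcomp Require Import all_classical all_reals all_analysis.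

Set Implicit Arguments.
Unset Strict Implicit.
Unset Printing Implicit Defensive.

Import Order.TTheory GRing.Theory Num.Theory.
Import numFieldNormedType.Exports.
Import ComplexField.Normc.

Local Open Scope classical_set_scope.
Local Open Scope ring_scope.

(* Cantor's pairing of nat * nat with nat; [unpair] walks along the
   antidiagonals. *)
Definition npair (a b : nat) : nat := ('C((a + b).+1, 2) + b)%N.

Fixpoint unpair (n : nat) : nat * nat :=
  if n is m.+1 then
    let: (a, b) := unpair m in if a is a'.+1 then (a', b.+1) else (b.+1, 0%N)
  else (0%N, 0%N).

Lemma npairK (a b : nat) : unpair (npair a b) = (a, b).
Proof.
have [m] := ubnP (npair a b); elim: m a b => // m IH a b.
case: b => [|b] lt_m.
  case: a lt_m => [|a] lt_m; first by rewrite /npair.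
  have e : npair a.+1 0 = (npair 0 a).+1.
    by rewrite /npair !addn0 add0n binS bin1 addnS.
  by rewrite e /= IH // -ltnS -e.
have e : npair a b.+1 = (npair a.+1 b).+1 by rewrite /npair !addnS addSn.
by rewrite e /= IH // -ltnS -e.
Qed.

Lemma unpairK (n : nat) : npair (unpair n).1 (unpair n).2 = n.
Proof.
elim: n => //= n; case: (unpair n) => -[|a] b /= <-.
  by rewrite /npair !addn0 add0n binS bin1 addnS.
by rewrite /npair !addnS addSn.
Qed.

(* Kleene's partial recursive functions, as unary functions on nat: tuples of
   arguments are packed by [npair]. *)
Inductive prog : Type :=
  | Zero | Succ | Fst | Snd
  | Pair of prog & prog
  | Comp of prog & prog
  | PrimRec of prog & prog
  | Mu of prog.

(* [eval c n m]: the program [c] halts on input [n] with output [m]. *)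
Fixpoint eval (c : prog) (n m : nat) : Prop :=
  match c with
  | Zero => m = 0%N
  | Succ => m = n.+1
  | Fst => m = (unpair n).1
  | Snd => m = (unpair n).2
  | Pair f g => exists a b, [/\ eval f n a, eval g n b & m = npair a b]
  | Comp f g => exists2 a, eval g n a & eval f a m
  | PrimRec f g => exists s : nat -> nat,
      [/\ eval f (unpair n).1 (s 0%N),
          forall k, (k < (unpair n).2)%N ->
            eval g (npair (unpair n).1 (npair k (s k))) (s k.+1)
        & m = s (unpair n).2]
  | Mu f => eval f (npair n m) 0%N /\
      forall k, (k < m)%N -> exists b, eval f (npair n k) b.+1
  end.

Definition computable (f : nat -> nat) : Prop :=
  exists c : prog, forall n, eval c n (f n).

Lemma eval_fun (c : prog) (n m m' : nat) : eval c n m -> eval c n m' -> m = m'.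
Proof.
elim: c n m m' => [||||f IHf g IHg|f IHf g IHg|f IHf g IHg|f IHf] n m m' /=.
- by move=> -> ->.
- by move=> -> ->.
- by move=> -> ->.
- by move=> -> ->.
- move=> [a [b [fa gb ->]]] [a' [b' [fa' gb' ->]]].
  by rewrite (IHf _ _ _ fa fa') (IHg _ _ _ gb gb').
- move=> [a ga fa] [a' ga']; rewrite (IHg _ _ _ ga' ga); exact: IHf.
- move=> [s [s0 sS ->]] [s' [s'0 s'S ->]].
  have : forall k, (k <= (unpair n).2)%N -> s k = s' k; last exact.
  elim=> [_|k IHk ltk]; first exact: IHf s0 s'0.
  have := s'S _ ltk; rewrite -(IHk (ltnW ltk)); exact/IHg/sS.
- move=> [m0 ltm] [m'0 ltm'].
  case: (ltngtP m m') => // lt_m.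
    by have [b fb] := ltm' _ lt_m; have := IHf _ _ _ fb m0.
  by have [b fb] := ltm _ lt_m; have := IHf _ _ _ fb m'0.
Qed.

(* Formal noncommutative unital *-polynomials in the variables [V] with
   coefficients in Q(i); [PConst a b d] is the constant (a + b i) / (d + 1). *)
Inductive starpoly (V : Type) : Type :=
  | PVar of V
  | PConst of int & int & nat
  | PAdd of starpoly V & starpoly V
  | PMul of starpoly V & starpoly V
  | PStar of starpoly V.

Definition code_int (z : int) : nat :=
  match z with Posz n => n.*2 | Negz n => n.*2.+1 end.

Fixpoint code_poly (p : starpoly nat) : nat :=
  match p with
  | PVar v => npair 0 v
  | PConst a b d => npair 1 (npair (code_int a) (npair (code_int b) d))
  | PAdd p q => npair 2 (npair (code_poly p) (code_poly q))
  | PMul p q => npair 3 (npair (code_poly p) (code_poly q))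
  | PStar p => npair 4 (code_poly p)
  end.

Definition decode_int (n : nat) : int := if odd n then Negz n./2 else Posz n./2.
Definition decode_rat (n : nat) : rat :=
  (decode_int (unpair n).1)%:~R / (unpair n).2.+1%:R.

Lemma code_intK : cancel code_int decode_int.
Proof.
by case=> n; rewrite /decode_int /= ?odd_double ?doubleK // uphalf_double.
Qed.

Lemma decode_rat_surj (r : rat) : exists n, decode_rat n = r.
Proof.
exists (npair (code_int (numq r)) `|denq r|.-1).
rewrite /decode_rat npairK /= code_intK prednK ?absz_gt0 ?denq_neq0 //.
by rewrite -[in RHS](divq_num_den r) -[in RHS](absz_denq r).
Qed.

Lemma npair_inj (a b a' b' : nat) : npair a b = npair a' b' -> a = a' /\ b = b'.
Proof. by move/(congr1 unpair); rewrite !npairK => -[-> ->]. Qed.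

Lemma code_poly_inj : injective code_poly.
Proof.
elim=> [v|a b d|p IHp q IHq|p IHp q IHq|p IHp] [v'|a' b' d'|p' q'|p' q'|p'] /=
  /npair_inj[] // _.
- by move=> ->.
- move=> /npair_inj[/(can_inj code_intK) -> /npair_inj[]].
  by move=> /(can_inj code_intK) -> ->.
- by move=> /npair_inj[/IHp -> /IHq ->].
- by move=> /npair_inj[/IHp -> /IHq ->].
- by move=> /IHp ->.
Qed.

Section CStarAlgebra.
Variable R : realType.

Record cstar_axioms (A : algType R[i]) (star : A -> A) (norm : A -> R) : Prop :=
  CStarAxioms {
  ax_starK : involutive star;
  ax_starD : {morph star : x y / x + y};
  ax_starM : forall x y, star (x * y) = star y * star x;
  ax_starZ : forall (a : R[i]) x, star (a *: x) = conjc a *: star x;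
  ax_norm0_eq0 : forall x, norm x = 0 -> x = 0;
  ax_normD : forall x y, norm (x + y) <= norm x + norm y;
  ax_normZ : forall (a : R[i]) x, norm (a *: x) = normc a * norm x;
  ax_normM : forall x y, norm (x * y) <= norm x * norm y;
  ax_cstar : forall x, norm (star x * x) = norm x ^+ 2;
  ax_complete : forall u : nat -> A,
    (forall e : R, 0 < e -> exists N, forall m n, (N <= m)%N -> (N <= n)%N ->
       norm (u m - u n) < e) ->
    exists l, forall e : R, 0 < e -> exists N, forall n, (N <= n)%N ->
       norm (u n - l) < e }.

(* An [algType] is nontrivial, so the zero algebra is not a C*-algebra. *)
Record cstar : Type := CStar {
  cstar_alg :> algType R[i];
  star : cstar_alg -> cstar_alg;
  cnorm : cstar_alg -> R;
  cstarP : cstar_axioms star cnorm }.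

(* [{lrmorphism A -> B}]: unital homomorphisms of complex algebras. *)
Record starhom (A B : cstar) : Type := StarHom {
  starhom_fun :> {lrmorphism A -> B};
  starhom_star : forall a, starhom_fun (star a) = star (starhom_fun a) }.

Definition separable (A : cstar) : Prop :=
  exists d : nat -> A, forall (a : A) (e : R), 0 < e ->
    exists n, cnorm (a - d n) < e.

Record cstar_subalgebra (A : cstar) (S : set A) : Prop := CStarSubalgebra {
  sub_1 : S 1;
  subD : forall x y, S x -> S y -> S (x + y);
  subZ : forall (a : R[i]) x, S x -> S (a *: x);
  subM : forall x y, S x -> S y -> S (x * y);
  sub_star : forall x, S x -> S (star x);
  sub_closed : forall x, (forall e : R, 0 < e ->
    exists2 y, S y & cnorm (x - y) < e) -> S x }.

Definition generates (A : cstar) (a : nat -> A) : Prop :=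
  forall S : set A, cstar_subalgebra S -> (forall n, S (a n)) -> S = setT.

Fixpoint peval (V : Type) (A : cstar) (x : V -> A) (p : starpoly V) : A :=
  match p with
  | PVar v => x v
  | PConst a b d => (Complex (a%:~R / d.+1%:R) (b%:~R / d.+1%:R)) *: 1
  | PAdd p q => peval x p + peval x q
  | PMul p q => peval x p * peval x q
  | PStar p => star (peval x p)
  end.

End CStarAlgebra.

Arguments cnorm {R c} _.
Arguments star {R c} _.

Section CStarTheory.
Variables (R : realType) (A : cstar R).
Implicit Types x y : A.

Lemma starK x : star (star x) = x. Proof. exact: ax_starK (cstarP A) x. Qed.
Lemma starD x y : star (x + y) = star x + star y.
Proof. exact: ax_starD (cstarP A) x y. Qed.
Lemma starM x y : star (x * y) = star y * star x.
Proof. exact: ax_starM (cstarP A) x y. Qed.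
Lemma starZ (a : R[i]) x : star (a *: x) = conjc a *: star x.
Proof. exact: ax_starZ (cstarP A) a x. Qed.
Lemma starN x : star (- x) = - star x.
Proof. by rewrite -scaleN1r starZ rmorphN rmorph1 scaleN1r. Qed.
Lemma starB x y : star (x - y) = star x - star y.
Proof. by rewrite starD starN. Qed.

Lemma cnorm_eq0 x : cnorm x = 0 -> x = 0.
Proof. exact: ax_norm0_eq0 (cstarP A) x. Qed.
Lemma cnormD x y : cnorm (x + y) <= cnorm x + cnorm y.
Proof. exact: ax_normD (cstarP A) x y. Qed.
Lemma cnormZ (a : R[i]) x : cnorm (a *: x) = normc a * cnorm x.
Proof. exact: ax_normZ (cstarP A) a x. Qed.
Lemma cnormM x y : cnorm (x * y) <= cnorm x * cnorm y.
Proof. exact: ax_normM (cstarP A) x y. Qed.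
Lemma cnorm_cstar x : cnorm (star x * x) = cnorm x ^+ 2.
Proof. exact: ax_cstar (cstarP A) x. Qed.

Lemma cnorm0 : cnorm (0 : A) = 0.
Proof. by rewrite -[0](@scale0r _ A 0) cnormZ normc0 mul0r. Qed.
Lemma cnormN x : cnorm (- x) = cnorm x.
Proof. by rewrite -scaleN1r cnormZ /= oppr0 sqrrN expr1n expr0n addr0 sqrtr1 mul1r. Qed.
Lemma cdistC x y : cnorm (x - y) = cnorm (y - x).
Proof. by rewrite -cnormN opprB. Qed.
Lemma cnorm_ge0 x : 0 <= cnorm x.
Proof.
by have := cnormD x (- x); rewrite subrr cnorm0 cnormN -mulr2n pmulrn_lge0.
Qed.
Lemma cnorm_star x : cnorm (star x) = cnorm x.
Proof.
have le (y : A) : cnorm y <= cnorm (star y).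
  have [y0|y0] := eqVneq (cnorm y) 0; first by rewrite y0 cnorm_ge0.
  have := cnormM (star y) y; rewrite cnorm_cstar expr2 ler_pM2r //.
  by rewrite lt_def y0 cnorm_ge0.
by apply/eqP; rewrite eq_le le -{2}(starK x) le.
Qed.
Lemma cdist_triangle z x y : cnorm (x - y) <= cnorm (x - z) + cnorm (z - y).
Proof. by rewrite -[x - y](subrKA z) cnormD. Qed.
Lemma cdist_norm x y : `|cnorm x - cnorm y| <= cnorm (x - y).
Proof.
have h (u v : A) : cnorm u - cnorm v <= cnorm (u - v).
  by have := cnormD (u - v) v; rewrite subrK lerBlDr.
by rewrite ler_norml h andbT lerNl opprB cdistC h.
Qed.
Lemma cnorm_complete (u : nat -> A) :
  (forall e : R, 0 < e -> exists N, forall m n, (N <= m)%N -> (N <= n)%N ->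
     cnorm (u m - u n) < e) ->
  exists l, forall e : R, 0 < e -> exists N, forall n, (N <= n)%N ->
     cnorm (u n - l) < e.
Proof. exact: ax_complete (cstarP A) u. Qed.
Lemma cnorm1_neq0 : cnorm (1 : A) != 0.
Proof. by apply/eqP => /cnorm_eq0/eqP; rewrite oner_eq0. Qed.

End CStarTheory.

Section Ultrapower.
Variables (R : realType) (A : cstar R).
Variables (U : set_system nat) (UU : UltraFilter U).

Definition bounded_seq : Type :=
  {s : nat -> A | `[< exists M : R, forall n, cnorm (s n) <= M >]}.
HB.instance Definition _ := Choice.on bounded_seq.

Implicit Types s t : bounded_seq.

Definition ulim (s : bounded_seq) : R := lim ((fun n => cnorm (val s n)) @ U).

Definition ueqv : rel bounded_seq := fun s t =>
  `[< (fun n => cnorm (val s n - val t n)) @ U --> (0 : R) >].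

Lemma bseqP s : exists M : R, forall n, cnorm (val s n) <= M.
Proof. by case: s => s /= /asboolP. Qed.

Lemma bseqP0 s : exists2 M : R, 0 <= M & forall n, cnorm (val s n) <= M.
Proof.
by have [M sM] := bseqP s; exists M => //; apply: le_trans (sM 0%N); exact: cnorm_ge0.
Qed.

Definition mkbseq (f : nat -> A) (b : exists M : R, forall n, cnorm (f n) <= M) :
  bounded_seq := exist _ f (asboolT b).

Fact bconst_bounded (a : A) : exists M : R, forall n : nat, cnorm a <= M.
Proof. by exists (cnorm a). Qed.
Fact bopp_bounded s : exists M : R, forall n, cnorm (- val s n) <= M.
Proof. by have [M sM] := bseqP s; exists M => n; rewrite cnormN. Qed.
Fact badd_bounded s t : exists M : R, forall n, cnorm (val s n + val t n) <= M.
Proof.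
have [M sM] := bseqP s; have [N tN] := bseqP t; exists (M + N) => n.
exact: le_trans (cnormD _ _) (lerD (sM n) (tN n)).
Qed.
Fact bmul_bounded s t : exists M : R, forall n, cnorm (val s n * val t n) <= M.
Proof.
have [M M0 sM] := bseqP0 s; have [N N0 tN] := bseqP0 t; exists (M * N) => n.
by apply: le_trans (cnormM _ _) _; apply: ler_pM; rewrite ?cnorm_ge0.
Qed.
Fact bscale_bounded (a : R[i]) s :
  exists M : R, forall n, cnorm (a *: val s n) <= M.
Proof.
have [M sM] := bseqP s; exists (normc a * M) => n; rewrite cnormZ.
by apply: ler_wpM2l => //; case: a => x y; rewrite /= sqrtr_ge0.
Qed.
Fact bstar_bounded s : exists M : R, forall n, cnorm (star (val s n)) <= M.
Proof. by have [M sM] := bseqP s; exists M => n; rewrite cnorm_star. Qed.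

Definition bconst (a : A) : bounded_seq := mkbseq (bconst_bounded a).
Definition bopp s := mkbseq (bopp_bounded s).
Definition badd s t := mkbseq (badd_bounded s t).
Definition bmul s t := mkbseq (bmul_bounded s t).
Definition bscale (a : R[i]) s := mkbseq (bscale_bounded a s).
Definition bstar s := mkbseq (bstar_bounded s).

Lemma ueqvP s t : reflect
  (forall e : R, 0 < e -> U [set n | cnorm (val s n - val t n) < e]) (ueqv s t).
Proof.
rewrite /ueqv; apply: (iffP (asboolP _)) => [/cvgrPdist_lt h e /h|h].
  apply: filterS => n /=; rewrite sub0r normrN ger0_norm //; exact: cnorm_ge0.
apply/cvgrPdist_lt => e /h; apply: filterS => n /=.
rewrite sub0r normrN ger0_norm //; exact: cnorm_ge0.
Qed.

Lemma ueqv_le (c : R) s t s' t' : ueqv s t ->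
  (forall n, cnorm (val s' n - val t' n) <= c * cnorm (val s n - val t n)) ->
  ueqv s' t'.
Proof.
move=> /ueqvP h le_c; apply/ueqvP => e e0.
have c0 : 0 < 1 + `|c| by rewrite ltr_wpDr.
have /h := divr_gt0 e0 c0; apply: filterS => n /= hn.
apply: le_lt_trans (le_c n) _; move: hn; rewrite ltr_pdivlMr // => hn.
apply: le_lt_trans hn; rewrite mulrC ler_wpM2l ?cnorm_ge0 //.
by rewrite (le_trans (ler_norm c)) // lerDr.
Qed.

Lemma ueqv_refl : reflexive ueqv.
Proof.
move=> s; apply/ueqvP => e e0; apply: filterE => n /=.
by rewrite subrr cnorm0.
Qed.
Lemma ueqv_sym : symmetric ueqv.
Proof.
move=> s t; apply/idP/idP => h; apply: (ueqv_le (c := 1) h) => n.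
  by rewrite mul1r cdistC.
by rewrite mul1r cdistC.
Qed.
Lemma ueqv_trans : transitive ueqv.
Proof.
move=> t s r /ueqvP st /ueqvP tr; apply/ueqvP => e e0.
have e20 : 0 < e / 2 by rewrite divr_gt0.
apply: filterS (filterI (st _ e20) (tr _ e20)) => n /= [h1 h2].
by rewrite (splitr e); apply: le_lt_trans (cdist_triangle (val t n) _ _) (ltrD h1 h2).
Qed.

Canonical ueqv_rel := EquivRel ueqv ueqv_refl ueqv_sym ueqv_trans.

Lemma ueqv_add s s' t t' : ueqv s s' -> ueqv t t' -> ueqv (badd s t) (badd s' t').
Proof.
have cadd (u v w : bounded_seq) : ueqv u v -> ueqv (badd u w) (badd v w).
  by move=> h; apply: (ueqv_le (c := 1) h) => n /=; rewrite mul1r opprD addrACA subrr addr0.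
have cadd' (u v w : bounded_seq) : ueqv u v -> ueqv (badd w u) (badd w v).
  move=> h; apply: (ueqv_le (c := 1) h) => n /=.
  by rewrite mul1r opprD addrACA subrr add0r.
by move=> /(cadd _ _ t) h /(cadd' _ _ s'); exact: ueqv_trans.
Qed.
Lemma ueqv_mul s s' t t' : ueqv s s' -> ueqv t t' -> ueqv (bmul s t) (bmul s' t').
Proof.
have cmul (u v w : bounded_seq) : ueqv u v -> ueqv (bmul u w) (bmul v w).
  have [M M0 wM] := bseqP0 w => h; apply: (ueqv_le (c := M) h) => n /=.
  rewrite -mulrBl mulrC; apply: le_trans (cnormM _ _) _.
  by apply: ler_wpM2l; [exact: cnorm_ge0 | exact: wM].
have cmul' (u v w : bounded_seq) : ueqv u v -> ueqv (bmul w u) (bmul w v).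
  have [M M0 wM] := bseqP0 w => h; apply: (ueqv_le (c := M) h) => n /=.
  rewrite -mulrBr; apply: le_trans (cnormM _ _) _.
  by apply: ler_wpM2r; [exact: cnorm_ge0 | exact: wM].
by move=> /(cmul _ _ t) h /(cmul' _ _ s'); exact: ueqv_trans.
Qed.
Lemma ueqv_scale a s s' : ueqv s s' -> ueqv (bscale a s) (bscale a s').
Proof.
by move=> h; apply: (ueqv_le (c := normc a) h) => n /=; rewrite -scalerBr cnormZ.
Qed.
Lemma ueqv_opp s s' : ueqv s s' -> ueqv (bopp s) (bopp s').
Proof.
by move=> h; apply: (ueqv_le (c := 1) h) => n /=; rewrite -opprD cnormN mul1r.
Qed.
Lemma ueqv_star s s' : ueqv s s' -> ueqv (bstar s) (bstar s').
Proof.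
by move=> h; apply: (ueqv_le (c := 1) h) => n /=; rewrite -starB cnorm_star mul1r.
Qed.

Lemma ulim_cvg s : (fun n => cnorm (val s n)) @ U --> ulim s.
Proof.
have [M sM] := bseqP s.
pose f n : R := cnorm (val s n).
have [|l [_ Fl]] := @segment_compact R 0 M (f @ U) _.
  by apply: (@filterE _ U) => n; rewrite /= in_itv /= /f cnorm_ge0 sM.
apply: (cvgP l) => B lB.
have [//|UC] := in_ultra_setVsetC (f @^-1` B) UU.
have [x [/= Cx Bx]] := Fl (~` B) B UC lB.
by have := Cx Bx.
Qed.

Arguments ulim_cvg s : clear implicits.

Lemma ulim_eq s (l : R) : (fun n => cnorm (val s n)) @ U --> l -> ulim s = l.
Proof. by move=> sl; apply: cvg_lim. Qed.

Lemma ulim_ueqv s t : ueqv s t -> ulim s = ulim t.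
Proof.
move=> /ueqvP st; apply: ulim_eq; apply/cvgrPdist_lt => e e0.
have e20 : 0 < e / 2 by rewrite divr_gt0.
have /cvgrPdist_lt/(_ _ e20) := ulim_cvg t.
have := st _ e20; apply: filterS2 => n /= h1 h2.
rewrite (splitr e); apply: le_lt_trans (ltrD h2 h1).
apply: le_trans (ler_distD (cnorm (val t n)) _ _) _.
by rewrite lerD2l (le_trans (cdist_norm _ _)) // cdistC.
Qed.

(* A^U: bounded sequences modulo the sequences whose norms tend to 0 along U. *)
Definition upow : Type := {eq_quot ueqv_rel}%qT.
HB.instance Definition _ := Choice.on upow.
HB.instance Definition _ := Quotient.on upow.

Definition upi : bounded_seq -> upow := \pi_upow%qT.

Lemma upi_eq s t : ueqv s t -> upi s = upi t.
Proof. by move=> st; apply/eqmodP. Qed.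
Lemma upi_inj s t : upi s = upi t -> ueqv s t.
Proof. by move/eqmodP. Qed.
Lemma upiW (P : upow -> Prop) : (forall s, P (upi s)) -> forall x, P x.
Proof. by move=> h; elim/quotW. Qed.
Lemma repr_upi s : ueqv (repr (upi s)) s.
Proof. by apply: upi_inj; rewrite /upi reprK. Qed.
Lemma upi_ext s t : val s =1 val t -> upi s = upi t.
Proof. by move=> st; congr upi; apply/val_inj/funext. Qed.

Definition uadd (x y : upow) : upow := upi (badd (repr x) (repr y)).
Definition umul (x y : upow) : upow := upi (bmul (repr x) (repr y)).
Definition uopp (x : upow) : upow := upi (bopp (repr x)).
Definition uscale (a : R[i]) (x : upow) : upow := upi (bscale a (repr x)).
Definition ustar (x : upow) : upow := upi (bstar (repr x)).
Definition unorm (x : upow) : R := ulim (repr x).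

Lemma uaddE s t : uadd (upi s) (upi t) = upi (badd s t).
Proof. by apply/upi_eq/ueqv_add; exact: repr_upi. Qed.
Lemma umulE s t : umul (upi s) (upi t) = upi (bmul s t).
Proof. by apply/upi_eq/ueqv_mul; exact: repr_upi. Qed.
Lemma uoppE s : uopp (upi s) = upi (bopp s).
Proof. by apply/upi_eq/ueqv_opp; exact: repr_upi. Qed.
Lemma uscaleE a s : uscale a (upi s) = upi (bscale a s).
Proof. by apply/upi_eq/ueqv_scale; exact: repr_upi. Qed.
Lemma ustarE s : ustar (upi s) = upi (bstar s).
Proof. by apply/upi_eq/ueqv_star; exact: repr_upi. Qed.
Lemma unormE s : unorm (upi s) = ulim s.
Proof. by apply/ulim_ueqv; exact: repr_upi. Qed.

Fact uaddA : associative uadd.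
Proof.
move=> x y z; elim/upiW: x => s; elim/upiW: y => t; elim/upiW: z => r.
by rewrite !uaddE; apply: upi_ext => n /=; rewrite addrA.
Qed.
Fact uaddC : commutative uadd.
Proof.
move=> x y; elim/upiW: x => s; elim/upiW: y => t.
by rewrite !uaddE; apply: upi_ext => n /=; rewrite addrC.
Qed.
Fact uadd0 : left_id (upi (bconst 0)) uadd.
Proof.
by elim/upiW => s; rewrite uaddE; apply: upi_ext => n /=; rewrite add0r.
Qed.
Fact uaddN : left_inverse (upi (bconst 0)) uopp uadd.
Proof.
by elim/upiW => s; rewrite uoppE uaddE; apply: upi_ext => n /=; rewrite addNr.
Qed.
Fact umulA : associative umul.
Proof.
move=> x y z; elim/upiW: x => s; elim/upiW: y => t; elim/upiW: z => r.
by rewrite !umulE; apply: upi_ext => n /=; rewrite mulrA.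
Qed.
Fact umul1l : left_id (upi (bconst 1)) umul.
Proof.
by elim/upiW => s; rewrite umulE; apply: upi_ext => n /=; rewrite mul1r.
Qed.
Fact umul1r : right_id (upi (bconst 1)) umul.
Proof.
by elim/upiW => s; rewrite umulE; apply: upi_ext => n /=; rewrite mulr1.
Qed.
Fact umulDl : left_distributive umul uadd.
Proof.
move=> x y z; elim/upiW: x => s; elim/upiW: y => t; elim/upiW: z => r.
by rewrite !(umulE, uaddE); apply: upi_ext => n /=; rewrite mulrDl.
Qed.
Fact umulDr : right_distributive umul uadd.
Proof.
move=> x y z; elim/upiW: x => s; elim/upiW: y => t; elim/upiW: z => r.
by rewrite !(umulE, uaddE); apply: upi_ext => n /=; rewrite mulrDr.
Qed.
Fact u1_neq0 : upi (bconst 1) != upi (bconst 0).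
Proof.
apply/eqP => /upi_inj/ueqvP/(_ (cnorm (1 : A))).
rewrite lt_def cnorm1_neq0 cnorm_ge0 => /(_ isT)/filter_ex[n /=].
by rewrite subr0 ltxx.
Qed.

HB.instance Definition _ := GRing.isNzRing.Build upow
  uaddA uaddC uadd0 uaddN umulA umul1l umul1r umulDl umulDr u1_neq0.

Fact uscaleA a b (x : upow) : uscale a (uscale b x) = uscale (a * b) x.
Proof.
by elim/upiW: x => s; rewrite !uscaleE; apply: upi_ext => n /=; rewrite scalerA.
Qed.
Fact uscale1 : left_id 1 uscale.
Proof.
by elim/upiW => s; rewrite !uscaleE; apply: upi_ext => n /=; rewrite scale1r.
Qed.
Fact uscaleDr : right_distributive uscale +%R.
Proof.
move=> a x y; elim/upiW: x => s; elim/upiW: y => t.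
rewrite [_ + _]uaddE !uscaleE [_ + _]uaddE.
by apply: upi_ext => n /=; rewrite scalerDr.
Qed.
Fact uscaleDl (x : upow) : {morph uscale^~ x : a b / a + b}.
Proof.
elim/upiW: x => s a b; rewrite !uscaleE [X in _ = X]uaddE.
by apply: upi_ext => n /=; rewrite scalerDl.
Qed.
HB.instance Definition _ := GRing.Zmodule_isLmodule.Build R[i] upow
  uscaleA uscale1 uscaleDr uscaleDl.

Fact uscaleAl (a : R[i]) (x y : upow) : a *: (x * y) = (a *: x) * y.
Proof.
elim/upiW: x => s; elim/upiW: y => t.
rewrite [upi s * upi t]umulE [a *: upi s]uscaleE [LHS]uscaleE [RHS]umulE.
by apply: upi_ext => n /=; rewrite scalerAl.
Qed.
HB.instance Definition _ := GRing.Lmodule_isLalgebra.Build R[i] upow uscaleAl.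

Fact uscaleAr (a : R[i]) (x y : upow) : a *: (x * y) = x * (a *: y).
Proof.
elim/upiW: x => s; elim/upiW: y => t.
rewrite [upi s * upi t]umulE [a *: upi t]uscaleE [LHS]uscaleE [RHS]umulE.
by apply: upi_ext => n /=; rewrite scalerAr.
Qed.
HB.instance Definition _ := GRing.Lalgebra_isAlgebra.Build R[i] upow uscaleAr.

Lemma upiD s t : upi s + upi t = upi (badd s t). Proof. exact: uaddE. Qed.
Lemma upiM s t : upi s * upi t = upi (bmul s t). Proof. exact: umulE. Qed.
Lemma upiN s : - upi s = upi (bopp s). Proof. exact: uoppE. Qed.
Lemma upiZ a s : a *: upi s = upi (bscale a s). Proof. exact: uscaleE. Qed.

Lemma ulim_le s (c : R) : (forall n, cnorm (val s n) <= c) -> ulim s <= c.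
Proof.
move=> sc; apply: (limr_le (ulim_cvg s : cvg _)).
exact: nearW.
Qed.

Lemma ulim_lt s (c : R) : ulim s < c -> U [set n | cnorm (val s n) < c].
Proof.
move=> sc; have c0 : 0 < c - ulim s by rewrite subr_gt0.
have /cvgrPdist_lt/(_ _ c0) := ulim_cvg s; apply: filterS => n /=.
by rewrite distrC => /(le_lt_trans (ler_norm _)); rewrite ltrD2r.
Qed.

Lemma geom_small (c e : R) : 0 < c -> 0 < e -> exists k, c * 2^-1 ^+ k < e.
Proof.
move=> c0 e0; exists (Num.bound (c / e)).
rewrite exprVn ltr_pdivrMr ?exprn_gt0 // mulrC -ltr_pdivrMr //.
apply: lt_trans (archi_boundP _) _; first by rewrite divr_ge0 ?ltW.
by rewrite -natrX ltr_nat ltn_expl.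
Qed.

Lemma upow_step (s t : bounded_seq) (e : R) : unorm (upi t - upi s) < e ->
  exists t' : bounded_seq, upi t' = upi t /\
    forall n, cnorm (val t' n - val s n) < e.
Proof.
rewrite upiN upiD unormE => /[dup] lt_e /ulim_lt Ue.
have e0 : 0 < e.
  by have [n /= hn] := filter_ex Ue; apply: le_lt_trans hn; exact: cnorm_ge0.
pose f n := if cnorm (val t n - val s n) < e then val t n else val s n.
have fb : exists M : R, forall n, cnorm (f n) <= M.
  have [M M0 sM] := bseqP0 s; have [N N0 tN] := bseqP0 t.
  exists (M + N) => n; rewrite /f; case: ifP => _.
    by rewrite (le_trans (tN n)) // lerDr.
  by rewrite (le_trans (sM n)) // lerDl.
exists (mkbseq fb); split=> [|n /=].
  apply/upi_eq/ueqvP => d d0; apply: filterS Ue => n /= hn.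
  by rewrite /f hn subrr cnorm0.
by rewrite /f; case: ifP => // _; rewrite subrr cnorm0.
Qed.

Lemma upow_lim_fast (x : nat -> upow) :
  (forall k, unorm (x k.+1 - x k) < 2^-1 ^+ k) ->
  exists l, forall k, unorm (x k - l) <= 2 * 2^-1 ^+ k.
Proof.
move=> fast.
have half0 k : 0 < 2^-1 ^+ k :> R by rewrite exprn_gt0 ?invr_gt0.
have step k (s : bounded_seq) : upi s = x k -> {t : bounded_seq |
    upi t = x k.+1 /\ forall n, cnorm (val t n - val s n) < 2^-1 ^+ k}.
  move=> sk; apply: cid; have := fast k.
  rewrite -sk -{1}[x k.+1]reprK => /upow_step[t [tE tn]].
  by exists t; split=> //; rewrite tE /upi reprK.
pose S k := {s : bounded_seq | upi s = x k}.
pose init : S 0%N := exist _ (repr (x 0%N)) (reprK _).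
pose next k (s : S k) : S k.+1 :=
  exist _ (sval (step k _ (svalP s))) (svalP (step k _ (svalP s))).1.
pose sq := fix sq k : S k := if k is k'.+1 then next k' (sq k') else init.
pose r k : bounded_seq := sval (sq k).
have rx k : upi (r k) = x k by exact: svalP (sq k).
have rS k n : cnorm (val (r k.+1) n - val (r k) n) < 2^-1 ^+ k.
  exact: (svalP (step k _ (svalP (sq k)))).2.
have rD k m n : cnorm (val (r (m + k)%N) n - val (r k) n)
    <= 2 * 2^-1 ^+ k - 2 * 2^-1 ^+ (m + k).
  elim: m => [|m IH]; first by rewrite add0n !subrr cnorm0.
  apply: le_trans (cdist_triangle (val (r (m + k)%N) n) _ _) _.
  apply: le_trans (lerD (ltW (rS _ n)) IH) _.
  rewrite addSn exprS mulrA divff // mul1r.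
  by rewrite addrCA lerD2l mulr_natl mulr2n opprD addNKr.
have rC k m n : (k <= m)%N -> cnorm (val (r m) n - val (r k) n) <= 2 * 2^-1 ^+ k.
  move=> /subnK <-; apply: le_trans (rD _ _ _) _.
  by rewrite gerBl mulr_ge0 // ltW.
have lims n : exists l, forall e : R, 0 < e -> exists N, forall m, (N <= m)%N ->
    cnorm (val (r m) n - l) < e.
  apply: cnorm_complete => e e0; have [N hN] := @geom_small 2 (e / 2) (ltr0n _ 2) (divr_gt0 e0 (ltr0n _ 2)).
  exists N => p q Np Nq; rewrite (splitr e).
  apply: le_lt_trans (cdist_triangle (val (r N) n) _ _) _.
  apply: ltrD; first exact: le_lt_trans (rC _ _ _ Np) hN.
  by rewrite cdistC; exact: le_lt_trans (rC _ _ _ Nq) hN.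
have [f fP] := choice lims.
have rf k n : cnorm (val (r k) n - f n) <= 2 * 2^-1 ^+ k.
  apply/ler_addgt0Pr => e e0; have [N hN] := fP n e e0.
  apply: le_trans (cdist_triangle (val (r (maxn N k)) n) _ _) _.
  rewrite lerD //; first by rewrite cdistC rC // leq_maxr.
  by rewrite ltW // hN // leq_maxl.
have fb : exists M : R, forall n, cnorm (f n) <= M.
  have [M M0 hM] := bseqP0 (r 0%N); exists (M + 2) => n.
  rewrite -[f n](subrK (val (r 0%N) n)) addrC.
  apply: le_trans (cnormD _ _) _; rewrite lerD // cdistC.
  by have := rf 0%N n; rewrite expr0 mulr1.
exists (upi (mkbseq fb)) => k; rewrite -rx upiN upiD unormE.
by apply: ulim_le => n /=; exact: rf.
Qed.

Fact unormD x y : unorm (x + y) <= unorm x + unorm y.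
Proof.
elim/upiW: x => s; elim/upiW: y => t; rewrite upiD !unormE.
apply: (ler_cvg_to (ulim_cvg _) (cvgD (ulim_cvg s) (ulim_cvg t))).
by apply: nearW => n; exact: cnormD.
Qed.
Fact unormM x y : unorm (x * y) <= unorm x * unorm y.
Proof.
elim/upiW: x => s; elim/upiW: y => t; rewrite upiM !unormE.
apply: (ler_cvg_to (ulim_cvg _) (cvgM (ulim_cvg s) (ulim_cvg t))).
by apply: nearW => n; exact: cnormM.
Qed.
Fact unormZ (a : R[i]) x : unorm (a *: x) = normc a * unorm x.
Proof.
elim/upiW: x => s; rewrite upiZ !unormE; apply: ulim_eq.
have -> : (fun n => cnorm (val (bscale a s) n))
   = (fun n => normc a * cnorm (val s n)) by apply/funext => n; rewrite cnormZ.
by apply: cvgM; [exact: cvg_cst | exact: ulim_cvg].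
Qed.
Fact unorm_cstar x : unorm (ustar x * x) = unorm x ^+ 2.
Proof.
elim/upiW: x => s; rewrite ustarE upiM !unormE; apply: ulim_eq.
have -> : (fun n => cnorm (val (bmul (bstar s) s) n))
   = (fun n => cnorm (val s n) * cnorm (val s n)).
  by apply/funext => n; rewrite /= cnorm_cstar expr2.
by rewrite expr2; apply: cvgM; exact: ulim_cvg.
Qed.
Fact unorm_eq0 x : unorm x = 0 -> x = 0.
Proof.
elim/upiW: x => s; rewrite unormE => s0; apply/upi_eq/ueqvP => e e0.
have := @ulim_lt s e; rewrite s0 => /(_ e0); apply: filterS => n /=.
by rewrite subr0.
Qed.
Fact unormB x y : unorm (x - y) = unorm (y - x).
Proof.
rewrite -[in LHS]opprB -scaleN1r unormZ /= oppr0 sqrrN expr1n expr0n addr0.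
by rewrite sqrtr1 mul1r.
Qed.

Fact upow_complete (x : nat -> upow) :
  (forall e : R, 0 < e -> exists N, forall m n, (N <= m)%N -> (N <= n)%N ->
     unorm (x m - x n) < e) ->
  exists l, forall e : R, 0 < e -> exists N, forall n, (N <= n)%N ->
     unorm (x n - l) < e.
Proof.
move=> xC.
have half0 k : 0 < 2^-1 ^+ k :> R by rewrite exprn_gt0 ?invr_gt0.
have [N NP] := choice (fun k => xC _ (half0 k)).
pose M := fix M k := if k is k'.+1 then maxn (M k') (N k) else N 0%N.
have NM k : (N k <= M k)%N by case: k => //= k; rewrite leq_maxr.
have MS k : (M k <= M k.+1)%N by rewrite /= leq_maxl.
have fast k : unorm (x (M k.+1) - x (M k)) < 2^-1 ^+ k.
  by apply: NP; rewrite ?NM // (leq_trans (NM k)).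
have [l lP] := upow_lim_fast fast; exists l => e e0.
have [k hk] := @geom_small 3 e (ltr0n _ 3) e0.
exists (M k) => n Mn; rewrite -[x n - l](subrKA (x (M k))).
apply: le_lt_trans (unormD _ _) _; apply: le_lt_trans hk.
have -> : 3 * 2^-1 ^+ k = 2^-1 ^+ k + 2 * 2^-1 ^+ k :> R.
  by rewrite -[X in X + _]mul1r -mulrDl -natr1 addrC.
by rewrite lerD // ltW // NP // (leq_trans (NM k)).
Qed.

Lemma upow_cstar : @cstar_axioms R upow ustar unorm.
Proof.
split; [| | | | exact: unorm_eq0 | exact: unormD | exact: unormZ
  | exact: unormM | exact: unorm_cstar | exact: upow_complete].
- by elim/upiW => s; rewrite !ustarE; apply: upi_ext => n /=; rewrite starK.
- move=> x y; elim/upiW: x => s; elim/upiW: y => t.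
  rewrite (ustarE s) (ustarE t) [upi s + upi t]upiD ustarE upiD.
  by apply: upi_ext => n /=; exact: starD.
- move=> x y; elim/upiW: x => s; elim/upiW: y => t.
  rewrite (ustarE s) (ustarE t) [upi s * upi t]upiM ustarE upiM.
  by apply: upi_ext => n /=; exact: starM.
- move=> a x; elim/upiW: x => s.
  rewrite (ustarE s) [a *: upi s]upiZ ustarE upiZ.
  by apply: upi_ext => n /=; exact: starZ.
Qed.

Definition ultrapower : cstar R := CStar upow_cstar.

End Ultrapower.

Section Presentations.
Variable R : realType.

Record presentation (C : cstar R) : Type := Presentation {
  special :> nat -> C;
  special_generates : generates special }.

Definition computable_presentation (C : cstar R) (P : presentation C) : Prop :=
  exists2 f : nat -> nat, computable f &
    forall (p : starpoly nat) (k : nat),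
      `|cnorm (peval P p) - ratr (decode_rat (f (npair (code_poly p) k)))|
        < 2 ^- k.

(* Relations p_i = 0 (i < nrel) and ||x_k|| <= c_k (k < ngen), with c_k the
   dyadic rational a / 2^e for [bound k = (a, e)].  The distinguished unit
   generator is not one of the x_k: it is the constant 1 of [starpoly], so it is
   always interpreted by the unit. *)
Record relations : Type := Relations {
  ngen : nat;
  nrel : nat;
  rel : 'I_nrel -> starpoly 'I_ngen;
  bound : 'I_ngen -> nat * nat }.

Definition dyadic (d : nat * nat) : R := d.1%:R / 2 ^+ d.2.

Definition satisfies_upto (S : relations) (D : cstar R) (z : 'I_(ngen S) -> D)
    (e : R) : Prop :=
  (forall i, cnorm (peval z (rel i)) <= e) /\
  (forall k, cnorm (z k) <= dyadic (bound k) + e).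

(* A with the tuple x is the universal C*-algebra C*<x | S>. *)
Definition universal_for (S : relations) (A : cstar R) (x : 'I_(ngen S) -> A) :
    Prop :=
  satisfies_upto x 0 /\
  forall (D : cstar R) (z : 'I_(ngen S) -> D), satisfies_upto z 0 ->
    exists phi : starhom A D, (forall k, phi (x k) = z k) /\
      forall psi : starhom A D, (forall k, psi (x k) = z k) -> psi =1 phi.

(* The finite list x_0, ..., x_(j-1) of special points, continued by the unit
   generator. *)
Definition with_unit (A : cstar R) (j : nat) (x : 'I_j -> A) (n : nat) : A :=
  if insub n is Some k then x k else 1.

Definition standard_presentation (S : relations) (A : cstar R)
    (x : 'I_(ngen S) -> A) (P : presentation A) : Prop :=
  universal_for x /\ special P =1 with_unit x.

Definition weak_stability_modulus (S : relations) (A : cstar R)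
    (x : 'I_(ngen S) -> A) (f : nat -> nat) : Prop :=
  forall (n : nat) (D : cstar R) (z : 'I_(ngen S) -> D),
    satisfies_upto z (2 ^- f n) ->
    exists phi : starhom A D, forall k, cnorm (phi (x k) - z k) < 2 ^- n.

Definition computably_weakly_stable (A : cstar R) (P : presentation A) : Prop :=
  exists (S : relations) (x : 'I_(ngen S) -> A),
    standard_presentation x P /\
    exists2 f : nat -> nat, computable f & weak_stability_modulus x f.

Definition nonprincipal (U : set_system nat) : Prop := forall n, ~ U [set n].

(* In the sense of metric structures: a *-homomorphism preserving the norm. *)
Definition embeds (A B : cstar R) : Prop :=
  exists phi : starhom A B, forall a, cnorm (phi a) = cnorm a.

(* Restricted to separable C*-algebras: an ultrapower over nat of a separable
   algebra has at most the cardinality of the continuum, so it cannot contain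
   all C*-algebras. *)
Definition locally_universal (B : cstar R) : Prop :=
  forall A : cstar R, separable A ->
    exists (U : set_system nat) (UU : UltraFilter U),
      nonprincipal U /\ embeds A (ultrapower B UU).

End Presentations.

(* Main.v *)
(* The norm of a rational point of [A] is approximated from both sides by one
   enumeration.

   From above: call a bound on the norm of a *-polynomial in the generators
   provable if it follows from the relations by the *-algebra laws, the triangle
   inequality, submultiplicativity, ||p* || = ||p|| and the rule that
   ||p* p|| <= r^2 implies ||p|| <= r.  The infimum of the provable bounds is then by
   its very definition a C*-seminorm, and completing the *-polynomials for it yields
   a C*-algebra that satisfies the relations.  As A is universal and *-homomorphisms
   are contractive, this seminorm is at most the norm of A, hence equal to it.

   From below: since A embeds into an ultrapower of B, there are rational points of B
   that satisfy the relations up to 2^-f(n) and where p has almost its norm in A.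
   Conversely, by weak stability, each tuple of rational points that satisfies the
   relations up to 2^-f(n) is 2^-n-close to the image of the generators under a
   *-homomorphism A -> B, so that the norm of p there, less the Lipschitz error, is a
   lower bound of the norm of p in A.  Norms in B are computable.

   Contractivity uses no spectral theory: if h is self-adjoint with ||h|| < 1, then
   u = h + i sqrt(1 - h^2) is unitary and h = (u + u* )/2, so ||phi(h)|| <= 1. *)
Require Import Defs.
From HB Require Import structures.
From mathcomp Require Import all_boot all_order all_algebra.
From mathcomp Require Import complex ring lra zify.
From mathcomp Require Import all_classical all_reals all_analysis.

Set Implicit Arguments.
Unset Strict Implicit.
Unset Printing Implicit Defensive.

(** * Recursive functions *)

(** Lower bounds found in [B] approach the norm of [A] without any known rate, so an algorithm needs
    a certificate from above to know when to stop. The finitely many relations supply one, because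
    their consequences can be enumerated. Judgements are numbers and rules are total functions on
    numbers, so both kinds of bound come from the same stack machine and are matched by unbounded
    search. Real numbers never enter a rule: bounds are rational and side conditions are decidable
    comparisons of rationals. Completeness is therefore stated with some slack, and the last rule
    absorbs it by asking that the two bounds differ by less than 2^-k. The calculus speaks of
    distances ||p - q|| because terms are mere syntax: an algebraic law becomes a distance 0 between
    two terms. The infimum of the provable bounds might collapse to 0, and the zero algebra is not a
    [cstar]. Soundness in [A] excludes this: each provable bound for 1 is at least ||1|| = 1. Local
    universality applies to [A] because its rational points are dense, so that [A] is separable. *)

Definition pi1 (n : nat) : nat := (unpair n).1.
Definition pi2 (n : nat) : nat := (unpair n).2.

Lemma pi1K a b : pi1 (npair a b) = a. Proof. by rewrite /pi1 npairK. Qed.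
Lemma pi2K a b : pi2 (npair a b) = b. Proof. by rewrite /pi2 npairK. Qed.
Lemma npairE n : npair (pi1 n) (pi2 n) = n. Proof. exact: unpairK. Qed.
Definition piK := (pi1K, pi2K).

Lemma computable_ext f g : f =1 g -> computable f -> computable g.
Proof. by move=> fg [c cf]; exists c => n; rewrite -fg. Qed.

Lemma computable_comp f g :
  computable f -> computable g -> computable (fun n => f (g n)).
Proof. by move=> [c cf] [d dg]; exists (Comp c d) => n /=; exists (g n). Qed.

Lemma computable_pair f g :
  computable f -> computable g -> computable (fun n => npair (f n) (g n)).
Proof. by move=> [c cf] [d dg]; exists (Pair c d) => n /=; exists (f n), (g n). Qed.

Lemma computable_pi1 f : computable f -> computable (fun n => pi1 (f n)).
Proof. by move=> cf; apply: (@computable_comp pi1) cf; exists Fst. Qed.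

Lemma computable_pi2 f : computable f -> computable (fun n => pi2 (f n)).
Proof. by move=> cf; apply: (@computable_comp pi2) cf; exists Snd. Qed.

Lemma computable_id : computable id.
Proof. by exists (Pair Fst Snd) => n; exists (pi1 n), (pi2 n); rewrite npairE. Qed.

Lemma computable_succ f : computable f -> computable (fun n => (f n).+1).
Proof. by move=> cf; apply: (@computable_comp S) cf; exists Succ. Qed.

Lemma computable_cst c : computable (fun=> c).
Proof. by elim: c => [|c /computable_succ//]; exists Zero. Qed.

(** The step function gets parameter, counter and previous value packed as [PrimRec] passes them;
    the depth [h n] may vary with the argument. *)
Lemma computable_rec f g h (r : nat -> nat -> nat) :
  (forall n, r n 0 = f n) ->
  (forall n k, r n k.+1 = g (npair n (npair k (r n k)))) ->
  computable f -> computable g -> computable h ->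
  computable (fun n => r n (h n)).
Proof.
move=> r0 rS [c cf] [d dg] ch.
have [e eP] : computable (fun n => r (pi1 n) (pi2 n)).
  exists (PrimRec c d) => n; exists (r (pi1 n)); split=> // [|k _].
    by rewrite r0; exact: cf.
  by rewrite rS; exact: dg.
have cr : computable (fun n => r (pi1 n) (pi2 n)) by exists e.
apply: computable_ext (computable_comp cr (computable_pair computable_id ch)) => n.
by rewrite !piK.
Qed.

Lemma computable_add f g :
  computable f -> computable g -> computable (fun n => f n + g n).
Proof.
move=> cf cg; apply: (computable_rec (r := fun n k => f n + k)
  (g := fun n => (pi2 (pi2 n)).+1)) cf _ cg => [n|n k|].
- exact: addn0.
- by rewrite !piK addnS.
- exact/computable_succ/computable_pi2/computable_pi2/computable_id.
Qed.

Lemma computable_mul f g :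
  computable f -> computable g -> computable (fun n => f n * g n).
Proof.
move=> cf cg; apply: (computable_rec (r := fun n k => f n * k)
  (g := fun n => f (pi1 n) + pi2 (pi2 n))) (computable_cst 0) _ cg => [n|n k|].
- exact: muln0.
- by rewrite !piK mulnS.
- apply: computable_add; first exact/(computable_comp cf)/computable_pi1/computable_id.
  exact/computable_pi2/computable_pi2/computable_id.
Qed.

Lemma computable_iter s f g : computable s -> computable f -> computable g ->
  computable (fun n => iter (g n) s (f n)).
Proof.
move=> cs cf cg; apply: (computable_rec (r := fun n k => iter k s (f n))
  (g := fun n => s (pi2 (pi2 n)))) cf _ cg => [//|n k|].
- by rewrite !piK.
- exact/(computable_comp cs)/computable_pi2/computable_pi2/computable_id.
Qed.

Lemma computable_pow2 f : computable f -> computable (fun n => 2 ^ f n).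
Proof.
move=> cf; apply: computable_ext (computable_iter
  (computable_add computable_id computable_id) (computable_cst 1) cf) => n.
by elim: (f n) => //= k ->; rewrite addnn -mul2n expnS.
Qed.

Lemma computable_pred f : computable f -> computable (fun n => (f n).-1).
Proof.
move=> cf; apply: (computable_rec (r := fun=> predn) (f := fun=> 0)
  (g := fun n => pi1 (pi2 n))) (computable_cst 0) _ cf => [//|n k|].
- by rewrite !piK.
- exact/computable_pi1/computable_pi2/computable_id.
Qed.

Lemma computable_sub f g :
  computable f -> computable g -> computable (fun n => f n - g n).
Proof.
move=> cf cg; apply: computable_ext (computable_iter
  (computable_pred computable_id) cf cg) => n.
by elim: (g n) => [|k /= ->]; rewrite ?subn0 // subnS.
Qed.

Lemma computable_if (b : nat -> bool) f g : computable (fun n => b n : nat) ->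
  computable f -> computable g -> computable (fun n => if b n then f n else g n).
Proof.
move=> cb cf cg.
(* Both branches are total, so a case distinction is arithmetic with a factor 0 or 1. *)
apply: (computable_ext (f := fun n => b n * f n + (1 - b n) * g n)) => [n|].
  by case: (b n); rewrite /= ?mul1n ?mul0n ?addn0.
by do ?[apply: computable_add|apply: computable_mul|apply: computable_sub|
  exact: computable_cst|done].
Qed.

Lemma computable_leq f g :
  computable f -> computable g -> computable (fun n => f n <= g n).
Proof.
move=> cf cg.
apply: (computable_ext (f := fun n => 1 - (f n - g n))) => [n|].
  by rewrite /leq; case: (f n - g n).
exact/(computable_sub (computable_cst 1))/computable_sub.
Qed.

Lemma computable_and (b c : nat -> bool) : computable (fun n => b n : nat) ->
  computable (fun n => c n : nat) -> computable (fun n => b n && c n).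
Proof.
move=> cb cc; apply: computable_ext (computable_mul cb cc) => n.
by case: (b n) (c n) => [] [].
Qed.

Lemma computable_neg (b : nat -> bool) : computable (fun n => b n : nat) ->
  computable (fun n => ~~ b n).
Proof.
move=> cb; apply: computable_ext (computable_sub (computable_cst 1) cb) => n.
by case: (b n).
Qed.

Lemma computable_eq f g :
  computable f -> computable g -> computable (fun n => f n == g n).
Proof.
move=> cf cg; apply: computable_ext
  (computable_and (computable_leq cf cg) (computable_leq cg cf)) => n.
by rewrite -eqn_leq.
Qed.

Lemma computable_odd f : computable f -> computable (fun n => odd (f n)).
Proof.
move=> cf; apply: computable_ext (computable_iter
  (computable_sub (computable_cst 1) computable_id) (computable_cst 0) cf) => n.
by elim: (f n) => //= k ->; case: (odd k).
Qed.

Lemma computable_half f : computable f -> computable (fun n => (f n)./2).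
Proof.
(* The recursion is [k.+1./2 = odd k + k./2]. *)
move=> cf; apply: (computable_rec (r := fun=> half) (f := fun=> 0)
  (g := fun n => odd (pi1 (pi2 n)) + pi2 (pi2 n))) (computable_cst 0) _ cf => [//|n k|].
- by rewrite !piK /= uphalf_half.
- apply: computable_add; last exact/computable_pi2/computable_pi2/computable_id.
  exact/computable_odd/computable_pi1/computable_pi2/computable_id.
Qed.

Lemma computable_nth (s : seq nat) f :
  computable f -> computable (fun n => nth 0 s (f n)).
Proof.
elim: s f => [|x s IHs] f cf.
  by apply: computable_ext (computable_cst 0) => n; rewrite nth_nil.
apply: computable_ext (computable_if (computable_eq cf (computable_cst 0))
  (computable_cst x) (IHs _ (computable_pred cf))) => n.
by case: (f n).
Qed.

(** The existence hypothesis makes unbounded minimisation total; the value returned is [ex_minn]. *)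
Lemma computable_search t : computable t ->
  (forall n, exists m, t (npair n m) = 0) ->
  exists2 g, computable g & forall n, t (npair n (g n)) = 0.
Proof.
move=> [c ct] ex.
have ex' n : exists m, t (npair n m) == 0 by have [m /eqP] := ex n; exists m.
exists (fun n => ex_minn (ex' n)); last by move=> n; case: ex_minnP => m /eqP.
exists (Mu c) => n; case: ex_minnP => m /eqP tm mP; split=> [|k ltk].
  by rewrite -tm; exact: ct.
exists (t (npair n k)).-1; rewrite prednK; first exact: ct.
by rewrite lt0n; apply: contraL ltk => /mP; rewrite -leqNgt.
Qed.

Ltac computability := first [assumption | exact: computable_cst
  | exact: (computable_pi1 computable_id) | exact: (computable_pi2 computable_id) |
  lazymatch goal with
  | |- computable (fun n => n) => exact: computable_id
  | |- computable (fun n => npair _ _) => apply: computable_pair; computability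
  | |- computable (fun n => pi1 _) => apply: computable_pi1; computability
  | |- computable (fun n => pi2 _) => apply: computable_pi2; computability
  | |- computable (fun n => (_).+1) => apply: computable_succ; computability
  | |- computable (fun n => (_).-1) => apply: computable_pred; computability
  | |- computable (fun n => _ + _) => apply: computable_add; computability
  | |- computable (fun n => _ * _) => apply: computable_mul; computability
  | |- computable (fun n => 2 ^ _) => apply: computable_pow2; computability
  | |- computable (fun n => if _ then _ else _) =>
      apply: computable_if; computability
  | |- computable (fun n => nat_of_bool (_ <= _)) =>
      apply: computable_leq; computability
  | |- computable (fun n => nat_of_bool (_ == _)) =>
      apply: computable_eq; computability
  | |- computable (fun n => nat_of_bool (_ && _)) =>
      apply: computable_and; computability
  | |- computable (fun n => nat_of_bool (~~ _)) =>
      apply: computable_neg; computability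
  | |- computable (fun n => nat_of_bool (odd _)) =>
      apply: computable_odd; computability
  | |- computable (fun n => half _) => apply: computable_half; computability
  | |- computable (fun n => nth 0 _ _) => apply: computable_nth; computability
  | H : computable ?f |- computable (fun n => ?f _) =>
      apply: (computable_comp H); computability
  | |- _ => idtac
  end].

(** * Derivations from a finite list of rules, run on a stack *)

Section RuleMachine.
Variable rules : seq (nat -> nat -> nat -> nat).

(** Every rule is a total function of a parameter [w] and two premises. When a side condition fails
    it can return the trivial conclusion 0, which is therefore an axiom. *)
Inductive provable : nat -> Prop :=
  | provable0 : provable 0
  | provable_rule i w a b :
      provable a -> provable b -> provable (nth (fun _ _ _ => 0) rules i w a b).

(* A derivation is run in postfix order on a stack of conclusions.  A stack is a
   nested pair, and the stack code 0 stands for infinitely many zeros. *)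
Definition machine_step (s : nat) : nat :=
  let ins := pi1 (pi2 s) in let st := pi1 s in
  npair
    (if ins == 0 then npair 0 st else
     npair (nth (fun _ _ _ => 0) rules (pi1 ins.-1) (pi2 ins.-1)
              (pi1 st) (pi1 (pi2 st)))
       (pi2 (pi2 st)))
    (pi2 (pi2 s)).

Lemma machine_stepE s c l : machine_step (npair s (npair c l)) =
  npair (if c == 0 then npair 0 s else
    npair (nth (fun _ _ _ => 0) rules (pi1 c.-1) (pi2 c.-1) (pi1 s) (pi1 (pi2 s)))
      (pi2 (pi2 s))) l.
Proof. by rewrite /machine_step !piK. Qed.

Definition machine (n : nat) : nat :=
  pi1 (pi1 (iter (pi1 n) machine_step (npair 0 (pi2 n)))).

(** Invariant of the run: the entries of the stack are provable at every depth. The initial stack 0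
    has this property since all its entries are 0. *)
Lemma machine_sound n : provable (machine n).
Proof.
have : forall k, provable (pi1 (iter k pi2 (npair 0 0))).
  elim=> [|k]; first by rewrite /= pi1K; exact: provable0.
  by rewrite iterSr piK.
have -> : npair 0 0 = 0 by [].
rewrite /machine; move: (pi2 n) 0 => l.
elim: (pi1 n) l => [|m IH] l s sP.
  by rewrite /= pi1K; exact: (sP 0).
rewrite iterSr {2}/machine_step !piK; apply: IH => k.
case: ifP => _.
  by case: k => [|k]; [rewrite /= pi1K; exact: provable0|rewrite iterSr piK].
case: k => [|k].
  by rewrite /= pi1K; apply: provable_rule; [exact: (sP 0)|exact: (sP 1)].
by have := sP k.+2; rewrite !iterSr piK.
Qed.

Lemma machine_complete j : provable j -> exists n, machine n = j.
Proof.
(* Continuation form: a derivation is a prefix [f] of instructions that works for any stack, any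
   remaining program and any number of further steps, so derivations compose. *)
suff exec : provable j -> exists (f : nat -> nat) m, forall s l k,
    iter (m + k) machine_step (npair s (f l))
      = iter k machine_step (npair (npair j s) l).
  move=> /exec[f [m E]]; exists (npair m (f 0)).
  by rewrite /machine !piK -[m]addn0 E /= !piK.
elim=> [|i w a b _ [f [m fE]] _ [g [p gE]]].
  exists (npair 0), 1 => s l k.
  by rewrite add1n iterSr machine_stepE.
(* The derivation of [b] runs first, so that [a] ends on top. The successor separates rule
   instructions from the instruction 0, which pushes 0. *)
exists (fun l => g (f (npair (npair i w).+1 l))), (p + (m + 1)) => s l k.
by rewrite -!addnA gE fE add1n iterSr machine_stepE /= !piK.
Qed.

Lemma machine_computable :
  (forall i, i < size rules -> computable (fun n =>
     nth (fun _ _ _ => 0) rules i (pi1 n) (pi1 (pi2 n)) (pi2 (pi2 n)))) ->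
  computable machine.
Proof.
move=> crules.
(* The rule number is read from the instruction, so selecting the rule is itself a computation:
   nested case distinctions along the finite list. *)
have crule f w a b : computable f -> computable w -> computable a -> computable b ->
    computable (fun n => nth (fun _ _ _ => 0) rules (f n) (w n) (a n) (b n)).
  move=> cf cw ca cb; elim: rules crules f cf => [|r rs IH] cr f cf.
    by apply: computable_ext (computable_cst 0) => n; rewrite nth_nil.
  have c0 := cr 0 isT.
  have cp : computable (fun n => npair (w n) (npair (a n) (b n))) by computability.
  have c1 := IH (fun i => cr i.+1) _ (computable_pred cf).
  apply: computable_ext (computable_if (computable_eq cf (computable_cst 0))
    (computable_comp c0 cp) c1) => n.
  by rewrite !piK; case: (f n).
have cstep : computable machine_step.
  rewrite /machine_step; computability.
  by apply: crule; computability.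
rewrite /machine; do 2!apply: computable_pi1.
by apply: (computable_iter cstep); computability.
Qed.

End RuleMachine.

Import Order.TTheory GRing.Theory Num.Theory.
Import numFieldNormedType.Exports.
Import ComplexField.Normc.

Local Open Scope classical_set_scope.
Local Open Scope ring_scope.

(** * Contractivity of *-homomorphisms *)

Section Contractivity.
Variable R : realType.

Lemma normc_real (r : R) : normc (Complex r 0) = `|r|.
Proof. by rewrite /= expr0n addr0 sqrtr_sqr. Qed.

(** Uniqueness of limits in the form used below; [c] absorbs the factors of the estimates. *)
Lemma cnorm_sub_eq (A : cstar R) (x y : A) (c : R) :
  (forall e : R, 0 < e -> cnorm (x - y) <= c * e) -> x = y.
Proof.
move=> le_c; apply/eqP; rewrite -subr_eq0; apply/eqP/cnorm_eq0/eqP.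
rewrite eq_le cnorm_ge0 andbT; apply/ler_addgt0Pr => e e0; rewrite add0r.
have c0 : 0 < 1 + `|c| by rewrite ltr_wpDr.
apply: le_trans (le_c _ (divr_gt0 e0 c0)) _.
rewrite mulrCA ger_pMr // ler_pdivrMr // mul1r.
by rewrite (le_trans (ler_norm c)) // lerDr.
Qed.

Lemma star1 (A : cstar R) : star (1 : A) = 1.
Proof. by have := starM (star (1 : A)) 1; rewrite mulr1 starK mulr1. Qed.

Lemma cnorm1 (A : cstar R) : cnorm (1 : A) = 1.
Proof.
have := cnorm_cstar (1 : A); rewrite star1 mul1r expr2 => /esym/eqP.
by rewrite -subr_eq0 -{3}[cnorm _]mulr1 -mulrBr mulf_eq0 subr_eq0 (negPf (cnorm1_neq0 A)) => /eqP.
Qed.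

(** * A square root of 1 - k from the fixed point of a contraction *)

Section SquareRoot.
Variables (A : cstar R) (k : A).
Hypotheses (k_sa : star k = k) (k_lt1 : cnorm k < 1).

Let half : R[i] := Complex 2^-1 0.
(** A fixed point l = (k + l^2)/2 satisfies (1 - l)^2 = 1 - k, so 1 - l is the square root
    sought. *)
Let w n := iter n (fun x : A => half *: (k + x * x)) 0.

Let cnorm_half (x : A) : cnorm (half *: x) = 2^-1 * cnorm x.
Proof. by rewrite cnormZ normc_real ger0_norm. Qed.

Let half2 (x : A) : half *: x + half *: x = x.
Proof.
rewrite -scalerDl -[RHS]scale1r; congr (_ *: _).
by apply/eqP; rewrite eq_complex /= addr0 eqxx andbT -[2^-1]mul1r -splitr.
Qed.

Let w_le n : cnorm (w n) <= cnorm k.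
Proof.
elim: n => [|n IH]; first by rewrite cnorm0 cnorm_ge0.
rewrite /= cnorm_half -/(w n).
have := cnormD k (w n * w n); have := cnormM (w n) (w n).
have w0 := cnorm_ge0 (w n); have : cnorm (w n) ^+ 2 <= cnorm k.
  rewrite expr2 -[leRHS]mulr1 ler_pM //; exact: le_trans IH (ltW k_lt1).
rewrite expr2; lra.
Qed.

(** On the ball of radius ||k|| one has ||x|| + ||y|| <= 2 ||k||, and the factor 1/2 leaves the
    contraction ratio ||k|| < 1. *)
Let square_diff (x y : A) : cnorm x <= cnorm k -> cnorm y <= cnorm k ->
  cnorm (half *: (k + x * x) - half *: (k + y * y)) <= cnorm k * cnorm (x - y).
Proof.
move=> xk yk; rewrite -scalerBr cnorm_half opprD addrACA subrr add0r.
have -> : x * x - y * y = x * (x - y) + (x - y) * y.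
  by rewrite mulrBr mulrBl addrA subrK.
have := cnormD (x * (x - y)) ((x - y) * y).
have := cnormM x (x - y); have := cnormM (x - y) y.
have := cnorm_ge0 (x - y); nra.
Qed.

Let w_step n : cnorm (w n.+1 - w n) <= cnorm k ^+ n.
Proof.
elim: n => [|n IH].
  by rewrite subr0 (le_trans (w_le 1)) // ltW.
apply: (le_trans (square_diff (w_le n.+1) (w_le n))).
by rewrite exprS ler_wpM2l ?cnorm_ge0.
Qed.

Let w_dist n m : cnorm (w (m + n) - w n) <= cnorm k ^+ n / (1 - cnorm k).
Proof.
have k1 : 0 < 1 - cnorm k by rewrite subr_gt0.
have k0 := cnorm_ge0 k.
(* With the tail subtracted, the geometric bound telescopes in the induction on [m]. *)
suff : cnorm (w (m + n) - w n) <= (cnorm k ^+ n - cnorm k ^+ (m + n)) / (1 - cnorm k).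
  move=> /le_trans; apply; rewrite ler_pM2r ?invr_gt0 //.
  by rewrite gerBl exprn_ge0.
elim: m => [|m IH]; first by rewrite !subrr cnorm0 mul0r.
apply: le_trans (cdist_triangle (w (m + n)) _ _) _.
apply: le_trans (lerD (w_step (m + n)) IH) _.
rewrite addSn -[X in X + _](mulfK (lt0r_neq0 k1)) -mulrDl ler_pM2r ?invr_gt0 //.
by rewrite exprS le_eqVlt; apply/orP; left; apply/eqP; ring.
Qed.

Let w_cvg : exists2 l, cnorm l <= cnorm k &
  forall e : R, 0 < e -> exists n, cnorm (w n - l) < e /\ cnorm (w n.+1 - l) < e.
Proof.
have k1 : 0 < 1 - cnorm k by rewrite subr_gt0.
have cauchy (e : R) : 0 < e -> exists N, forall m n, (N <= m)%N -> (N <= n)%N ->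
    cnorm (w m - w n) < e.
  move=> e0; have e1 : 0 < e / 2 * (1 - cnorm k) by rewrite !mulr_gt0.
  have : (fun n => cnorm k ^+ n) @ \oo --> (0 : R).
    by apply: cvg_expr; rewrite ger0_norm ?cnorm_ge0.
  move=> /cvgrPdist_lt/(_ _ e1)[N _ NP]; exists N => m n Nm Nn.
  have {}NP : cnorm k ^+ N / (1 - cnorm k) < e / 2.
    rewrite ltr_pdivrMr //; have /= := NP N (leqnn N).
    by rewrite sub0r normrN ger0_norm ?exprn_ge0 ?cnorm_ge0.
  rewrite (splitr e); apply: le_lt_trans (cdist_triangle (w N) _ _) _.
  rewrite ltrD // (le_lt_trans _ NP) //.
    by rewrite -(subnK Nm); exact: w_dist.
  by rewrite cdistC -(subnK Nn); exact: w_dist.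
have [l lP] := cnorm_complete cauchy; exists l.
  apply/ler_addgt0Pr => e /lP[N /(_ N (leqnn N))] h.
  have := cnormD (w N) (l - w N); rewrite subrKC cdistC.
  by move=> /le_trans; apply; rewrite lerD ?w_le // ltW // cdistC.
by move=> e /lP[N NP]; exists N; split; apply: NP.
Qed.

(** Self-adjointness and commutation pass from the iterates, which are polynomials in [k], to the
    limit. Commutation with [h] is what makes h + i sqrt(1 - h^2) unitary below. *)
Lemma cstar_sqrt_sub1 : exists y : A,
  [/\ star y = y, y * y = 1 - k & forall h, h * k = k * h -> h * y = y * h].
Proof.
have [l l_le lP] := w_cvg.
have w_comm n h : h * k = k * h -> h * w n = w n * h.
  move=> hk; elim: n => [|n IH] /=; first by rewrite mulr0 mul0r.
  by rewrite -/(w n) -scalerAr -scalerAl mulrDr mulrDl hk mulrA IH -!mulrA IH.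
have w_sa n : star (w n) = w n.
  elim: n => [|n IH] /=; first by rewrite -(subrr 0) starB !subrr.
  by rewrite -/(w n) starZ starD starM k_sa IH /conjc /= oppr0.
have lE : half *: (k + l * l) = l.
  apply: (cnorm_sub_eq (c := 2)) => e /lP[n [h1 h2]].
  apply: le_trans (cdist_triangle (w n.+1) _ _) _.
  rewrite mulr_natl mulr2n lerD //; last exact: ltW.
  rewrite cdistC; apply: le_trans (square_diff (w_le n) l_le) _.
  by apply: le_trans (ltW h1); rewrite ler_piMl ?cnorm_ge0 // ltW.
have l_sa : star l = l.
  apply: (cnorm_sub_eq (c := 2)) => e /lP[n [h1 h2]].
  apply: le_trans (cdist_triangle (w n) _ _) _.
  rewrite mulr_natl mulr2n lerD // ?ltW //.
  by rewrite -[w n]w_sa -starB cnorm_star cdistC.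
exists (1 - l); split.
- by rewrite starB star1 l_sa.
- have kE : k = l + l - l * l.
    by rewrite -{1 2}lE half2 addrK.
  rewrite mulrBr mulr1 mulrBl mul1r [in RHS]kE !opprB opprD -addrA.
  by congr (_ + _); rewrite addrCA.
- move=> h hk; rewrite mulrBr mulrBl mulr1 mul1r; congr (_ - _).
  apply: (cnorm_sub_eq (c := cnorm h + cnorm h)) => e /lP[n [h1 h2]].
  apply: le_trans (cdist_triangle (h * w n) _ _) _.
  rewrite [in X in _ + X](w_comm _ _ hk) -mulrBr -mulrBl [leRHS]mulrDl.
  apply: lerD; apply: le_trans (cnormM _ _) _.
    by rewrite ler_wpM2l ?cnorm_ge0 // cdistC ltW.
  by rewrite mulrC ler_wpM2l ?cnorm_ge0 // ltW.
Qed.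

End SquareRoot.

Lemma starhom_sa_le1 (A D : cstar R) (phi : starhom A D) (h : A) :
  star h = h -> cnorm h < 1 -> cnorm (phi h) <= 1.
Proof.
move=> h_sa h_lt1.
have hh_sa : star (h * h) = h * h by rewrite starM h_sa.
have hh_lt1 : cnorm (h * h) < 1.
  by apply: le_lt_trans (cnormM _ _) _; rewrite -expr2 expr_lt1 ?cnorm_ge0.
have [y [y_sa yy /(_ h (mulrA _ _ _)) hy]] := cstar_sqrt_sub1 hh_sa hh_lt1.
pose u := h + 'i%C *: y.
have su : star u = h - 'i%C *: y.
  rewrite starD starZ h_sa y_sa -scaleNr; congr (_ + _ *: _).
  by apply/eqP; rewrite eq_complex /= oppr0 !eqxx.
have ii : 'i%C * 'i%C = -1 :> R[i] by rewrite -expr2 sqr_i.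
have uu : star u * u = 1.
  rewrite su mulrDr !mulrBl -!scalerAl -!scalerAr scalerA ii scaleN1r.
  by rewrite opprK yy hy addrA subrK subrKC.
have nu : cnorm (phi u) = 1.
  have : cnorm (phi u) ^+ 2 = 1.
    by rewrite -cnorm_cstar -starhom_star -rmorphM uu rmorph1 cnorm1.
  by move=> /eqP; rewrite sqrp_eq1 ?cnorm_ge0 // => /eqP.
have nus : cnorm (phi (star u)) = 1 by rewrite starhom_star cnorm_star.
have uE : u + star u = h + h by rewrite su addrACA subrr addr0.
have phE : phi h + phi h = phi u + phi (star u) by rewrite -!raddfD uE.
have := cnormD (phi u) (phi (star u)); rewrite -phE nu nus.
have -> : phi h + phi h = (Complex 2 0) *: phi h.
  rewrite -[phi h in LHS]scale1r -scalerDl; congr (_ *: _).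
  by apply/eqP; rewrite eq_complex /= addr0 !eqxx.
rewrite cnormZ normc_real ger0_norm //; lra.
Qed.

Lemma starhom_contractive (A D : cstar R) (phi : starhom A D) (a : A) :
  cnorm (phi a) <= cnorm a.
Proof.
have sa_le (h : A) : star h = h -> cnorm (phi h) <= cnorm h.
  move=> h_sa; apply/ler_addgt0Pr => e e0.
  have r0 : 0 < cnorm h + e by rewrite ltr_wpDl ?cnorm_ge0.
  have i0 : 0 <= (cnorm h + e)^-1 by rewrite invr_ge0 ltW.
  (* Dividing by ||h|| + e brings the norm strictly below 1, also when h = 0. *)
  have := @starhom_sa_le1 A D phi (Complex (cnorm h + e)^-1 0 *: h).
  rewrite starZ h_sa /= oppr0 linearZ !cnormZ normc_real (ger0_norm i0).
  rewrite !(mulrC (_^-1)).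
  rewrite ltr_pdivrMr // mul1r ltrDl ler_pdivrMr // mul1r.
  exact.
(* The C*-identity reduces a general [a] to the self-adjoint [star a * a]. *)
have := sa_le (star a * a); rewrite starM starK => /(_ erefl).
have -> : phi (star a * a) = star (phi a) * phi a by rewrite -starhom_star -rmorphM.
by rewrite !cnorm_cstar ler_sqr ?nnegrE ?cnorm_ge0.
Qed.

End Contractivity.

(** * Completion of the *-polynomials for a C*-seminorm *)

Fixpoint psubst (V W : Type) (s : V -> starpoly W) (p : starpoly V) : starpoly W :=
  match p with
  | PVar v => s v
  | PConst a b d => PConst W a b d
  | PAdd p q => PAdd (psubst s p) (psubst s q)
  | PMul p q => PMul (psubst s p) (psubst s q)
  | PStar p => PStar (psubst s p)
  end.

Lemma peval_psubst (R : realType) (A : cstar R) (V W : Type) (x : W -> A)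
    (s : V -> starpoly W) (p : starpoly V) :
  peval x (psubst s p) = peval (fun v => peval x (s v)) p.
Proof. by elim: p => //= [p -> q ->|p -> q ->|p ->]. Qed.

Definition pzero V := PConst V 0 0 0.
Definition pone V := PConst V 1 0 0.
Definition popp V (p : starpoly V) := PMul (PConst V (-1) 0 0) p.
Definition psub V (p q : starpoly V) := PAdd p (popp q).

(* The variables 0, 1, 2 are metavariables. *)
Definition star_laws : seq (starpoly nat * starpoly nat) :=
  let x := PVar 0%N in let y := PVar 1%N in let z := PVar 2%N in
  [:: (PAdd x (PAdd y z), PAdd (PAdd x y) z);
      (PAdd x y, PAdd y x);
      (PAdd (pzero nat) x, x);
      (PAdd (popp x) x, pzero nat);
      (PMul x (PMul y z), PMul (PMul x y) z);
      (PMul (pone nat) x, x);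
      (PMul x (pone nat), x);
      (PMul (PAdd x y) z, PAdd (PMul x z) (PMul y z));
      (PMul x (PAdd y z), PAdd (PMul x y) (PMul x z));
      (PStar (PStar x), x);
      (PStar (PAdd x y), PAdd (PStar x) (PStar y));
      (PStar (PMul x y), PMul (PStar y) (PStar x))].

Definition star_law i := nth (PVar 0%N, PVar 0%N) star_laws i.

Definition gauss (R : realType) (c : int * int * nat) : R[i] :=
  Complex (c.1.1%:~R / c.2.+1%:R) (c.1.2%:~R / c.2.+1%:R).
Definition pgauss V (c : int * int * nat) := PConst V c.1.1 c.1.2 c.2.

Section Completion.
Variable R : realType.
Notation term := (starpoly nat).
Notation G := (@gauss R).
Notation K := (@pgauss nat).

(** Laws are distances 0; constants are formal Gaussian rationals, controlled through their values.
    One half of the C*-identity is an axiom, the other follows from submultiplicativity. [dst_one]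
    keeps the completion nonzero. *)
Record cstar_pseudometric (dst : term -> term -> R) : Prop := CStarPseudometric {
  dst_refl : forall p, dst p p = 0;
  dst_sym : forall p q, dst p q = dst q p;
  dst_tri : forall q p r, dst p r <= dst p q + dst q r;
  dst_add : forall p p' q q',
    dst (PAdd p q) (PAdd p' q') <= dst p p' + dst q q';
  dst_star : forall p q, dst (PStar p) (PStar q) <= dst p q;
  dst_mull : forall p q s,
    dst (PMul p s) (PMul q s) <= dst p q * dst s (pzero nat);
  dst_mulr : forall p q s,
    dst (PMul s p) (PMul s q) <= dst s (pzero nat) * dst p q;
  dst_cstar : forall p,
    dst p (pzero nat) ^+ 2 <= dst (PMul (PStar p) p) (pzero nat);
  dst_law : forall i s, dst (psubst s (star_law i).1) (psubst s (star_law i).2) = 0;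
  dst_const : forall c c', dst (K c) (K c') <= normc (G c - G c');
  dst_constD : forall c c' c'',
    dst (PAdd (K c) (K c')) (K c'') <= normc (G c + G c' - G c'');
  dst_constM : forall c c' c'',
    dst (PMul (K c) (K c')) (K c'') <= normc (G c * G c' - G c'');
  dst_constS : forall c c',
    dst (PStar (K c)) (K c') <= normc (conjc (G c) - G c');
  dst_constC : forall c p, dst (PMul (K c) p) (PMul p (K c)) = 0;
  dst_one : 0 < dst (pone nat) (pzero nat) }.

Lemma normc_ge0 (a : R[i]) : 0 <= normc a.
Proof. by case: a => x y; rewrite /= sqrtr_ge0. Qed.

Lemma normc_le_abs (x y : R) : normc (Complex x y) <= `|x| + `|y|.
Proof.
have s0 : 0 <= `|x| + `|y| by rewrite addr_ge0.
rewrite /= -[leRHS]ger0_norm // -sqrtr_sqr ler_wsqrtr //.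
rewrite sqrrD !real_normK ?num_real // addrAC lerDl.
by rewrite mulrn_wge0 // mulr_ge0.
Qed.

Lemma normcD (a b : R[i]) : normc (a + b) <= normc a + normc b.
Proof. exact: (@le_normcD R a b). Qed.

Lemma normc_distC (a b : R[i]) : normc (a - b) = normc (b - a).
Proof. by rewrite -(@normcN R (a - b)) opprB. Qed.

Definition gauss_approx (a : R[i]) (n : nat) : int * int * nat :=
  (Num.floor (complex.Re a * n.+1%:R), Num.floor (complex.Im a * n.+1%:R), n).

Lemma gauss_approxP (a : R[i]) (n : nat) :
  normc (G (gauss_approx a n) - a) <= 2 / n.+1%:R.
Proof.
have fl (x : R) : `|(Num.floor (x * n.+1%:R))%:~R / n.+1%:R - x| <= n.+1%:R^-1.
  have n0 : 0 < n.+1%:R :> R by [].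
  have xE : x = x * n.+1%:R / n.+1%:R by rewrite mulfK.
  rewrite {2}xE -mulrBl normrM (ger0_norm (_ : 0 <= n.+1%:R^-1)) //.
  rewrite -[leRHS]mul1r ler_pM2r // distrC ger0_norm ?subr_ge0 ?ge_floor //.
  rewrite lerBlDl ltW //; have := floorD1_gt (x * n.+1%:R).
  by rewrite intrD.
case: a => x y; apply: le_trans (normc_le_abs _ _) _.
by rewrite mulr2n mulrDl mul1r; apply: lerD; exact: fl.
Qed.

(** Two indices, so that [clim s s] below is the Cauchy condition; a statement about one index is
    constant in the other. *)
Definition eventually (P : nat -> nat -> Prop) : Prop :=
  exists N, forall m n, (N <= m)%N -> (N <= n)%N -> P m n.

Lemma eventually_mono (P Q : nat -> nat -> Prop) :
  (forall m n, P m n -> Q m n) -> eventually P -> eventually Q.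
Proof. by move=> PQ [N NP]; exists N => m n Nm Nn; apply/PQ/NP. Qed.

Lemma eventually_and (P Q : nat -> nat -> Prop) :
  eventually P -> eventually Q -> eventually (fun m n => P m n /\ Q m n).
Proof.
move=> [N NP] [M MQ]; exists (maxn N M) => m n.
by rewrite !geq_max => /andP[Nm Mm] /andP[Nn Mn]; split; [apply: NP|apply: MQ].
Qed.

Lemma eventually2 (P Q S : nat -> nat -> Prop) :
  (forall m n, P m n -> Q m n -> S m n) ->
  eventually P -> eventually Q -> eventually S.
Proof.
by move=> PQS eP eQ; apply: eventually_mono (eventually_and eP eQ) => m n []; exact: PQS.
Qed.

Lemma eventually_swap (P : nat -> nat -> Prop) :
  eventually P -> eventually (fun m n => P n m).
Proof. by move=> [N NP]; exists N => m n Nm Nn; exact: NP. Qed.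

Lemma gauss_approx_cvg (a : R[i]) (e : R) : 0 < e ->
  eventually (fun m _ => normc (G (gauss_approx a m) - a) < e).
Proof.
move=> e0; exists (Num.bound (2 / e)) => m _ Nm _.
apply: le_lt_trans (gauss_approxP _ _) _.
rewrite ltr_pdivrMr // mulrC -ltr_pdivrMr //.
apply: lt_trans (archi_boundP (divr_ge0 _ (ltW e0))) _ => //.
by rewrite ltr_nat ltnS.
Qed.

Section Quotient.
Variable dst : term -> term -> R.
Hypothesis H : cstar_pseudometric dst.

Local Notation nrm p := (dst p (pzero nat)).

Definition clim (s t : nat -> term) : Prop :=
  forall e, 0 < e -> eventually (fun m n => dst (s m) (t n) < e).

Lemma dst_ge0 p q : 0 <= dst p q.
Proof.
have := dst_tri H q p p; rewrite (dst_refl H) (dst_sym H q p) -mulr2n.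
by rewrite pmulrn_lge0.
Qed.

Let sigma (p q r : term) (i : nat) : term := nth p [:: p; q; r] i.

(** Translation invariance is derived: adding [popp q] and then [q] does not increase distances, and
    the two cancel up to distance 0. *)
Lemma dst_sub p q : dst (psub p q) (pzero nat) = dst p q.
Proof.
have addN r : dst (PAdd (popp r) r) (pzero nat) = 0 := dst_law H 3 (sigma r r r).
have addC r s : dst (PAdd r s) (PAdd s r) = 0 := dst_law H 1 (sigma r s s).
have add0 r : dst (PAdd (pzero nat) r) r = 0 := dst_law H 2 (sigma r r r).
have addA r s t : dst (PAdd r (PAdd s t)) (PAdd (PAdd r s) t) = 0
  := dst_law H 0 (sigma r s t).
apply/eqP; rewrite eq_le; apply/andP; split.
  apply: le_trans (dst_tri H (psub q q) _ _) _.
  have h : dst (psub q q) (pzero nat) <= 0.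
    apply: le_trans (dst_tri H (PAdd (popp q) q) _ _) _.
    by rewrite /psub addC addN addr0.
  have := dst_add H p q (popp q) (popp q); rewrite (dst_refl H) addr0.
  rewrite -/(psub p q) -/(psub q q); lra.
have h1 : dst p (PAdd (psub p q) q) <= 0.
  apply: le_trans (dst_tri H (PAdd p (PAdd (popp q) q)) _ _) _.
  rewrite /psub addA addr0; apply: le_trans (dst_tri H (PAdd p (pzero nat)) _ _) _.
  have := dst_tri H (PAdd (pzero nat) p) p (PAdd p (pzero nat)).
  rewrite addC (dst_sym H p (PAdd (pzero nat) p)) add0.
  have := dst_add H p p (pzero nat) (PAdd (popp q) q).
  rewrite (dst_refl H) (dst_sym H (pzero nat)) addN; lra.
have h2 := dst_add H (psub p q) (pzero nat) q q.
have h3 := dst_tri H (PAdd (psub p q) q) p q.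
have h4 := dst_tri H (PAdd (pzero nat) q) (PAdd (psub p q) q) q.
move: h2 h4; rewrite add0 (dst_refl H); lra.
Qed.

Lemma dst_nrm p q : `|nrm p - nrm q| <= dst p q.
Proof.
rewrite ler_norml; have := dst_tri H q p (pzero nat).
by have := dst_tri H p q (pzero nat); rewrite (dst_sym H q p); lra.
Qed.

Lemma clim_sym s t : clim s t -> clim t s.
Proof.
move=> st e /st; move/eventually_swap.
by apply: eventually_mono => m n; rewrite (dst_sym H).
Qed.

Lemma clim_trans t s r : clim s t -> clim t r -> clim s r.
Proof.
move=> st tr e e0; have e20 : 0 < e / 2 by rewrite divr_gt0.
have [N NP] := st _ e20; have [M MP] := tr _ e20.
exists (maxn N M) => m n.
rewrite !geq_max => /andP[Nm _] /andP[_ Mn]; rewrite (splitr e).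
apply: le_lt_trans (dst_tri H (t (maxn N M)) _ _) _.
by apply: ltrD; [apply: NP|apply: MP]; rewrite // leq_max leqnn ?orbT.
Qed.

Lemma clim_eq s t : clim s s -> (forall n, dst (s n) (t n) = 0) -> clim s t.
Proof.
move=> ss st e /ss; apply: eventually_mono => m n h.
by apply: le_lt_trans h; apply: le_trans (dst_tri H (s n) _ _) _; rewrite st addr0.
Qed.

Lemma clim_cst p : clim (fun=> p) (fun=> p).
Proof. by move=> e e0; exists 0%N => m n _ _; rewrite (dst_refl H). Qed.

Lemma clim_add s s' t t' : clim s s' -> clim t t' ->
  clim (fun n => PAdd (s n) (t n)) (fun n => PAdd (s' n) (t' n)).
Proof.
move=> ss tt e e0; have e20 : 0 < e / 2 by rewrite divr_gt0.
apply: eventually2 (ss _ e20) (tt _ e20) => m n h1 h2.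
by rewrite (splitr e); apply: le_lt_trans (dst_add H _ _ _ _) (ltrD h1 h2).
Qed.

Lemma clim_star s s' : clim s s' ->
  clim (fun n => PStar (s n)) (fun n => PStar (s' n)).
Proof.
move=> ss e /ss; apply: eventually_mono => m n.
exact: le_lt_trans (dst_star H _ _).
Qed.

Lemma clim_bounded s t : clim s t -> exists2 b, 0 < b &
  eventually (fun m _ => nrm (s m) < b).
Proof.
move=> /(_ _ ltr01)[N NP]; exists (1 + nrm (t N)).
  by rewrite ltr_pwDl // dst_ge0.
exists N => m _ Nm _; apply: le_lt_trans (dst_tri H (t N) _ _) _.
by rewrite ltrD2r NP.
Qed.

Lemma clim_mul s s' t t' : clim s s' -> clim t t' ->
  clim (fun n => PMul (s n) (t n)) (fun n => PMul (s' n) (t' n)).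
Proof.
move=> ss tt e e0.
have [a a0 sa] := clim_bounded (clim_sym ss); have [b b0 tb] := clim_bounded tt.
have e20 : 0 < e / 2 by rewrite divr_gt0.
have h1 := eventually_and (ss _ (divr_gt0 e20 b0)) tb.
have h2 := eventually_and (tt _ (divr_gt0 e20 a0)) (eventually_swap sa).
apply: eventually2 h1 h2 => m n [d1 tm] [d2 sn].
apply: le_lt_trans (dst_tri H (PMul (s' n) (t m)) _ _) _.
rewrite (splitr e); apply: ltr_leD.
  apply: le_lt_trans (dst_mull H _ _ _) _.
  rewrite ltr_pdivlMr // in d1; apply: le_lt_trans d1.
  by rewrite ler_wpM2l ?dst_ge0 // ltW.
apply: le_trans (dst_mulr H _ _ _) _.
rewrite ltr_pdivlMr // in d2; apply: le_trans (ltW d2).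
by rewrite mulrC ler_wpM2l ?dst_ge0 // ltW.
Qed.

(** With Cauchy sequences of terms, a single quotient both identifies terms at distance 0 and
    completes. *)
Definition cauchy_term : Type := {s : nat -> term | `[< clim s s >]}.
HB.instance Definition _ := gen_eqMixin cauchy_term.
HB.instance Definition _ := gen_choiceMixin cauchy_term.

Definition ceqv : rel cauchy_term := fun s t => `[< clim (val s) (val t) >].

Lemma cauchy_termP (s : cauchy_term) : clim (val s) (val s).
Proof. by case: s => s /= /asboolP. Qed.

Lemma ceqv_refl : reflexive ceqv.
Proof. by move=> s; apply/asboolP/cauchy_termP. Qed.
Lemma ceqv_sym : symmetric ceqv.
Proof. by move=> s t; apply/asboolP/asboolP => /clim_sym. Qed.
Lemma ceqv_trans : transitive ceqv.
Proof. by move=> t s r /asboolP st /asboolP tr; apply/asboolP/(clim_trans st tr). Qed.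

Canonical ceqv_rel := EquivRel ceqv ceqv_refl ceqv_sym ceqv_trans.

Definition completion : Type := {eq_quot ceqv_rel}%qT.
HB.instance Definition _ := Choice.on completion.
HB.instance Definition _ := Quotient.on completion.

Definition cterm (s : nat -> term) (cs : clim s s) : cauchy_term :=
  exist _ s (asboolT cs).
Definition cls (s : nat -> term) (cs : clim s s) : completion :=
  \pi_completion%qT (cterm cs).

Lemma cls_eq s t (cs : clim s s) (ct : clim t t) : clim s t -> cls cs = cls ct.
Proof. by move=> st; apply/eqmodP/asboolP. Qed.
Lemma cls_inj s t (cs : clim s s) (ct : clim t t) : cls cs = cls ct -> clim s t.
Proof. by move/eqmodP/asboolP. Qed.
Lemma clsW (P : completion -> Prop) :
  (forall s (cs : clim s s), P (cls cs)) -> forall x, P x.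
Proof.
move=> h; elim/quotW => s; have := h _ (cauchy_termP s).
by congr (P _); rewrite /cls; congr (\pi_completion%qT _); apply: val_inj.
Qed.

Definition creal (x : completion) : nat -> term := val (repr x).
Lemma crealP x : clim (creal x) (creal x). Proof. exact: cauchy_termP. Qed.
Lemma creal_cls s (cs : clim s s) : clim (creal (cls cs)) s.
Proof.
apply: (cls_inj (cs := crealP _) (ct := cs)); rewrite -[RHS]reprK.
by congr \pi_completion%qT; apply: val_inj.
Qed.

Definition qadd x y : completion := cls (clim_add (crealP x) (crealP y)).
Definition qmul x y : completion := cls (clim_mul (crealP x) (crealP y)).
Definition qstar x : completion := cls (clim_star (crealP x)).
Definition qconst p : completion := cls (clim_cst p).
Definition qopp x : completion := qmul (qconst (PConst nat (-1) 0 0)) x.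

Lemma clim_gauss (a : R[i]) :
  clim (fun n => K (gauss_approx a n)) (fun n => K (gauss_approx a n)).
Proof.
move=> e e0; have /gauss_approx_cvg h : 0 < e / 2 by rewrite divr_gt0.
apply: eventually2 (h a) (eventually_swap (h a)) => m n h1 h2.
apply: le_lt_trans (dst_const H _ _) _; rewrite (splitr e).
rewrite -(subrKA a); apply: le_lt_trans (normcD _ _) (ltrD h1 _).
by rewrite normc_distC.
Qed.

(** Terms contain Gaussian rationals only, so a complex scalar is the class of its approximants. It
    is central by [dst_constC], so scaling can be defined as multiplication. *)
Definition qscalar (a : R[i]) : completion := cls (clim_gauss a).
Definition qscale (a : R[i]) x : completion := qmul (qscalar a) x.

Lemma qaddE s t (cs : clim s s) (ct : clim t t) :
  qadd (cls cs) (cls ct) = cls (clim_add cs ct).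
Proof. by apply/cls_eq/clim_add; exact: creal_cls. Qed.
Lemma qmulE s t (cs : clim s s) (ct : clim t t) :
  qmul (cls cs) (cls ct) = cls (clim_mul cs ct).
Proof. by apply/cls_eq/clim_mul; exact: creal_cls. Qed.
Lemma qstarE s (cs : clim s s) : qstar (cls cs) = cls (clim_star cs).
Proof. by apply/cls_eq/clim_star; exact: creal_cls. Qed.

Lemma cls_ext s t (cs : clim s s) (ct : clim t t) :
  (forall n, dst (s n) (t n) = 0) -> cls cs = cls ct.
Proof. by move=> st; apply/cls_eq/clim_eq. Qed.

Fact qaddA : associative qadd.
Proof.
elim/clsW => s cs; elim/clsW => t ct; elim/clsW => r cr; rewrite !qaddE.
by apply: cls_ext => n; exact: (dst_law H 0 (sigma (s n) (t n) (r n))).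
Qed.
Fact qaddC : commutative qadd.
Proof.
elim/clsW => s cs; elim/clsW => t ct; rewrite !qaddE.
by apply: cls_ext => n; exact: (dst_law H 1 (sigma (s n) (t n) (t n))).
Qed.
Fact qadd0 : left_id (qconst (pzero nat)) qadd.
Proof.
elim/clsW => s cs; rewrite !qaddE.
by apply: cls_ext => n; exact: (dst_law H 2 (sigma (s n) (s n) (s n))).
Qed.
Fact qaddN : left_inverse (qconst (pzero nat)) qopp qadd.
Proof.
elim/clsW => s cs; rewrite /qopp qmulE !qaddE.
by apply: cls_ext => n; exact: (dst_law H 3 (sigma (s n) (s n) (s n))).
Qed.
Fact qmulA : associative qmul.
Proof.
elim/clsW => s cs; elim/clsW => t ct; elim/clsW => r cr; rewrite !qmulE.
by apply: cls_ext => n; exact: (dst_law H 4 (sigma (s n) (t n) (r n))).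
Qed.
Fact qmul1l : left_id (qconst (pone nat)) qmul.
Proof.
elim/clsW => s cs; rewrite !qmulE.
by apply: cls_ext => n; exact: (dst_law H 5 (sigma (s n) (s n) (s n))).
Qed.
Fact qmul1r : right_id (qconst (pone nat)) qmul.
Proof.
elim/clsW => s cs; rewrite !qmulE.
by apply: cls_ext => n; exact: (dst_law H 6 (sigma (s n) (s n) (s n))).
Qed.
Fact qmulDl : left_distributive qmul qadd.
Proof.
elim/clsW => s cs; elim/clsW => t ct; elim/clsW => r cr.
rewrite !(qaddE, qmulE).
by apply: cls_ext => n; exact: (dst_law H 7 (sigma (s n) (t n) (r n))).
Qed.
Fact qmulDr : right_distributive qmul qadd.
Proof.
elim/clsW => s cs; elim/clsW => t ct; elim/clsW => r cr.
rewrite !(qaddE, qmulE).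
by apply: cls_ext => n; exact: (dst_law H 8 (sigma (s n) (t n) (r n))).
Qed.
Fact q1_neq0 : qconst (pone nat) != qconst (pzero nat).
Proof.
apply/eqP => /cls_inj/(_ _ (dst_one H))[N /(_ N N (leqnn N) (leqnn N))].
by rewrite ltxx.
Qed.

HB.instance Definition _ := GRing.isNzRing.Build completion
  qaddA qaddC qadd0 qaddN qmulA qmul1l qmul1r qmulDl qmulDr q1_neq0.

Lemma qaddE' s t (cs : clim s s) (ct : clim t t) :
  cls cs + cls ct = cls (clim_add cs ct).
Proof. exact: qaddE. Qed.
Lemma qmulE' s t (cs : clim s s) (ct : clim t t) :
  cls cs * cls ct = cls (clim_mul cs ct).
Proof. exact: qmulE. Qed.

Lemma qconst_gauss c : qconst (K c) = qscalar (G c).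
Proof.
apply: cls_eq => e e0.
apply: eventually_mono (eventually_swap (gauss_approx_cvg (G c) e0)) => m n h.
by apply: le_lt_trans (dst_const H _ _) _; rewrite normc_distC.
Qed.

Lemma qscalarD (a b : R[i]) : qscalar (a + b) = qscalar a + qscalar b.
Proof.
rewrite [RHS]qaddE'; apply/esym/cls_eq => e e0.
have e3 : 0 < e / 3 by rewrite divr_gt0.
have := eventually_and (gauss_approx_cvg a e3) (gauss_approx_cvg b e3).
move=> /eventually2; apply; last exact: eventually_swap (gauss_approx_cvg (a + b) e3).
move=> m n [h1 h2] h3; apply: le_lt_trans (dst_constD H _ _ _) _.
set x := G _ in h1 *; set y := G _ in h2 *; set z := G _ in h3 *.
have -> : x + y - z = (x - a) + ((y - b) + (a + b - z)) by ring.
have := normcD (x - a) ((y - b) + (a + b - z)).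
have := normcD (y - b) (a + b - z).
rewrite (normc_distC (a + b)); lra.
Qed.

Lemma qscalarM (a b : R[i]) : qscalar (a * b) = qscalar a * qscalar b.
Proof.
rewrite [RHS]qmulE'; apply/esym/cls_eq => e e0.
have e3 : 0 < e / 3 by rewrite divr_gt0.
have a0 : 0 < normc a + 1 by rewrite ltr_wpDl ?normc_ge0.
have b0 : 0 < normc b + 1 by rewrite ltr_wpDl ?normc_ge0.
(* The last condition bounds the approximant of b by |b| + 1; the divisors fit the splitting (x - a)
   y + a (y - b) + (ab - z). *)
have := eventually_and (gauss_approx_cvg a (divr_gt0 e3 b0))
  (eventually_and (gauss_approx_cvg b (divr_gt0 e3 a0)) (gauss_approx_cvg b ltr01)).
move=> /eventually2; apply; last exact: eventually_swap (gauss_approx_cvg (a * b) e3).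
move=> m n [h1 [h2 h4]] h3; apply: le_lt_trans (dst_constM H _ _ _) _.
set x := G _ in h1 *; set y := G _ in h2 h4 *; set z := G _ in h3 *.
have -> : x * y - z = (x - a) * y + (a * (y - b) + (a * b - z)) by ring.
have := normcD ((x - a) * y) (a * (y - b) + (a * b - z)).
have := normcD (a * (y - b)) (a * b - z).
have y_le : normc y <= normc b + 1.
  by have := normcD (y - b) b; rewrite subrK; lra.
have m1 : normc ((x - a) * y) <= e / 3.
  rewrite normcM; rewrite ltr_pdivlMr // in h1; apply: le_trans (ltW h1).
  by rewrite ler_wpM2l ?normc_ge0.
have m2 : normc (a * (y - b)) <= e / 3.
  rewrite normcM mulrC; rewrite ltr_pdivlMr // in h2; apply: le_trans (ltW h2).
  by rewrite ler_wpM2l ?normc_ge0 // lerDl.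
rewrite (normc_distC (a * b)); lra.
Qed.

Lemma qscalarC (a : R[i]) x : qscalar a * x = x * qscalar a.
Proof.
elim/clsW: x => s cs; rewrite [LHS]qmulE' [RHS]qmulE'.
by apply: cls_ext => n; exact: dst_constC.
Qed.

Lemma qscalar1 : qscalar 1 = 1.
Proof.
transitivity (qscalar (G (1, 0, 0%N))); last exact/esym/(qconst_gauss (1, 0, 0%N)).
by congr qscalar; rewrite /gauss /= divr1 mul0r.
Qed.

Lemma normc_conj (a : R[i]) : normc (conjc a) = normc a.
Proof. by case: a => x y; rewrite /= sqrrN. Qed.

Lemma qstar_scalar (a : R[i]) : qstar (qscalar a) = qscalar (conjc a).
Proof.
rewrite qstarE; apply: cls_eq => e e0.
have e2 : 0 < e / 2 by rewrite divr_gt0.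
apply: eventually2 (gauss_approx_cvg a e2)
  (eventually_swap (gauss_approx_cvg (conjc a) e2)) => m n h1 h2.
apply: le_lt_trans (dst_constS H _ _) _; rewrite (splitr e).
rewrite -(subrKA (conjc a)); apply: le_lt_trans (normcD _ _) (ltrD _ _).
  by rewrite -rmorphB normc_conj.
by rewrite normc_distC.
Qed.

Fact qscaleA a b (x : completion) : qscale a (qscale b x) = qscale (a * b) x.
Proof. by rewrite /qscale qscalarM; exact: (mulrA (qscalar a)). Qed.
Fact qscale1 : left_id 1 qscale.
Proof. by move=> x; rewrite /qscale qscalar1; exact: (mul1r x). Qed.
Fact qscaleDr : right_distributive qscale +%R.
Proof. by move=> a x y; exact: (mulrDr (qscalar a)). Qed.
Fact qscaleDl (x : completion) : {morph qscale^~ x : a b / a + b}.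
Proof. by move=> a b; rewrite /qscale qscalarD; exact: (mulrDl (qscalar a)). Qed.
HB.instance Definition _ := GRing.Zmodule_isLmodule.Build R[i] completion
  qscaleA qscale1 qscaleDr qscaleDl.

Fact qscaleAl (a : R[i]) (x y : completion) : a *: (x * y) = (a *: x) * y.
Proof. exact: mulrA. Qed.
HB.instance Definition _ := GRing.Lmodule_isLalgebra.Build R[i] completion qscaleAl.

Fact qscaleAr (a : R[i]) (x y : completion) : a *: (x * y) = x * (a *: y).
Proof.
transitivity ((qscalar a * x) * y); first exact: mulrA.
by rewrite qscalarC -mulrA.
Qed.
HB.instance Definition _ := GRing.Lalgebra_isAlgebra.Build R[i] completion qscaleAr.

Definition qnorm (x : completion) : R := lim (nrm (creal x n) @[n --> \oo]).

Lemma clim_cvg s t : clim s s -> clim s t ->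
  nrm (t n) @[n --> \oo] --> lim (nrm (s n) @[n --> \oo]).
Proof.
move=> ss st; have : cvg (nrm (s n) @[n --> \oo]).
  apply/cauchy_cvgP/cauchy_exP => e e0; have [N NP] := ss e e0.
  exists (nrm (s N)), N => // n /= Nn; rewrite /ball /=.
  exact: le_lt_trans (dst_nrm _ _) (NP _ _ _ _).
move=> /cvgrPdist_lt cs; apply/cvgrPdist_lt => e e0.
have e2 : 0 < e / 2 by rewrite divr_gt0.
have [N NP] := st _ e2; near=> n; rewrite (splitr e).
apply: le_lt_trans (ler_distD (nrm (s n)) _ _) _; apply: ltrD.
  by near: n; exact: cs.
apply: le_lt_trans (dst_nrm _ _) _; apply: NP; by near: n; exact: nbhs_infty_ge.
Unshelve. all: by end_near. Qed.

Lemma qnorm_cvg s (cs : clim s s) : nrm (s n) @[n --> \oo] --> qnorm (cls cs).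
Proof. by apply: clim_cvg; [exact: crealP|exact: creal_cls]. Qed.
Arguments qnorm_cvg {s} cs.

Lemma qnorm_eq s (cs : clim s s) l : nrm (s n) @[n --> \oo] --> l -> qnorm (cls cs) = l.
Proof. by move=> sl; apply: cvg_unique (qnorm_cvg cs) sl. Qed.

Lemma qnorm_le s (cs : clim s s) l :
  eventually (fun m _ => nrm (s m) <= l) -> qnorm (cls cs) <= l.
Proof.
move=> [N NP]; apply: (ler_cvg_to (qnorm_cvg cs) (cvg_cst l)).
by exists N => // n Nn; exact: (NP n n Nn Nn).
Qed.

Fact qnormD x y : qnorm (x + y) <= qnorm x + qnorm y.
Proof.
elim/clsW: x => s cs; elim/clsW: y => t ct; rewrite qaddE'.
apply: (ler_cvg_to (qnorm_cvg _) (cvgD (qnorm_cvg cs) (qnorm_cvg ct))).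
apply: nearW => n; apply: le_trans (dst_tri H (PAdd (pzero nat) (pzero nat)) _ _) _.
have -> : dst (PAdd (pzero nat) (pzero nat)) (pzero nat) = 0.
  exact: (dst_law H 2 (sigma (pzero nat) (pzero nat) (pzero nat))).
by rewrite addr0; exact: (dst_add H).
Qed.

(** Absorption by zero is not one of the laws. It holds in the completion by ring theory and is
    pulled back to terms. *)
Lemma dst_mul0 p : dst (PMul (pzero nat) p) (pzero nat) <= 0.
Proof.
have E : qconst (PMul (pzero nat) p) = qconst (pzero nat).
  have := mul0r (qconst p); rewrite -[0]/(qconst (pzero nat)) qmulE' => <-.
  exact: cls_ext (fun=> dst_refl H _).
move: E => /cls_inj E; apply/ler_addgt0Pr => e /E[N /(_ N N (leqnn N) (leqnn N)) /ltW].
by rewrite add0r.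
Qed.

Lemma dst_nrmM p q : nrm (PMul p q) <= nrm p * nrm q.
Proof.
apply: le_trans (dst_tri H (PMul (pzero nat) q) _ _) _.
by have := dst_mull H p (pzero nat) q; have := dst_mul0 q; lra.
Qed.

Fact qnormM x y : qnorm (x * y) <= qnorm x * qnorm y.
Proof.
elim/clsW: x => s cs; elim/clsW: y => t ct; rewrite qmulE'.
apply: (ler_cvg_to (qnorm_cvg _) (cvgM (qnorm_cvg cs) (qnorm_cvg ct))).
by apply: nearW => n; exact: dst_nrmM.
Qed.

Fact qnorm_scalar (a : R[i]) : qnorm (qscalar a) <= normc a.
Proof.
apply/ler_addgt0Pr => e e0; apply: qnorm_le.
apply: eventually_mono (gauss_approx_cvg a e0) => m _ h.
apply: le_trans (dst_const H _ (0, 0, 0%N)) _.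
rewrite (_ : G (0, 0, 0%N) = 0) ?subr0; last by rewrite /gauss /= !mul0r.
by have := normcD (G (gauss_approx a m) - a) a; rewrite subrK; lra.
Qed.

Fact qnormZ (a : R[i]) x : qnorm (a *: x) = normc a * qnorm x.
Proof.
have le b y : qnorm (b *: y) <= normc b * qnorm y.
  apply: le_trans (qnormM _ _) _; rewrite ler_wpM2r ?qnorm_scalar //.
  elim/clsW: y => s cs; apply: (ler_cvg_to (cvg_cst 0) (qnorm_cvg cs)).
  by apply: nearW => n; exact: dst_ge0.
apply/eqP; rewrite eq_le le /=.
have [->|a0] := eqVneq a 0.
  rewrite normc0 mul0r; apply: (@le_trans _ _ (qnorm 0)); last by rewrite scale0r.
  apply: (ler_cvg_to (cvg_cst 0) (qnorm_cvg (clim_cst (pzero nat)))).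
  by apply: nearW => n; exact: dst_ge0.
have na : 0 < normc a.
  by rewrite lt_def normc_ge0 andbT; apply: contra_neq a0 => /eq0_normc.
(* The reverse inequality is the direct one for the scalar a^-1 acting on a x. *)
rewrite -ler_pdivlMl // -normcV; apply: le_trans (le _ _).
by rewrite scalerA mulVf // scale1r.
Qed.

Fact qnorm_cstar x : qnorm (qstar x * x) = qnorm x ^+ 2.
Proof.
elim/clsW: x => s cs; rewrite qstarE qmulE'; apply: qnorm_eq.
have -> : (fun n => nrm (PMul (PStar (s n)) (s n))) = (fun n => nrm (s n) * nrm (s n)).
  apply/funext => n; apply/eqP; rewrite eq_le -expr2 (dst_cstar H) andbT.
  apply: le_trans (dst_nrmM _ _) _; rewrite expr2 ler_wpM2r ?dst_ge0 //.
  apply: le_trans (dst_tri H (PStar (pzero nat)) _ _) _.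
  have -> : nrm (PStar (pzero nat)) = 0.
    apply/eqP; rewrite eq_le dst_ge0 andbT.
    apply: le_trans (dst_constS H (0, 0, 0%N) (0, 0, 0%N)) _.
    rewrite (_ : G (0, 0, 0%N) = 0) ?subr0; last by rewrite /gauss /= !mul0r.
    by rewrite rmorph0 normc0.
  by rewrite addr0; exact: dst_star.
by rewrite expr2; apply: cvgM; exact: qnorm_cvg.
Qed.

Fact qnorm_eq0 x : qnorm x = 0 -> x = 0.
Proof.
elim/clsW: x => s cs s0; apply: cls_eq => e e0.
have := qnorm_cvg cs; rewrite s0 => /cvgrPdist_lt/(_ _ e0)[N _ NP].
exists N => m n Nm _; have := NP m Nm; rewrite sub0r normrN.
exact: le_lt_trans (ler_norm _).
Qed.

Lemma qnorm_const p : qnorm (qconst p) = nrm p.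
Proof. by apply: qnorm_eq; exact: cvg_cst. Qed.

Lemma qnorm_sub_le s t (cs : clim s s) (ct : clim t t) l :
  eventually (fun m _ => dst (s m) (t m) <= l) -> qnorm (cls cs - cls ct) <= l.
Proof.
move=> h; rewrite -[- cls ct]/(qopp (cls ct)) /qopp qmulE qaddE'.
by apply: qnorm_le; apply: eventually_mono h => m n; rewrite -dst_sub.
Qed.

Lemma qnorm_const_sub p q : qnorm (qconst p - qconst q) = dst p q.
Proof.
rewrite -[- qconst q]/(qopp (qconst q)) /qopp qmulE qaddE' -dst_sub.
by apply: qnorm_eq; exact: cvg_cst.
Qed.

Lemma qconst_dense x e : 0 < e -> exists p, qnorm (x - qconst p) <= e.
Proof.
move=> e0; elim/clsW: x => s cs; have [N NP] := cs _ e0.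
exists (s N); apply: qnorm_sub_le; exists N => m _ Nm _.
by rewrite ltW // NP.
Qed.

Fact qnormN x : qnorm (- x) = qnorm x.
Proof.
by rewrite -scaleN1r qnormZ -(@normcN R (-1)) opprK normc1 mul1r.
Qed.

Fact q_complete (x : nat -> completion) :
  (forall e : R, 0 < e -> exists N, forall m n, (N <= m)%N -> (N <= n)%N ->
     qnorm (x m - x n) < e) ->
  exists l, forall e : R, 0 < e -> exists N, forall n, (N <= n)%N ->
     qnorm (x n - l) < e.
Proof.
move=> xC.
(* Each x n is replaced by one term within 1/(n + 1); the sequence of these terms is Cauchy and its
   class is the limit. *)
have /choice[t tP] n : exists p, qnorm (x n - qconst p) <= n.+1%:R^-1.
  exact: qconst_dense.
have small (e : R) : 0 < e -> exists N, forall n, (N <= n)%N ->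
    qnorm (x n - qconst (t n)) < e.
  move=> e0; exists (Num.bound e^-1) => n Nn; apply: le_lt_trans (tP n) _.
  rewrite invf_plt // ?posrE //; apply: lt_trans (archi_boundP _) _.
    by rewrite invr_ge0 ltW.
  by rewrite ltr_nat ltnS.
have tri (y z w : completion) : qnorm (y - w) <= qnorm (y - z) + qnorm (z - w).
  by rewrite -[y - w](subrKA z) qnormD.
have sym (y z : completion) : qnorm (y - z) = qnorm (z - y).
  by rewrite -qnormN opprB.
have ct : clim t t.
  move=> e e0; have e3 : 0 < e / 3 by rewrite divr_gt0.
  have [N NP] := small _ e3; have [M MP] := xC _ e3.
  exists (maxn N M) => m n; rewrite !geq_max => /andP[Nm Mm] /andP[Nn Mn].
  rewrite -qnorm_const_sub.
  have := tri (qconst (t m)) (x m) (qconst (t n)).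
  have := tri (x m) (x n) (qconst (t n)).
  have := NP _ Nm; have := NP _ Nn; have := MP _ _ Mm Mn.
  rewrite (sym (qconst (t m)) (x m)); lra.
exists (cls ct) => e e0; have e3 : 0 < e / 3 by rewrite divr_gt0.
have [N NP] := small _ e3; have [M MP] := ct _ e3.
exists (maxn N M) => n; rewrite geq_max => /andP[Nn Mn].
have : qnorm (qconst (t n) - cls ct) <= e / 3.
  by apply: qnorm_sub_le; exists M => m _ Mm _; apply/ltW/MP.
have := tri (x n) (qconst (t n)) (cls ct); have := NP _ Nn; lra.
Qed.

Lemma completion_cstar : @cstar_axioms R completion qstar qnorm.
Proof.
split; [| | | | exact: qnorm_eq0 | exact: qnormD | exact: qnormZ
  | exact: qnormM | exact: qnorm_cstar | exact: q_complete].
- elim/clsW => s cs; rewrite !qstarE; apply: cls_ext => n.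
  exact: (dst_law H 9 (sigma (s n) (s n) (s n))).
- move=> x y; elim/clsW: x => s cs; elim/clsW: y => t ct.
  rewrite qaddE' !qstarE qaddE'; apply: cls_ext => n.
  exact: (dst_law H 10 (sigma (s n) (t n) (t n))).
- move=> x y; elim/clsW: x => s cs; elim/clsW: y => t ct.
  rewrite qmulE' !qstarE qmulE'; apply: cls_ext => n.
  exact: (dst_law H 11 (sigma (s n) (t n) (t n))).
- move=> a x; transitivity (qstar x * qstar (qscalar a)).
    elim/clsW: x => s cs; rewrite [a *: _]qmulE' !qstarE qmulE'.
    by apply: cls_ext => n; exact: (dst_law H 11 (sigma _ (s n) (s n))).
  by rewrite qstar_scalar -qscalarC.
Qed.

End Quotient.

Lemma cstar_completion (dst : term -> term -> R) : cstar_pseudometric dst ->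
  exists (C : cstar R) (z : nat -> C),
    forall p, cnorm (peval z p) = dst p (pzero nat).
Proof.
move=> H; exists (CStar (completion_cstar H)), (fun k => qconst H (PVar k)) => p.
have -> : peval (A := CStar (completion_cstar H)) (fun k => qconst H (PVar k)) p = qconst H p.
  elim: p => //= [a b d|p -> q ->|p -> q ->|p ->].
  - rewrite [RHS](qconst_gauss H (a, b, d)).
    exact: (mulr1 (qscalar H (G (a, b, d)))).
  - by rewrite [LHS]qaddE'; apply: cls_ext => n; exact: dst_refl.
  - by rewrite [LHS]qmulE'; apply: cls_ext => n; exact: dst_refl.
  - by rewrite [LHS]qstarE; apply: cls_ext => n; exact: dst_refl.
exact: qnorm_const.
Qed.

End Completion.

(** * Inference rules on codes *)

Section Codes.
Local Open Scope nat_scope.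

Definition code_var k := npair 0 k.
Definition code_const c := npair 1 c.
Definition code_add x y := npair 2 (npair x y).
Definition code_mul x y := npair 3 (npair x y).
Definition code_star x := npair 4 x.
Definition code_zero := code_poly (pzero nat).
Arguments code_zero : simpl never.
Definition code_one := code_poly (pone nat).
Arguments code_one : simpl never.

(* Total decoder: every number is the code of some term, so that the rules below
   need not check that their arguments are well-formed. *)
Fixpoint decode_poly_fuel (m n : nat) : starpoly nat :=
  if m is m'.+1 then
    let b := pi2 n in
    match pi1 n with
    | 0 => PVar b
    | 1 => PConst nat (decode_int (pi1 b)) (decode_int (pi1 (pi2 b))) (pi2 (pi2 b))
    | 2 => PAdd (decode_poly_fuel m' (pi1 b)) (decode_poly_fuel m' (pi2 b))
    | 3 => PMul (decode_poly_fuel m' (pi1 b)) (decode_poly_fuel m' (pi2 b))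
    | 4 => PStar (decode_poly_fuel m' b)
    | _ => pzero nat
    end
  else pzero nat.
Definition decode_poly n := decode_poly_fuel n.+1 n.
Arguments decode_poly : simpl never.

Lemma npair_ge a b : a + b <= npair a b.
Proof.
rewrite /npair binS bin1.
by apply: leq_trans (leq_addr _ _); exact: leq_addl.
Qed.

Lemma pi1_le n : pi1 n <= n.
Proof. by rewrite -{2}(npairE n) (leq_trans _ (npair_ge _ _)) ?leq_addr. Qed.
Lemma pi2_le n : pi2 n <= n.
Proof. by rewrite -{2}(npairE n) (leq_trans _ (npair_ge _ _)) ?leq_addl. Qed.

Lemma decode_fuelE m m' n : n < m -> n < m' -> decode_poly_fuel m n = decode_poly_fuel m' n.
Proof.
elim: m m' n => // m IH [//|m'] n nm nm' /=.
case E: (pi1 n) => [//|[//|t]].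
(* Recursion happens from tag 2 on only, and a positive tag makes the payload smaller than the
   code. *)
have lt : pi2 n < n.
  by rewrite -{2}(npairE n) E (leq_trans _ (npair_ge _ _)) // addSn ltnS leq_addl.
have h1 := pi1_le (pi2 n); have h2 := pi2_le (pi2 n).
have I k : k <= pi2 n -> decode_poly_fuel m k = decode_poly_fuel m' k.
  by move=> kn; apply: IH; lia.
by rewrite !I.
Qed.

Lemma decode_var k : decode_poly (code_var k) = PVar k.
Proof. by rewrite /decode_poly /= !piK. Qed.
Lemma decode_const c : decode_poly (code_const c) =
  PConst nat (decode_int (pi1 c)) (decode_int (pi1 (pi2 c))) (pi2 (pi2 c)).
Proof. by rewrite /decode_poly /= !piK. Qed.

Lemma decode_polyE n : decode_poly n =
  let b := pi2 n in
  match pi1 n with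
  | 0 => PVar b
  | 1 => PConst nat (decode_int (pi1 b)) (decode_int (pi1 (pi2 b))) (pi2 (pi2 b))
  | 2 => PAdd (decode_poly (pi1 b)) (decode_poly (pi2 b))
  | 3 => PMul (decode_poly (pi1 b)) (decode_poly (pi2 b))
  | 4 => PStar (decode_poly b)
  | _ => pzero nat
  end.
Proof.
rewrite /decode_poly /=; case E: (pi1 n) => [//|[//|t]].
have lt : pi2 n < n.
  by rewrite -{2}(npairE n) E (leq_trans _ (npair_ge _ _)) // addSn ltnS leq_addl.
have h1 := pi1_le (pi2 n); have h2 := pi2_le (pi2 n).
have I k : k <= pi2 n -> decode_poly_fuel n k = decode_poly_fuel k.+1 k.
  by move=> kn; apply: decode_fuelE; lia.
by case: t {E} => [|[|[|t]]]; rewrite /= ?I.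
Qed.

Lemma decodeD x y : decode_poly (code_add x y) = PAdd (decode_poly x) (decode_poly y).
Proof. by rewrite decode_polyE /= !piK. Qed.
Lemma decodeM x y : decode_poly (code_mul x y) = PMul (decode_poly x) (decode_poly y).
Proof. by rewrite decode_polyE /= !piK. Qed.
Lemma decode_star x : decode_poly (code_star x) = PStar (decode_poly x).
Proof. by rewrite decode_polyE /= !piK. Qed.

Lemma decode_junk t b : decode_poly (npair t.+4.+1 b) = pzero nat.
Proof. by rewrite decode_polyE /= !piK. Qed.

(** Induction over all numbers: tags from 5 on form the junk case, which decodes to zero. *)
Lemma code_ind (P : nat -> Prop) :
  (forall k, P (code_var k)) -> (forall c, P (code_const c)) ->
  (forall x y, P x -> P y -> P (code_add x y)) ->
  (forall x y, P x -> P y -> P (code_mul x y)) ->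
  (forall x, P x -> P (code_star x)) -> (forall t b, P (npair t.+4.+1 b)) ->
  forall n, P n.
Proof.
move=> Pv Pc Pa Pm Ps Pj n; have [m] := ubnP n; elim: m n => // m IH n ltn.
rewrite -(npairE n); case E: (pi1 n) => [//|[//|t]].
have lt : pi2 n < n.
  by rewrite -{2}(npairE n) E (leq_trans _ (npair_ge _ _)) // addSn ltnS leq_addl.
have h1 := pi1_le (pi2 n); have h2 := pi2_le (pi2 n).
have I k : k <= pi2 n -> P k by move=> kn; apply: IH; lia.
case: t {E} => [|[|[|t]]].
- by rewrite -(npairE (pi2 n)); apply: Pa; apply: I.
- by rewrite -(npairE (pi2 n)); apply: Pm; apply: I.
- by apply: Ps; apply: I.
- exact: Pj.
Qed.

Lemma code_polyK : cancel code_poly decode_poly.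
Proof.
elim=> [v|a b d|p IHp q IHq|p IHp q IHq|p IHp] /=.
- by rewrite decode_var.
- by rewrite decode_const !piK !code_intK.
- by rewrite decodeD IHp IHq.
- by rewrite decodeM IHp IHq.
- by rewrite decode_star IHp.
Qed.

Lemma decode_intK : cancel decode_int code_int.
Proof.
by move=> n; rewrite /decode_int -[RHS]odd_double_half; case: (odd n).
Qed.

(* The code [(a, d)] stands for the nonnegative rational [a / (d + 1)]. *)
Definition radd r s := npair (pi1 r * (pi2 s).+1 + pi1 s * (pi2 r).+1)
  (pi2 r * pi2 s + pi2 r + pi2 s).
Definition rmul r s := npair (pi1 r * pi1 s) (pi2 r * pi2 s + pi2 r + pi2 s).
Definition rle r s := pi1 r * (pi2 s).+1 <= pi1 s * (pi2 r).+1.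
Definition rlt r s := (pi1 r * (pi2 s).+1).+1 <= pi1 s * (pi2 r).+1.
Definition rpow k := npair 1 (2 ^ k).-1.

(* The code [(u, v)] stands for the integer [u - v], and [(x, (y, d))] for the
   Gaussian rational [(x + i y) / (d + 1)]. *)
Definition zadd x y := npair (pi1 x + pi1 y) (pi2 x + pi2 y).
Definition zmul x y := npair (pi1 x * pi1 y + pi2 x * pi2 y)
  (pi1 x * pi2 y + pi2 x * pi1 y).
Definition zopp x := npair (pi2 x) (pi1 x).
Definition zscale n x := npair (n * pi1 x) (n * pi2 x).
Definition zcode z := if odd z then npair 0 z./2.+1 else npair z./2 0.

Definition gre v := pi1 v.
Definition gim v := pi1 (pi2 v).
Definition gden v := pi2 (pi2 v).
Definition gcode x y d := npair x (npair y d).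
Definition gconst c := gcode (zcode (pi1 c)) (zcode (pi1 (pi2 c))) (pi2 (pi2 c)).
Definition gaddc v w := gcode
  (zadd (zscale (gden w).+1 (gre v)) (zscale (gden v).+1 (gre w)))
  (zadd (zscale (gden w).+1 (gim v)) (zscale (gden v).+1 (gim w)))
  (gden v * gden w + gden v + gden w).
Definition gmulc v w := gcode
  (zadd (zmul (gre v) (gre w)) (zopp (zmul (gim v) (gim w))))
  (zadd (zmul (gre v) (gim w)) (zmul (gim v) (gre w)))
  (gden v * gden w + gden v + gden w).
Definition gconjc v := gcode (gre v) (zopp (gim v)) (gden v).
(** This is |v|^2 <= r^2 cleared of denominators, with the mixed terms of the squares (u - v)^2
    moved to the right so that no subtraction occurs in [nat]. *)
Definition gle v r :=
  (pi1 (gre v) * pi1 (gre v) + pi2 (gre v) * pi2 (gre v) +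
   (pi1 (gim v) * pi1 (gim v) + pi2 (gim v) * pi2 (gim v))) *
    ((pi2 r).+1 * (pi2 r).+1)
  <= pi1 r * pi1 r * ((gden v).+1 * (gden v).+1) +
     2 * (pi1 (gre v) * pi2 (gre v) + pi1 (gim v) * pi2 (gim v)) *
       ((pi2 r).+1 * (pi2 r).+1).

(** Laws are instantiated directly on codes, which makes the rule computable; [w] packs the values
    of the three metavariables. *)
Fixpoint cinst (l : starpoly nat) (w : nat) : nat :=
  match l with
  | PVar 0 => pi1 w
  | PVar 1 => pi1 (pi2 w)
  | PVar _ => pi2 (pi2 w)
  | PConst a b d => code_poly (PConst nat a b d)
  | PAdd p q => code_add (cinst p w) (cinst q w)
  | PMul p q => code_mul (cinst p w) (cinst q w)
  | PStar p => code_star (cinst p w)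
  end.
Definition cinst_var w i :=
  match i with 0 => pi1 w | 1 => pi1 (pi2 w) | _ => pi2 (pi2 w) end.

Lemma decode_inst l w : decode_poly (cinst l w) = psubst (fun i => decode_poly (cinst_var w i)) l.
Proof.
elim: l => [[|[|i]]|a b d|p IHp q IHq|p IHp q IHq|p IHp] //=.
- by rewrite -[RHS]code_polyK.
- by rewrite decodeD IHp IHq.
- by rewrite decodeM IHp IHq.
- by rewrite decode_star IHp.
Qed.

Lemma computable_inst l f : computable f -> computable (fun n => cinst l (f n)).
Proof.
move=> cf; elim: l => [[|[|i]]|a b d|p IHp q IHq|p IHp q IHq|p IHp] /=;
  rewrite /code_add /code_mul /code_star; computability.
Qed.

Definition code_nth l k := pi1 (iter k pi2 l).

Lemma code_nth_surj (f : nat -> nat) n :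
  exists l, forall k, k < n -> code_nth l k = f k.
Proof.
elim: n f => [|n IH] f; first by exists 0.
have [l lP] := IH (fun k => f k.+1).
exists (npair (f 0) l) => -[_|k ltk]; rewrite /code_nth ?iterSr ?piK //.
exact: lP.
Qed.

(* Judgements, with their meaning for a term [p] evaluated at the generators:
   [jdist p q r]: ||p - q|| <= r;
   [jval e v]: the value of the closed term [e] is [v];
   [jsub c p p' M E]: [p'] is [p] with the terms listed in [c] substituted for the
     variables, and [M], [E] are the bound and the Lipschitz constant of [p];
   [jgood c i]: the first [i] relations hold approximately at the point [c];
   [jlow p u]: u <= ||p||;
   [japp p k q]: the rational coded by [q] approximates ||p|| within 2^-k;
   [jterm p]: [p] is in the range of [code_poly]. *)
Definition jdist p q r := npair 1 (npair p (npair q r)).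
Definition jval e v := npair 2 (npair e v).
Definition jsub c p p' M E := npair 3 (npair c (npair p (npair p' (npair M E)))).
Definition jgood c i := npair 4 (npair c i).
Definition jlow p u := npair 5 (npair p u).
Definition japp p k q := npair 6 (npair (npair p k) q).

Definition jterm p := npair 7 p.

Definition snd0 j := pi2 j.
Definition fst1 j := pi1 (pi2 j).
Definition snd1 j := pi2 (pi2 j).
Definition fst2 j := pi1 (snd1 j).
Definition snd2 j := pi2 (snd1 j).
Definition fst3 j := pi1 (snd2 j).
Definition snd3 j := pi2 (snd2 j).
Definition fst4 j := pi1 (snd3 j).
Definition snd4 j := pi2 (snd3 j).

(** The shape of a judgement is tested by rebuilding it from its projections. *)
Definition is_dist j := j == jdist (fst1 j) (fst2 j) (snd2 j).
Definition is_val j := j == jval (fst1 j) (snd1 j).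
Definition is_sub j := j == jsub (fst1 j) (fst2 j) (fst3 j) (fst4 j) (snd4 j).
Definition is_good j := j == jgood (fst1 j) (snd1 j).
Definition is_low j := j == jlow (fst1 j) (snd1 j).

Definition is_term j := j == jterm (snd0 j).

Lemma distE p q r : (fst1 (jdist p q r) = p) * (fst2 (jdist p q r) = q) *
  (snd2 (jdist p q r) = r) * (is_dist (jdist p q r) = true).
Proof. by rewrite /is_dist /fst1 /snd2 /fst2 /snd1 /jdist !piK eqxx. Qed.
Lemma valE e v : (fst1 (jval e v) = e) * (snd1 (jval e v) = v) *
  (is_val (jval e v) = true).
Proof. by rewrite /is_val /fst1 /snd1 /jval !piK eqxx. Qed.
Lemma subE c p p' M E : (fst1 (jsub c p p' M E) = c) *
  (fst2 (jsub c p p' M E) = p) * (fst3 (jsub c p p' M E) = p') *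
  (fst4 (jsub c p p' M E) = M) * (snd4 (jsub c p p' M E) = E) *
  (is_sub (jsub c p p' M E) = true).
Proof.
by rewrite /is_sub /fst1 /fst2 /fst3 /fst4 /snd4 /snd3 /snd2 /snd1 /jsub !piK eqxx.
Qed.
Lemma goodE c i : (fst1 (jgood c i) = c) * (snd1 (jgood c i) = i) *
  (is_good (jgood c i) = true).
Proof. by rewrite /is_good /fst1 /snd1 /jgood !piK eqxx. Qed.
Lemma lowE p u : (fst1 (jlow p u) = p) * (snd1 (jlow p u) = u) *
  (is_low (jlow p u) = true).
Proof. by rewrite /is_low /fst1 /snd1 /jlow !piK eqxx. Qed.

Lemma termE p : (snd0 (jterm p) = p) * (is_term (jterm p) = true).
Proof. by rewrite /is_term /snd0 /jterm !piK eqxx. Qed.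

(** * The rules, relative to the relations, the norm algorithm of B and the stability modulus *)

Variables (ngens bnd : nat) (rels : seq (nat * nat)) (fB fm : nat -> nat).

Definition rel_term i := nth 0 (map fst rels) i.
Definition rel_bound i := nth 0 (map snd rels) i.

(** A sample point [c] packs a precision index n = [pi1 c] with a list of term codes. The index sets
    both the tolerance 2^-fm(n) in the relations and the distance 2^-n to a homomorphic image. *)
Definition sample c k := if k.+1 <= ngens then code_nth (pi2 c) k else code_one.

(** A negative answer (odd numerator code) is replaced by 0, which is closer to any norm; an even
    code is halved. The result fits the nonnegative rational codes of the rules. *)
Definition normB p k := let q := fB (npair p k) in
  npair (if odd (pi1 q) then 0 else (pi1 q)./2) (pi2 q).

Definition rule_law i (w a b : nat) :=
  jdist (cinst (star_law i).1 w) (cinst (star_law i).2 w) 0.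
Definition rule_refl (w a b : nat) := jdist w w 0.
Definition rule_sym (w a b : nat) :=
  if is_dist a then jdist (fst2 a) (fst1 a) (snd2 a) else 0.
Definition rule_tri (w a b : nat) :=
  if [&& is_dist a, is_dist b & fst2 a == fst1 b] then
    jdist (fst1 a) (fst2 b) (radd (snd2 a) (snd2 b)) else 0.
Definition rule_add (w a b : nat) :=
  if is_dist a && is_dist b then
    jdist (code_add (fst1 a) (fst1 b)) (code_add (fst2 a) (fst2 b)) (radd (snd2 a) (snd2 b))
  else 0.
Definition rule_star (w a b : nat) :=
  if is_dist a then jdist (code_star (fst1 a)) (code_star (fst2 a)) (snd2 a) else 0.
Definition rule_mull (w a b : nat) :=
  if [&& is_dist a, is_dist b & fst2 b == code_zero] then
    jdist (code_mul (fst1 a) (fst1 b)) (code_mul (fst2 a) (fst1 b)) (rmul (snd2 a) (snd2 b))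
  else 0.
Definition rule_mulr (w a b : nat) :=
  if [&& is_dist a, is_dist b & fst2 b == code_zero] then
    jdist (code_mul (fst1 b) (fst1 a)) (code_mul (fst1 b) (fst2 a)) (rmul (snd2 b) (snd2 a))
  else 0.
(** The root is guessed in [pi2 w] and checked by squaring, so no root is computed. *)
Definition rule_cstar (w a b : nat) :=
  if [&& is_dist a, fst1 a == code_mul (code_star (pi1 w)) (pi1 w), fst2 a == code_zero &
      rle (snd2 a) (rmul (pi2 w) (pi2 w))] then jdist (pi1 w) code_zero (pi2 w) else 0.
Definition rule_rel (w a b : nat) :=
  if w.+1 <= size rels then jdist (rel_term w) code_zero (rel_bound w) else 0.
Definition rule_unit (w a b : nat) :=
  if ngens <= w then jdist (code_var w) code_one 0 else 0.
Definition rule_central (w a b : nat) :=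
  jdist (code_mul (code_const (pi1 w)) (pi2 w)) (code_mul (pi2 w) (code_const (pi1 w))) 0.
(** Serves to prove every number at distance 0 from the code of the term it decodes to. *)
Definition rule_junk (w a b : nat) := jdist (npair (pi1 w).+4.+1 (pi2 w)) code_zero 0.
Definition rule_valconst (w a b : nat) := jval (code_const w) (gconst w).
Definition rule_valadd (w a b : nat) :=
  if is_val a && is_val b then
    jval (code_add (fst1 a) (fst1 b)) (gaddc (snd1 a) (snd1 b)) else 0.
Definition rule_valmul (w a b : nat) :=
  if is_val a && is_val b then
    jval (code_mul (fst1 a) (fst1 b)) (gmulc (snd1 a) (snd1 b)) else 0.
Definition rule_valstar (w a b : nat) :=
  if is_val a then jval (code_star (fst1 a)) (gconjc (snd1 a)) else 0.
Definition rule_valle (w a b : nat) :=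
  if is_val a && gle (snd1 a) w then jdist (fst1 a) code_zero w else 0.
(** The norm algorithm of [B] is guaranteed on genuine codes only, so the entries of a sample point
    carry a certificate. *)
Definition rule_termvar (w a b : nat) := jterm (code_var w).
Definition rule_termconst (w a b : nat) := jterm (code_const w).
Definition rule_termadd (w a b : nat) :=
  if is_term a && is_term b then jterm (code_add (snd0 a) (snd0 b)) else 0.
Definition rule_termmul (w a b : nat) :=
  if is_term a && is_term b then jterm (code_mul (snd0 a) (snd0 b)) else 0.
Definition rule_termstar (w a b : nat) :=
  if is_term a then jterm (code_star (snd0 a)) else 0.
Definition rule_subvar (w a b : nat) :=
  if is_term a && (snd0 a == sample (pi1 w) (pi2 w)) then
    jsub (pi1 w) (code_var (pi2 w)) (snd0 a) bnd 1 else 0.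
Definition rule_subconst (w a b : nat) :=
  jsub (pi1 w) (code_const (pi2 w)) (code_const (pi2 w))
    (pi1 (pi2 w) + pi1 (pi2 (pi2 w))) 0.
Definition rule_subadd (w a b : nat) :=
  if [&& is_sub a, is_sub b & fst1 a == fst1 b] then
    jsub (fst1 a) (code_add (fst2 a) (fst2 b)) (code_add (fst3 a) (fst3 b))
      (fst4 a + fst4 b) (snd4 a + snd4 b) else 0.
Definition rule_submul (w a b : nat) :=
  if [&& is_sub a, is_sub b & fst1 a == fst1 b] then
    jsub (fst1 a) (code_mul (fst2 a) (fst2 b)) (code_mul (fst3 a) (fst3 b))
      (fst4 a * fst4 b) (snd4 a * fst4 b + fst4 a * snd4 b) else 0.
Definition rule_substar (w a b : nat) :=
  if is_sub a then
    jsub (fst1 a) (code_star (fst2 a)) (code_star (fst3 a)) (fst4 a) (snd4 a) else 0.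
Definition rule_subjunk (w a b : nat) :=
  jsub (pi1 w) (npair (pi1 (pi2 w)).+4.+1 (pi2 (pi2 w))) code_zero 0 0.
Definition rule_good0 (w a b : nat) := jgood w 0.
(** [w] is the precision of the norm computation in [B]; the summand [rpow w] guards against its
    error. *)
Definition rule_good (w a b : nat) :=
  if [&& is_good a, is_sub b, fst1 a == fst1 b,
      fst2 b == rel_term (snd1 a), (snd1 a).+1 <= size rels &
      rle (radd (normB (fst3 b) w) (rpow w))
          (radd (rel_bound (snd1 a)) (rpow (fm (pi1 (fst1 a)))))]
  then jgood (fst1 a) (snd1 a).+1 else 0.
Definition rule_low0 (w a b : nat) := jlow w 0.
(** The guess [pi2 w] must stay below the computed norm by the computation error plus the Lipschitz
    constant times 2^-n. *)
Definition rule_low (w a b : nat) :=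
  if [&& is_good a, is_sub b, fst1 a == fst1 b, snd1 a == size rels &
      rle (radd (pi2 w) (radd (rpow (pi1 w))
             (rmul (npair (snd4 b) 0) (rpow (pi1 (fst1 a))))))
          (normB (fst3 b) (pi1 w))]
  then jlow (fst2 b) (pi2 w) else 0.
(** From u <= ||p|| <= r < u + 2^-k, the bound r itself is the approximation. Its numerator is
    doubled since [decode_int] reads even codes as nonnegative. *)
Definition rule_app (w a b : nat) :=
  if [&& is_dist a, is_low b, fst2 a == code_zero, fst1 a == fst1 b &
      rlt (snd2 a) (radd (snd1 b) (rpow w))]
  then japp (fst1 a) w (npair (pi1 (snd2 a) + pi1 (snd2 a)) (pi2 (snd2 a)))
  else 0.

Definition base_rules : seq (nat -> nat -> nat -> nat) :=
  [:: rule_refl; rule_sym; rule_tri; rule_add; rule_star;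
      rule_mull; rule_mulr; rule_cstar; rule_rel; rule_unit; rule_central;
      rule_junk; rule_valconst; rule_valadd; rule_valmul; rule_valstar; rule_valle;
      rule_termvar; rule_termconst; rule_termadd; rule_termmul; rule_termstar;
      rule_subvar; rule_subconst; rule_subadd; rule_submul; rule_substar;
      rule_subjunk;       rule_good0; rule_good; rule_low0; rule_low; rule_app].
Definition rules := base_rules ++ map rule_law (iota 0 (size star_laws)).

Definition norm_machine := machine rules.

Lemma machine_norm_computable : computable fB -> computable fm ->
  computable norm_machine.
Proof.
move=> cB cm; apply: machine_computable => i; rewrite size_cat size_map size_iota => lti.
have cnth f g : computable f -> computable g ->
    computable (fun n => code_nth (f n) (g n)).
  move=> cf cg; rewrite /code_nth; apply: computable_pi1.
  by apply: computable_iter => //; computability.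
rewrite nth_cat; case: ifP => [lti' | nlti]; last first.
  have law : computable (fun n =>
      nth (fun _ _ _ => 0) [seq rule_law i | i <- iota 0 (size star_laws)]
      (i - 33) (pi1 n) (pi1 (pi2 n)) (pi2 (pi2 n))).
    have lt : i - 33 < size star_laws by move: lti nlti => /=; lia.
    rewrite (nth_map 0) ?size_iota // nth_iota // /rule_law /jdist.
    by computability; apply: computable_inst; computability.
  exact: law.
do 33?[case: i lti lti' => [|i] lti lti' /=].
all: rewrite ?/rule_refl ?/rule_sym ?/rule_tri ?/rule_add ?/rule_star
  ?/rule_mull ?/rule_mulr ?/rule_cstar ?/rule_rel ?/rule_unit ?/rule_central ?/rule_junk
  ?/rule_valconst ?/rule_valadd ?/rule_valmul ?/rule_valstar ?/rule_valle
  ?/rule_termvar ?/rule_termconst ?/rule_termadd ?/rule_termmul ?/rule_termstar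
  ?/rule_subvar ?/rule_subconst ?/rule_subadd ?/rule_submul ?/rule_substar ?/rule_subjunk
  ?/rule_good0 ?/rule_good ?/rule_low0 ?/rule_low ?/rule_app.
all: rewrite ?/is_dist ?/is_val ?/is_sub ?/is_good ?/is_low ?/is_term
  ?/jterm ?/snd0 ?/jdist ?/jval ?/jsub ?/jgood ?/jlow ?/japp
  ?/fst4 ?/snd4 ?/fst3 ?/snd3 ?/fst2 ?/snd2 ?/fst1 ?/snd1
  ?/gle ?/gaddc ?/gmulc ?/gconjc ?/gconst ?/gcode ?/gre ?/gim ?/gden
  ?/zadd ?/zmul ?/zopp ?/zscale ?/zcode
  ?/sample ?/normB ?/rel_term ?/rel_bound
  ?/rle ?/rlt ?/radd ?/rmul ?/rpow ?/code_add ?/code_mul ?/code_star ?/code_var ?/code_const.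
all: computability.
all: by [apply: cnth; computability | move: lti'].
Qed.

End Codes.

(** * Values of terms and codes *)

(** Bound and Lipschitz constant are natural numbers read off the syntax, so that rules can compute
    them. For constants, [code_int] dominates the absolute value and the denominator is dropped. *)
Fixpoint plip (bnd : nat) (p : starpoly nat) : nat * nat :=
  match p with
  | PVar _ => (bnd, 1%N)
  | PConst a b _ => ((code_int a + code_int b)%N, 0%N)
  | PAdd p q => (((plip bnd p).1 + (plip bnd q).1)%N, ((plip bnd p).2 + (plip bnd q).2)%N)
  | PMul p q => (((plip bnd p).1 * (plip bnd q).1)%N,
      ((plip bnd p).2 * (plip bnd q).1 + (plip bnd p).1 * (plip bnd q).2)%N)
  | PStar p => plip bnd p
  end.

Section Evaluation.
Variable R : realType.

Lemma star_law_sound (A : cstar R) (i : nat) (x : nat -> A) :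
  peval x (star_law i).1 = peval x (star_law i).2.
Proof.
have c0 : (Complex ((0 : int)%:~R / 1%:R) ((0 : int)%:~R / 1%:R) : R[i]) = 0.
  by rewrite !mul0r.
have c1 : (Complex ((1 : int)%:~R / 1%:R) ((0 : int)%:~R / 1%:R) : R[i]) = 1.
  by rewrite mul0r divr1.
have cN1 : (Complex ((-1 : int)%:~R / 1%:R) ((0 : int)%:~R / 1%:R) : R[i]) = -1.
  by rewrite mul0r divr1; apply/eqP; rewrite eq_complex /= oppr0 !eqxx.
rewrite /star_law; do 12?[case: i => [|i]]; rewrite /= ?c0 ?c1 ?cN1.
- exact: addrA.
- exact: addrC.
- by rewrite scale0r add0r.
- by rewrite scaleN1r mulN1r addNr scale0r.
- exact: mulrA.
- by rewrite scale1r mul1r.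
- by rewrite scale1r mulr1.
- exact: mulrDl.
- exact: mulrDr.
- exact: starK.
- exact: starD.
- exact: starM.
- by rewrite nth_nil.
Qed.

Lemma pevalD (A : cstar R) (V : Type) (x : V -> A) p q :
  peval x (PAdd p q) = peval x p + peval x q.
Proof. by []. Qed.
Lemma pevalM (A : cstar R) (V : Type) (x : V -> A) p q :
  peval x (PMul p q) = peval x p * peval x q.
Proof. by []. Qed.
Lemma peval_star (A : cstar R) (V : Type) (x : V -> A) p :
  peval x (PStar p) = star (peval x p).
Proof. by []. Qed.

Lemma peval_gauss (A : cstar R) (x : nat -> A) a b d :
  peval x (PConst nat a b d) = gauss R (a, b, d) *: 1.
Proof. by []. Qed.

Lemma peval_zero (A : cstar R) (x : nat -> A) : peval x (pzero nat) = 0.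
Proof. by rewrite peval_gauss /gauss /= !mul0r scale0r. Qed.

Lemma peval_one (A : cstar R) (x : nat -> A) : peval x (pone nat) = 1.
Proof. by rewrite peval_gauss /gauss /= mul0r divr1 scale1r. Qed.

Lemma peval_ext (A : cstar R) (V : Type) (x y : V -> A) (p : starpoly V) :
  x =1 y -> peval x p = peval y p.
Proof.
by move=> xy; elim: p => //= [p -> q ->|p -> q ->|p ->].
Qed.

Lemma peval_starhom (A D : cstar R) (V : Type) (phi : starhom A D) (x : V -> A)
    (p : starpoly V) : phi (peval x p) = peval (fun v => phi (x v)) p.
Proof.
elim: p => //= [a b d|p <- q <-|p <- q <-|p <-].
- by rewrite linearZ rmorph1.
- exact: raddfD.
- exact: rmorphM.
- exact: starhom_star.
Qed.

Lemma natrE_int (z : int) : `|z%:~R : R| <= (code_int z)%:R.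
Proof.
case: z => n /=; first by rewrite ger0_norm ?ler0n // ler_nat -addnn leq_addr.
by rewrite NegzE rmorphN normrN ger0_norm ?ler0n // ler_nat -addnn ltnS leq_addr.
Qed.

Lemma plip_sound (A : cstar R) (x y : nat -> A) (bnd : nat) (e : R) (p : starpoly nat) :
  (forall k, cnorm (x k) <= bnd%:R) -> (forall k, cnorm (y k) <= bnd%:R) ->
  (forall k, cnorm (x k - y k) <= e) ->
  [/\ cnorm (peval x p) <= (plip bnd p).1%:R, cnorm (peval y p) <= (plip bnd p).1%:R
    & cnorm (peval x p - peval y p) <= (plip bnd p).2%:R * e].
Proof.
move=> xb yb xy; elim: p => [v|a b d|p [p1 p2 p3] q [q1 q2 q3]|p [p1 p2 p3] q [q1 q2 q3]
  |p [p1 p2 p3]] /=.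
- by rewrite mul1r.
- rewrite subrr cnorm0 mul0r !cnormZ cnorm1 mulr1.
  have le : normc (Complex (a%:~R / d.+1%:R) (b%:~R / d.+1%:R))
      <= (code_int a + code_int b)%:R :> R.
    apply: le_trans (normc_le_abs _ _) _.
    have h (z : int) : `|z%:~R / d.+1%:R : R| <= (code_int z)%:R.
      rewrite normrM (ger0_norm (_ : 0 <= d.+1%:R^-1)) //.
      by rewrite ler_pdivrMr // (le_trans (natrE_int z)) // ler_peMr // ler1n.
    by rewrite natrD lerD.
  by split.
- rewrite !natrD; split.
  + exact: le_trans (cnormD _ _) (lerD p1 q1).
  + exact: le_trans (cnormD _ _) (lerD p2 q2).
  + rewrite opprD addrACA mulrDl; exact: le_trans (cnormD _ _) (lerD p3 q3).
- have m (u v : A) s t : cnorm u <= s -> cnorm v <= t -> cnorm (u * v) <= s * t.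
    by move=> us vt; apply: le_trans (cnormM _ _) _; apply: ler_pM; rewrite ?cnorm_ge0.
  rewrite natrD !natrM; split; [exact: m|exact: m|].
  have -> : peval x p * peval x q - peval y p * peval y q =
      (peval x p - peval y p) * peval x q + peval y p * (peval x q - peval y q).
    by rewrite mulrBl mulrBr addrA subrK.
  have h1 := m _ _ _ _ p3 q1; have h2 := m _ _ _ _ p2 q3.
  by have := cnormD ((peval x p - peval y p) * peval x q)
    (peval y p * (peval x q - peval y q)); lra.
- by rewrite -starB !cnorm_star.
Qed.

Definition rval (r : nat) : R := (pi1 r)%:R / (pi2 r).+1%:R.

Lemma rval_ge0 r : 0 <= rval r.
Proof. by rewrite divr_ge0. Qed.

Lemma rval0 : rval 0 = 0. Proof. by rewrite /rval (pi1K 0 0) mul0r. Qed.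

Lemma rval_npair a d : rval (npair a d) = a%:R / d.+1%:R.
Proof. by rewrite /rval !piK. Qed.

Lemma rvalD r s : rval (radd r s) = rval r + rval s.
Proof.
rewrite /rval /radd !piK addf_div ?pnatr_eq0 // -!natrM -natrD; congr (_ / _%:R).
by rewrite mulSn mulnS; lia.
Qed.

Lemma rvalM r s : rval (rmul r s) = rval r * rval s.
Proof.
rewrite /rval /rmul !piK mulf_div -!natrM; congr (_ / _%:R).
by rewrite mulSn mulnS; lia.
Qed.

Lemma rle_rval r s : rle r s = (rval r <= rval s).
Proof. by rewrite /rle /rval ler_pdivrMr // mulrAC ler_pdivlMr // -!natrM ler_nat. Qed.

Lemma rlt_rval r s : rlt r s = (rval r < rval s).
Proof. by rewrite /rlt /rval ltr_pdivrMr // mulrAC ltr_pdivlMr // -!natrM ltr_nat. Qed.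

Lemma rval_pow k : rval (rpow k) = 2 ^- k.
Proof. by rewrite rval_npair prednK ?expn_gt0 // natrX mul1r. Qed.

Definition zval (x : nat) : R := (pi1 x)%:R - (pi2 x)%:R.

Lemma zvalD x y : zval (zadd x y) = zval x + zval y.
Proof. by rewrite /zval !piK !natrD; ring. Qed.
Lemma zvalM x y : zval (zmul x y) = zval x * zval y.
Proof. by rewrite /zval !piK !natrD !natrM; ring. Qed.
Lemma zvalN x : zval (zopp x) = - zval x.
Proof. by rewrite /zval !piK; ring. Qed.
Lemma zvalZ n x : zval (zscale n x) = n%:R * zval x.
Proof. by rewrite /zval !piK !natrM; ring. Qed.
Lemma zval_code z : zval (zcode z) = (decode_int z)%:~R.
Proof.
rewrite /zval /zcode /decode_int; case: (odd z); rewrite !piK /=; last by rewrite subr0.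
by rewrite NegzE rmorphN sub0r.
Qed.

Definition gval (v : nat) : R[i] :=
  Complex (zval (gre v) / (gden v).+1%:R) (zval (gim v) / (gden v).+1%:R).

Lemma gcodeE x y d : (gre (gcode x y d) = x) * (gim (gcode x y d) = y) *
  (gden (gcode x y d) = d).
Proof. by rewrite /gre /gim /gden /gcode !piK. Qed.

Let den (d e : nat) : (d * e + d + e).+1%:R = d.+1%:R * e.+1%:R :> R.
Proof. by rewrite -natrM; congr _%:R; lia. Qed.

Lemma gvalD v w : gval (gaddc v w) = gval v + gval w.
Proof.
have v0 : (gden v).+1%:R != 0 :> R by rewrite pnatr_eq0.
have w0 : (gden w).+1%:R != 0 :> R by rewrite pnatr_eq0.
apply/eqP; rewrite /gval eq_complex /= !gcodeE !zvalD !zvalZ den.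
move: (_.+1%:R) (_.+1%:R) v0 w0 => a b a0 b0.
by apply/andP; split; apply/eqP; field; rewrite a0 b0.
Qed.

Lemma gvalM v w : gval (gmulc v w) = gval v * gval w.
Proof.
have v0 : (gden v).+1%:R != 0 :> R by rewrite pnatr_eq0.
have w0 : (gden w).+1%:R != 0 :> R by rewrite pnatr_eq0.
apply/eqP; rewrite /gval eq_complex /= !gcodeE !zvalD !zvalN !zvalM den.
move: (_.+1%:R) (_.+1%:R) v0 w0 => a b a0 b0.
by apply/andP; split; apply/eqP; field; rewrite a0 b0.
Qed.

Lemma gval_conj v : gval (gconjc v) = conjc (gval v).
Proof.
by apply/eqP; rewrite /gval eq_complex /= !gcodeE zvalN mulNr !eqxx.
Qed.

Lemma gval_const c : gval (gconst c) =
  gauss R (decode_int (pi1 c), decode_int (pi1 (pi2 c)), pi2 (pi2 c)).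
Proof. by rewrite /gval /gauss !gcodeE !zval_code. Qed.

Lemma gle_gval v r : gle v r = (normc (gval v) <= rval r).
Proof.
have d0 : 0 < (gden v).+1%:R ^+ 2 :> R by rewrite exprn_gt0.
have e0 : 0 < (pi2 r).+1%:R ^+ 2 :> R by rewrite exprn_gt0.
rewrite -[rval r]ger0_norm ?rval_ge0 // -[RHS]ler_sqr ?nnegrE ?normc_ge0 //.
rewrite /= sqr_sqrtr ?addr_ge0 ?sqr_ge0 // real_normK ?num_real //.
rewrite !exprMn -mulrDl !exprVn ler_pdivrMr // mulrAC ler_pdivlMr //.
rewrite /gle -(ler_nat R) !(natrD, natrM) /zval -subr_ge0 -[RHS]subr_ge0.
by congr (0 <= _); ring.
Qed.

End Evaluation.

(** * Soundness of the rules *)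

Section Soundness.
Variables (R : realType) (A B : cstar R) (PA : nat -> A) (PB : nat -> B).
Variables (ngens bnd : nat) (rels : seq (nat * nat)) (fB fm : nat -> nat).

Definition sample_at (c k : nat) : B := peval PB (decode_poly (sample ngens c k)).

Lemma sample_atE c k : sample_at c k = peval PB (decode_poly (sample ngens c k)).
Proof. by []. Qed.

Definition near_model (c i : nat) : Prop := forall i', (i' < i)%N ->
  cnorm (peval (sample_at c) (decode_poly (rel_term rels i')))
    <= rval R (rel_bound rels i') + 2 ^- fm (pi1 c).

Hypothesis approxB : forall p k,
  `|cnorm (peval PB p) - ratr (decode_rat (fB (npair (code_poly p) k)))| < 2 ^- k.
Hypothesis rels_A : forall i, (i < size rels)%N ->
  cnorm (peval PA (decode_poly (rel_term rels i))) <= rval R (rel_bound rels i).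
Hypothesis unit_A : forall k, (ngens <= k)%N -> PA k = 1.
Hypothesis bnd_A : forall k, cnorm (PA k) + 1 <= bnd%:R.
Hypothesis stable : forall c, near_model c (size rels) ->
  exists phi : starhom A B, forall k, cnorm (phi (PA k) - sample_at c k) <= 2 ^- pi1 c.

Local Notation evA p := (peval PA (decode_poly p)).

Definition dist_sem p q r := cnorm (evA p - evA q) <= rval R r.
Definition val_sem e v := evA e = gval R v *: 1.
(** The clause that [p'] is a genuine code is what allows [approxB] to be applied to it. *)
Definition sub_sem c p p' M E :=
  [/\ decode_poly p' = psubst (fun k => decode_poly (sample ngens c k)) (decode_poly p),
      code_poly (decode_poly p') = p' & (M, E) = plip bnd (decode_poly p)].
Definition low_sem p u := rval R u <= cnorm (evA p).
Definition app_sem p k q := `|cnorm (evA p) - ratr (decode_rat q)| < 2 ^- k :> R.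

Definition sem (j : nat) : Prop :=
  match pi1 j with
  | 1 => dist_sem (fst1 j) (fst2 j) (snd2 j)
  | 2 => val_sem (fst1 j) (snd1 j)
  | 3 => sub_sem (fst1 j) (fst2 j) (fst3 j) (fst4 j) (snd4 j)
  | 4 => near_model (fst1 j) (snd1 j)
  | 5 => low_sem (fst1 j) (snd1 j)
  | 6 => app_sem (pi1 (fst1 j)) (pi2 (fst1 j)) (snd1 j)
  | 7 => code_poly (decode_poly (snd0 j)) = snd0 j
  | _ => True
  end.

Lemma sem_dist p q r : sem (jdist p q r) = dist_sem p q r.
Proof. by rewrite /sem !distE /jdist piK. Qed.
Lemma sem_val e v : sem (jval e v) = val_sem e v.
Proof. by rewrite /sem !valE /jval piK. Qed.
Lemma sem_sub c p p' M E : sem (jsub c p p' M E) = sub_sem c p p' M E.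
Proof. by rewrite /sem !subE /jsub piK. Qed.
Lemma sem_good c i : sem (jgood c i) = near_model c i.
Proof. by rewrite /sem !goodE /jgood piK. Qed.
Lemma sem_low p u : sem (jlow p u) = low_sem p u.
Proof. by rewrite /sem !lowE /jlow piK. Qed.
Lemma sem_app p k q : sem (japp p k q) = app_sem p k q.
Proof. by rewrite /sem /fst1 /snd1 /japp !piK. Qed.
Lemma sem_term p : sem (jterm p) = (code_poly (decode_poly p) = p).
Proof. by rewrite /sem !termE /jterm piK. Qed.
Lemma sem0 : sem 0. Proof. by rewrite /sem (pi1K 0 0). Qed.

Lemma sem_if (b : bool) j : (b -> sem j) -> sem (if b then j else 0%N).
Proof. by case: b => [/(_ isT)|_ ] //; exact: sem0. Qed.

Lemma is_distP j : is_dist j -> sem j -> dist_sem (fst1 j) (fst2 j) (snd2 j).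
Proof. by move=> /eqP {1}->; rewrite sem_dist. Qed.
Lemma is_valP j : is_val j -> sem j -> val_sem (fst1 j) (snd1 j).
Proof. by move=> /eqP {1}->; rewrite sem_val. Qed.
Lemma is_subP j : is_sub j -> sem j ->
  sub_sem (fst1 j) (fst2 j) (fst3 j) (fst4 j) (snd4 j).
Proof. by move=> /eqP {1}->; rewrite sem_sub. Qed.
Lemma is_goodP j : is_good j -> sem j -> near_model (fst1 j) (snd1 j).
Proof. by move=> /eqP {1}->; rewrite sem_good. Qed.
Lemma is_lowP j : is_low j -> sem j -> low_sem (fst1 j) (snd1 j).
Proof. by move=> /eqP {1}->; rewrite sem_low. Qed.
Lemma is_termP j : is_term j -> sem j -> code_poly (decode_poly (snd0 j)) = snd0 j.
Proof. by move=> /eqP {1}->; rewrite sem_term. Qed.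

Lemma normB_approx p k : code_poly (decode_poly p) = p ->
  `|cnorm (peval PB (decode_poly p)) - rval R (normB fB p k)| < 2 ^- k.
Proof.
move=> pE; have := approxB (decode_poly p) k; rewrite pE /normB.
set q := fB _; rewrite /decode_rat -/(pi1 q) -/(pi2 q) rval_npair.
set x := cnorm _; have x0 : 0 <= x := cnorm_ge0 _.
have -> : ratr ((decode_int (pi1 q))%:~R / (pi2 q).+1%:R) =
    (decode_int (pi1 q))%:~R / (pi2 q).+1%:R :> R.
  by rewrite fmorph_div /= ratr_int ratr_nat.
rewrite /decode_int; case: ifP => _; last first.
  by rewrite -[(Posz _)%:~R]/(_%:R).
(* A negative answer -y had error x + y with x, y >= 0; replacing it by 0 leaves the error x. *)
rewrite mul0r subr0 NegzE rmorphN mulNr opprK.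
have y0 : 0 <= (pi1 q)./2.+1%:~R / (pi2 q).+1%:R :> R by rewrite divr_ge0.
by rewrite !ger0_norm ?addr_ge0 //; apply: le_lt_trans; rewrite lerDl.
Qed.

Lemma evA_zero : evA code_zero = 0.
Proof. by rewrite /code_zero code_polyK peval_zero. Qed.

Let m2 (u v : A) s t : cnorm u <= s -> cnorm v <= t -> cnorm (u * v) <= s * t.
Proof. by move=> us vt; apply: le_trans (cnormM _ _) _; apply: ler_pM; rewrite ?cnorm_ge0. Qed.

(** Contractivity gives ||p|| >= ||phi(p)||; the Lipschitz bound passes to the sample point, losing
    E 2^-n; the norm computation loses 2^-k. *)
Lemma low_sound c p p' M E k u : near_model c (size rels) -> sub_sem c p p' M E ->
  rval R u + (2 ^- k + E%:R * 2 ^- pi1 c) <= rval R (normB fB p' k) -> low_sem p u.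
Proof.
move=> gc [p'E p'K /(congr1 snd)/= EE] le_u; have [phi phiP] := stable gc.
have pA := normB_approx k p'K.
have phib n : cnorm (phi (PA n)) <= bnd%:R.
  have := starhom_contractive phi (PA n); have := bnd_A n; lra.
(* Sample points are within 1 of the images of the generators; the summand 1 in [bnd_A] keeps them
   in the ball of radius [bnd]. *)
have e1 : 2 ^- pi1 c <= 1 :> R by rewrite invf_le1 ?exprn_gt0 // exprn_ege1 // ler1n.
have ptb n : cnorm (sample_at c n) <= bnd%:R.
  have := cnormD (sample_at c n - phi (PA n)) (phi (PA n)); rewrite subrK cdistC.
  have := phiP n; have := starhom_contractive phi (PA n); have := bnd_A n; lra.
have [_ _] := plip_sound (decode_poly p) phib ptb phiP.
rewrite -EE -peval_starhom /= => h.
rewrite /low_sem; apply: le_trans (starhom_contractive phi _).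
move: pA; rewrite p'E peval_psubst => pA.
have := ler_norml (cnorm (peval (sample_at c) (decode_poly p)) - rval R (normB fB p' k)) (2 ^- k).
rewrite (ltW pA) => /esym/andP[h1 h2].
have := cdist_norm (phi (evA p)) (peval (sample_at c) (decode_poly p)).
rewrite ler_norml => /andP[h3 h4]; lra.
Qed.

Lemma base_rules_sound i w a b : sem a -> sem b ->
  sem (nth (fun _ _ _ => 0%N) (base_rules ngens bnd rels fB fm) i w a b).
Proof.
move=> sa sb; do 33?[case: i => [|i]]; rewrite [nth _ _ _]/=.
- by rewrite sem_dist /dist_sem subrr cnorm0 rval_ge0.
- apply: sem_if => /is_distP/(_ sa); rewrite sem_dist.
  by rewrite /dist_sem cdistC.
- apply: sem_if => /and3P[/is_distP/(_ sa) ha /is_distP/(_ sb) hb /eqP E].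
  rewrite sem_dist /dist_sem rvalD; apply: le_trans (cdist_triangle (evA (fst2 a)) _ _) _.
  by apply: lerD ha _; rewrite E.
- apply: sem_if => /andP[/is_distP/(_ sa) ha /is_distP/(_ sb) hb].
  rewrite sem_dist /dist_sem rvalD !decodeD !pevalD opprD addrACA.
  exact: le_trans (cnormD _ _) (lerD ha hb).
- apply: sem_if => /is_distP/(_ sa); rewrite sem_dist /dist_sem !decode_star !peval_star.
  by rewrite -starB cnorm_star.
- apply: sem_if => /and3P[/is_distP/(_ sa) ha /is_distP/(_ sb) hb /eqP E].
  move: hb; rewrite sem_dist /dist_sem rvalM !decodeM !pevalM E evA_zero subr0 => hb.
  by rewrite -mulrBl; exact: m2.
- apply: sem_if => /and3P[/is_distP/(_ sa) ha /is_distP/(_ sb) hb /eqP E].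
  move: hb; rewrite sem_dist /dist_sem rvalM !decodeM !pevalM E evA_zero subr0 => hb.
  by rewrite -mulrBr; exact: m2.
- apply: sem_if => /and4P[/is_distP/(_ sa) + /eqP E1 /eqP E2].
  rewrite E1 E2 (rle_rval R) rvalM sem_dist /dist_sem decodeM decode_star pevalM peval_star.
  rewrite evA_zero !subr0 cnorm_cstar -expr2 => h1 /(le_trans h1).
  by rewrite ler_sqr ?nnegrE ?cnorm_ge0 ?rval_ge0.
- apply: sem_if => lt_w; rewrite sem_dist /dist_sem evA_zero subr0; exact: rels_A.
- apply: sem_if => le_w; rewrite sem_dist /dist_sem decode_var /code_one code_polyK.
  by rewrite peval_one /= unit_A // subrr cnorm0 rval_ge0.
- rewrite sem_dist /dist_sem !decodeM decode_const /=.
  by rewrite -scalerAl -scalerAr mul1r mulr1 subrr cnorm0 rval_ge0.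
- by rewrite sem_dist /dist_sem decode_junk ?peval_zero ?evA_zero subrr cnorm0 rval_ge0.
- by rewrite sem_val /val_sem decode_const gval_const.
- apply: sem_if => /andP[/is_valP/(_ sa) ha /is_valP/(_ sb) hb].
  by rewrite sem_val /val_sem gvalD decodeD /= ha hb scalerDl.
- apply: sem_if => /andP[/is_valP/(_ sa) ha /is_valP/(_ sb) hb].
  by rewrite sem_val /val_sem gvalM decodeM /= ha hb -scalerAl mul1r scalerA.
- apply: sem_if => /is_valP/(_ sa) ha.
  by rewrite sem_val /val_sem gval_conj decode_star /= ha starZ star1.
- apply: sem_if => /andP[/is_valP/(_ sa) ha]; rewrite (gle_gval R) => le_w.
  by rewrite sem_dist /dist_sem ha evA_zero subr0 cnormZ cnorm1 mulr1.
- by rewrite sem_term decode_var.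
- by rewrite sem_term decode_const /= !decode_intK !npairE.
- apply: sem_if => /andP[/is_termP/(_ sa) ha /is_termP/(_ sb) hb].
  by rewrite sem_term decodeD /= ha hb.
- apply: sem_if => /andP[/is_termP/(_ sa) ha /is_termP/(_ sb) hb].
  by rewrite sem_term decodeM /= ha hb.
- by apply: sem_if => /is_termP/(_ sa) ha; rewrite sem_term decode_star /= ha.
- apply: sem_if => /andP[/is_termP/(_ sa) ha /eqP E].
  by rewrite sem_sub; split=> //; rewrite decode_var /= ?E.
- rewrite sem_sub; split; rewrite decode_const //=.
    by rewrite !decode_intK !npairE.
  by rewrite !decode_intK.
- apply: sem_if => /and3P[/is_subP/(_ sa) [a1 a2 a3] /is_subP/(_ sb) [b1 b2 b3] /eqP E].
  rewrite sem_sub; split; rewrite !decodeD /=.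
  + by rewrite a1 b1 E.
  + by rewrite a2 b2.
  + by rewrite -a3 -b3.
- apply: sem_if => /and3P[/is_subP/(_ sa) [a1 a2 a3] /is_subP/(_ sb) [b1 b2 b3] /eqP E].
  rewrite sem_sub; split; rewrite !decodeM /=.
  + by rewrite a1 b1 E.
  + by rewrite a2 b2.
  + by rewrite -a3 -b3.
- apply: sem_if => /is_subP/(_ sa) [a1 a2 a3].
  rewrite sem_sub; split; rewrite !decode_star //=; first by rewrite a1.
  by rewrite a2.
- by rewrite sem_sub; split; rewrite ?decode_junk // /code_zero code_polyK.
- by rewrite /rule_good0 sem_good => i'.
- apply: sem_if => /and5P[/is_goodP/(_ sa) ha /is_subP/(_ sb) [b1 b2 b3]].
  move=> /eqP E1 /eqP E2 /andP[lt_s].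
  rewrite (rle_rval R) !rvalD !rval_pow => le_b; rewrite sem_good => i'.
  rewrite ltnS leq_eqVlt => /predU1P[->|]; last exact: ha.
  have := normB_approx w b2; rewrite b1 E2 peval_psubst -E1 -/(sample_at _).
  move=> /ltW; rewrite ler_norml => /andP[_ h]; move: le_b h; rewrite -/(sample_at _).
  set x := cnorm _; lra.
- by rewrite sem_low /low_sem rval0 cnorm_ge0.
- apply: sem_if => /and5P[/is_goodP/(_ sa) ha /is_subP/(_ sb) hb /eqP E1 /eqP E2].
  rewrite (rle_rval R) !rvalD rvalM !rval_pow rval_npair divr1 => le_u.
  rewrite sem_low; rewrite E2 in ha; rewrite -E1 in hb.
  exact: low_sound ha hb le_u.
- apply: sem_if => /and5P[/is_distP/(_ sa) ha /is_lowP/(_ sb) hb /eqP E1 /eqP E2].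
  rewrite (rlt_rval R) rvalD rval_pow => lt_r.
  move: ha hb; rewrite sem_app /dist_sem /low_sem /app_sem E1 -E2 evA_zero subr0 => ha hb.
  have -> : ratr (decode_rat (npair (pi1 (snd2 a) + pi1 (snd2 a)) (pi2 (snd2 a))))
      = rval R (snd2 a).
    rewrite /decode_rat npairK /decode_int /= oddD addbb addnn doubleK.
    by rewrite fmorph_div /= ratr_int ratr_nat.
  rewrite distrC ger0_norm ?subr_ge0 //; lra.
- by rewrite nth_nil; exact: sem0.
Qed.

Lemma provable_sound j : provable (rules ngens bnd rels fB fm) j -> sem j.
Proof.
elim=> [|i w a b _ sa _ sb]; first exact: sem0.
rewrite /rules nth_cat; case: ifP => _; first exact: base_rules_sound.
move: (i - _)%N => k; have [lt_k|le_k] := ltnP k (size star_laws); last first.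
  by rewrite nth_default ?size_map ?size_iota //; exact: sem0.
rewrite (nth_map 0%N) ?size_iota // nth_iota // sem_dist /dist_sem !decode_inst.
by rewrite !peval_psubst star_law_sound subrr cnorm0 rval_ge0.
Qed.

End Soundness.

(** * The seminorm of provable bounds *)

Section Completeness.
Variables (R : realType) (ngens bnd : nat) (rels : seq (nat * nat)).
Variables (fB fm : nat -> nat).

Notation prov := (provable (rules ngens bnd rels fB fm)).
Notation zero := (pzero nat).

Lemma rval_dense (x y : R) : 0 <= x -> x < y -> exists r, x < rval R r < y.
Proof.
move=> x0 /rat_in_itvoo[q]; rewrite in_itv /= => /andP[xq qy].
have q0 : 0 < q by rewrite -(ltr0q R) (le_lt_trans x0).
exists (npair `|numq q|%N `|denq q|%N.-1); rewrite rval_npair.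
suff -> : `|numq q|%N%:R / `|denq q|%N.-1.+1%:R = ratr q :> R by rewrite xq.
rewrite prednK ?absz_gt0 ?denq_neq0 // !natr_absz /ratr.
by rewrite !ger0_norm ?denq_ge0 // numq_ge0 ltW.
Qed.

(** Only rational bounds are derivable; a real bound holds when some derivable rational is at most
    it. *)
Definition proves_dist (p q : nat) (x : R) : Prop :=
  exists2 r, prov (jdist p q r) & rval R r <= x.
Notation D p q := (proves_dist (code_poly p) (code_poly q)).

Lemma distW p q x y : proves_dist p q x -> x <= y -> proves_dist p q y.
Proof. by move=> [r pr rx] xy; exists r => //; exact: le_trans xy. Qed.

Lemma dist_refl p : proves_dist p p 0.
Proof.
exists 0%N; last by rewrite rval0.
exact: (provable_rule 0 p (provable0 _) (provable0 _)).
Qed.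

Lemma dist_sym p q x : proves_dist p q x -> proves_dist q p x.
Proof.
move=> [r pr rx]; exists r => //.
by have := provable_rule 1 0 pr pr; rewrite /= /rule_sym !distE.
Qed.

Lemma dist_tri q p s x y :
  proves_dist p q x -> proves_dist q s y -> proves_dist p s (x + y).
Proof.
move=> [r pr rx] [t pt ty]; exists (radd r t); last by rewrite rvalD lerD.
by have := provable_rule 2 0 pr pt; rewrite /= /rule_tri !distE eqxx.
Qed.

Lemma dist_add p q p' q' x y : proves_dist p p' x -> proves_dist q q' y ->
  proves_dist (code_add p q) (code_add p' q') (x + y).
Proof.
move=> [r pr rx] [t pt ty]; exists (radd r t); last by rewrite rvalD lerD.
by have := provable_rule 3 0 pr pt; rewrite /= /rule_add !distE.
Qed.

Lemma dist_star p q x :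
  proves_dist p q x -> proves_dist (code_star p) (code_star q) x.
Proof.
move=> [r pr rx]; exists r => //.
by have := provable_rule 4 0 pr pr; rewrite /= /rule_star !distE.
Qed.

Lemma dist_mull p q s x y : proves_dist p q x -> proves_dist s code_zero y ->
  proves_dist (code_mul p s) (code_mul q s) (x * y).
Proof.
move=> [r pr rx] [t pt ty]; exists (rmul r t); last first.
  by rewrite rvalM ler_pM ?rval_ge0.
by have := provable_rule 5 0 pr pt; rewrite /= /rule_mull !distE eqxx.
Qed.

Lemma dist_mulr p q s x y : proves_dist p q x -> proves_dist s code_zero y ->
  proves_dist (code_mul s p) (code_mul s q) (y * x).
Proof.
move=> [r pr rx] [t pt ty]; exists (rmul t r); last first.
  by rewrite rvalM ler_pM ?rval_ge0.
by have := provable_rule 6 0 pr pt; rewrite /= /rule_mulr !distE eqxx.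
Qed.

(** The rule takes a rational root bound, found strictly between y and z; hence the slack in the
    conclusion. *)
Lemma dist_cstar p x y : D (PMul (PStar p) p) zero x -> 0 <= y -> x < y ^+ 2 ->
  forall z, y < z -> D p zero z.
Proof.
move=> [r pr rx] y0 xy z /(rval_dense y0)[s /andP[ys sz]].
exists s; last exact: ltW.
have := provable_rule 7 (npair (code_poly p) s) pr pr.
rewrite /= /rule_cstar !distE !piK !eqxx /= (rle_rval R) rvalM ifT //.
apply: le_trans rx _; apply: le_trans (ltW xy) _.
by rewrite expr2 ler_pM // ltW.
Qed.

Lemma dist_law i s : D (psubst s (star_law i).1) (psubst s (star_law i).2) 0.
Proof.
exists 0%N; last by rewrite rval0.
pose w := npair (code_poly (s 0%N)) (npair (code_poly (s 1%N)) (code_poly (s 2%N))).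
have [lt_i|le_i] := ltnP i (size star_laws); last first.
  (* Past the end of the list the default law is x = x, an instance of reflexivity. *)
  rewrite /star_law nth_default //.
  exact: (provable_rule 0 (code_poly (s 0%N)) (provable0 _) (provable0 _)).
(* In [rules] the laws come after the 33 base rules. *)
have := provable_rule (rules := rules ngens bnd rels fB fm) (33 + i) w (provable0 _) (provable0 _).
rewrite {2}/rules nth_cat [size (base_rules _ _ _ _ _)]/= ltnNge leq_addr addKn.
rewrite (nth_map 0%N) ?size_iota // nth_iota // add0n.
suff [E1 E2] : code_poly (psubst s (star_law i).1) = cinst (star_law i).1 w /\
    code_poly (psubst s (star_law i).2) = cinst (star_law i).2 w.
  by rewrite E1 E2.
by do 12?[case: i lt_i => [|i] lt_i]; rewrite //= /w !piK.
Qed.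

Lemma dist_rel i : (i < size rels)%N ->
  proves_dist (rel_term rels i) code_zero (rval R (rel_bound rels i)).
Proof.
move=> lt_i; exists (rel_bound rels i) => //.
by have := provable_rule (rules := rules ngens bnd rels fB fm) 8 i (provable0 _) (provable0 _);
  rewrite /= /rule_rel lt_i.
Qed.

Lemma dist_unit k : (ngens <= k)%N -> D (PVar k) (pone nat) 0.
Proof.
move=> le_k; exists 0%N; last by rewrite rval0.
by have := provable_rule (rules := rules ngens bnd rels fB fm) 9 k (provable0 _) (provable0 _);
  rewrite /= /rule_unit le_k.
Qed.

Lemma dist_central c p : D (PMul (pgauss nat c) p) (PMul p (pgauss nat c)) 0.
Proof.
exists 0%N; last by rewrite rval0.
have := provable_rule (rules := rules ngens bnd rels fB fm) 10
  (npair (pi2 (code_poly (pgauss nat c))) (code_poly p)) (provable0 _) (provable0 _).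
by rewrite /= /rule_central !piK.
Qed.

Definition proves_val (e : starpoly nat) (a : R[i]) : Prop :=
  exists2 v, prov (jval (code_poly e) v) & gval R v = a.

Lemma val_const c : proves_val (pgauss nat c) (gauss R c).
Proof.
pose w := npair (code_int c.1.1) (npair (code_int c.1.2) c.2).
exists (gconst w); last by rewrite gval_const /w !piK !code_intK; case: c {w} => -[].
exact: (provable_rule 12 w (provable0 _) (provable0 _)).
Qed.

Lemma val_add e e' a a' : proves_val e a -> proves_val e' a' ->
  proves_val (PAdd e e') (a + a').
Proof.
move=> [v pv <-] [w pw <-]; exists (gaddc v w); last exact: gvalD.
by have := provable_rule 13 0 pv pw; rewrite /= /rule_valadd !valE.
Qed.

Lemma val_mul e e' a a' : proves_val e a -> proves_val e' a' ->
  proves_val (PMul e e') (a * a').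
Proof.
move=> [v pv <-] [w pw <-]; exists (gmulc v w); last exact: gvalM.
by have := provable_rule 14 0 pv pw; rewrite /= /rule_valmul !valE.
Qed.

Lemma val_star e a : proves_val e a -> proves_val (PStar e) (conjc a).
Proof.
move=> [v pv <-]; exists (gconjc v); last exact: gval_conj.
by have := provable_rule 15 0 pv pv; rewrite /= /rule_valstar !valE.
Qed.

Lemma dist_val0 e a x : proves_val e a -> normc a < x -> D e zero x.
Proof.
move=> [v pv <-] /(rval_dense (normc_ge0 _))[r /andP[vr rx]].
exists r; last exact: ltW.
have := provable_rule 16 r pv pv.
by rewrite /= /rule_valle !valE (gle_gval R) (ltW vr).
Qed.

Let sigma (p q r : starpoly nat) (i : nat) := nth p [:: p; q; r] i.

(** Values of closed terms are compared with 0 only, so two closed terms are compared through their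
    difference. The chain is p = 0 + p = p + 0 = p + (-q + q) = (p - q) + q, then 0 + q = q. *)
Lemma dist_of_sub p q x : D (psub p q) zero x -> D p q x.
Proof.
move=> pq.
have h1 : D p (PAdd zero p) 0 := dist_sym (dist_law 2 (sigma p p p)).
have h2 : D (PAdd zero p) (PAdd p zero) 0 := dist_law 1 (sigma zero p p).
have h3 : D (PAdd p zero) (PAdd p (PAdd (popp q) q)) (0 + 0) :=
  dist_add (dist_refl (code_poly p)) (dist_sym (dist_law 3 (sigma q q q))).
have h4 : D (PAdd p (PAdd (popp q) q)) (PAdd (psub p q) q) 0 :=
  dist_law 0 (sigma p (popp q) q).
have h5 : D (PAdd (psub p q) q) (PAdd zero q) (x + 0) := dist_add pq (dist_refl _).
have h6 : D (PAdd zero q) q 0 := dist_law 2 (sigma q q q).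
apply: distW (dist_tri h1 (dist_tri h2 (dist_tri h3 (dist_tri h4 (dist_tri h5 h6))))) _.
by rewrite !(add0r, addr0).
Qed.

Lemma dist_val e e' a a' x : proves_val e a -> proves_val e' a' ->
  normc (a - a') < x -> D e e' x.
Proof.
move=> ea ea' lt_x; apply: dist_of_sub; apply: dist_val0 lt_x.
have -> : a - a' = a + gauss R (-1, 0, 0%N) * a'.
  rewrite (_ : gauss R _ = -1) ?mulN1r // /gauss /= mul0r divr1.
  by apply/eqP; rewrite eq_complex /= oppr0 !eqxx.
exact: val_add ea (val_mul (val_const (-1, 0, 0%N)) ea').
Qed.

Hypothesis gens_bounded : forall k, (k < ngens)%N ->
  exists2 i, (i < size rels)%N & rel_term rels i = code_var k.

Lemma val_zero : proves_val zero 0.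
Proof.
have := val_const (0, 0, 0%N); rewrite (_ : gauss R _ = 0) //.
by rewrite /gauss /= !mul0r.
Qed.

(** Makes the set behind the infimum [prov_dst] nonempty; variables are bounded by the norm
    relations. The bounds 1 are arbitrary positive numbers, as [dist_val0] needs strictness. *)
Lemma dist_bounded p : exists x, D p zero x.
Proof.
elim: p => [k|a b d|p [x px] q [y qy]|p [x px] q [y qy]|p [x px]].
- have [le_k|lt_k] := leqP ngens k.
    have [x one] : exists x, D (pone nat) zero x.
      exists (normc (gauss R (1, 0, 0%N)) + 1).
      by apply: dist_val0 (val_const (1, 0, 0%N)) _; rewrite ltrDl.
    by exists (0 + x); apply: dist_tri one; exact: dist_unit.
  have [i lt_i E] := gens_bounded lt_k; exists (rval R (rel_bound rels i)).
  by have := dist_rel lt_i; rewrite E.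
- exists (normc (gauss R (a, b, d)) + 1); apply: dist_val0 (val_const (a, b, d)) _.
  by rewrite ltrDl.
- have h : D (PAdd zero zero) zero 1.
    by apply: dist_val0 (val_add val_zero val_zero) _; rewrite addr0 normc0.
  by exists (x + y + 1); apply: dist_tri (dist_add px qy) h.
- have h : D (PMul zero zero) zero 1.
    by apply: dist_val0 (val_mul val_zero val_zero) _; rewrite mul0r normc0.
  have h' := dist_tri (dist_mulr qy (dist_refl code_zero)) h.
  by exists (x * y + (0 * y + 1)); apply: dist_tri (dist_mull px qy) h'.
- have h : D (PStar zero) zero 1.
    by apply: dist_val0 (val_star val_zero) _; rewrite rmorph0 normc0.
  by exists (x + 1); apply: dist_tri (dist_star px) h.
Qed.

Definition prov_dst p q : R := inf [set x | D p q x].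

Lemma D_ge0 p q x : D p q x -> 0 <= x.
Proof. by move=> [r _]; apply: le_trans; exact: rval_ge0. Qed.

Lemma prov_dst_le p q x : D p q x -> prov_dst p q <= x.
Proof. by move=> h; apply: ge_inf => //; exists 0 => y; exact: D_ge0. Qed.

Lemma dist_inhabited p q : [set x | D p q x] !=set0.
Proof.
have [x px] := dist_bounded p; have [y qy] := dist_bounded q.
by exists (x + y); exact: dist_tri px (dist_sym qy).
Qed.

Lemma prov_dst_lt p q x : prov_dst p q < x -> D p q x.
Proof.
by move=> /(inf_lt (dist_inhabited p q))[y /= h /ltW]; exact: distW.
Qed.

Lemma prov_dst_leP p q x : (forall y, x < y -> D p q y) -> prov_dst p q <= x.
Proof. by move=> h; apply/ler_addgt0Pr => e e0; apply/prov_dst_le/h; rewrite ltrDl. Qed.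

Lemma prov_dst_ge0 p q : 0 <= prov_dst p q.
Proof.
by apply: lb_le_inf (dist_inhabited p q) _ => z; exact: D_ge0.
Qed.

Lemma prov_dst0 p q : D p q 0 -> prov_dst p q = 0.
Proof. by move=> /prov_dst_le h; apply/eqP; rewrite eq_le h prov_dst_ge0. Qed.

Lemma le_mul_eps (x y z : R) : 0 <= x -> 0 <= y ->
  (forall e, 0 < e -> z <= (x + e) * (y + e)) -> z <= x * y.
Proof.
move=> x0 y0 h; apply/ler_addgt0Pr => e e0.
(* With d <= 1, (x + d)(y + d) <= xy + d (x + y + 1) <= xy + e. *)
pose d := Num.min 1 (e / (x + y + 1)).
have s0 : 0 < x + y + 1 by rewrite ltr_wpDl ?addr_ge0.
have d0 : 0 < d by rewrite lt_min ltr01 divr_gt0.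
have d1 : d <= 1 by rewrite ge_min lexx.
have d2 : d * (x + y + 1) <= e by rewrite -ler_pdivlMr // ge_min lexx orbT.
apply: le_trans (h d d0) _; nra.
Qed.

Hypothesis one_nontrivial : exists2 e : R, 0 < e &
  forall x, D (pone nat) zero x -> e <= x.

Lemma prov_dst_cstar : cstar_pseudometric prov_dst.
Proof.
have lt p q e : 0 < e -> D p q (prov_dst p q + e).
  by move=> e0; apply: prov_dst_lt; rewrite ltrDl.
split.
- by move=> p; apply: prov_dst0; exact: dist_refl.
- have le p q : prov_dst p q <= prov_dst q p.
    by apply: prov_dst_leP => y /prov_dst_lt; exact: dist_sym.
  by move=> p q; apply/eqP; rewrite eq_le !le.
- move=> q p r; apply/ler_addgt0Pr => e e0; have e2 : 0 < e / 2 by rewrite divr_gt0.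
  rewrite (splitr e) addrACA; apply: prov_dst_le.
  by apply: (dist_tri (q := code_poly q)); exact: lt.
- move=> p p' q q'; apply/ler_addgt0Pr => e e0; have e2 : 0 < e / 2 by rewrite divr_gt0.
  rewrite (splitr e) addrACA; apply: prov_dst_le.
  by apply: dist_add; exact: lt.
- by move=> p q; apply: prov_dst_leP => y /prov_dst_lt; exact: dist_star.
- move=> p q s; apply: le_mul_eps; rewrite ?prov_dst_ge0 // => e e0.
  by apply: prov_dst_le; apply: dist_mull; exact: lt.
- move=> p q s; apply: le_mul_eps; rewrite ?prov_dst_ge0 // => e e0.
  by apply: prov_dst_le; apply: dist_mulr; exact: lt.
(* If the inequality failed, a provable bound for p* p would lie below y^2 with y <
   [prov_dst p zero], and the root rule would prove a bound z below that infimum. *)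
- move=> p; rewrite leNgt; apply/negP => lt_sq.
  have := lt_sq; rewrite -[X in X < _]sqr_sqrtr ?prov_dst_ge0 //.
  rewrite ltr_sqr ?nnegrE ?prov_dst_ge0 ?sqrtr_ge0 // => lt_r.
  set s := Num.sqrt _ in lt_r; have s0 : 0 <= s by exact: sqrtr_ge0.
  pose y := (s + prov_dst p zero) / 2; have sy : s < y by rewrite midf_lt.
  have yp : y < prov_dst p zero by rewrite midf_lt.
  pose z := (y + prov_dst p zero) / 2; have yz : y < z by rewrite midf_lt.
  have zp : z < prov_dst p zero by rewrite midf_lt.
  have y0 : 0 <= y by rewrite (le_trans s0) // ltW.
  have : prov_dst (PMul (PStar p) p) zero < y ^+ 2.
    by rewrite -[X in X < _]sqr_sqrtr ?prov_dst_ge0 // ltr_sqr ?nnegrE.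
  set x := prov_dst (PMul _ _) _ => xy.
  pose t := (x + y ^+ 2) / 2; have xt : x < t by rewrite midf_lt.
  have ty : t < y ^+ 2 by rewrite midf_lt.
  have := prov_dst_le (dist_cstar (prov_dst_lt xt) y0 ty yz).
  by rewrite leNgt zp.
- by move=> i s; apply: prov_dst0; exact: dist_law.
- by move=> c c'; apply: prov_dst_leP => y; apply: dist_val; exact: val_const.
- move=> c c' c''; apply: prov_dst_leP => y; apply: dist_val; last exact: val_const.
  by apply: val_add; exact: val_const.
- move=> c c' c''; apply: prov_dst_leP => y; apply: dist_val; last exact: val_const.
  by apply: val_mul; exact: val_const.
- move=> c c'; apply: prov_dst_leP => y; apply: dist_val; last exact: val_const.
  by apply: val_star; exact: val_const.
- by move=> c p; apply: prov_dst0; exact: dist_central.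
- have [e e0 h] := one_nontrivial; apply: lt_le_trans e0 _.
  exact: lb_le_inf (dist_inhabited _ _) h.
Qed.

End Completeness.

(** * Completeness of the rules *)

Section NormApproximation.
Variables (R : realType) (A B : cstar R) (PA : nat -> A) (PB : nat -> B).
Variables (ngens bnd : nat) (rels : seq (nat * nat)) (fB fm : nat -> nat).

Notation sample_at := (sample_at PB ngens).
Notation near_model := (near_model PB ngens rels fm).
Notation prov := (provable (rules ngens bnd rels fB fm)).
Notation proves_dist := (@proves_dist R ngens bnd rels fB fm).
Notation evA p := (peval PA (decode_poly p)).

Hypothesis approxB : forall p k,
  `|cnorm (peval PB p) - ratr (decode_rat (fB (npair (code_poly p) k)))| < 2 ^- k.
Hypothesis rels_A : forall i, (i < size rels)%N ->
  cnorm (evA (rel_term rels i)) <= rval R (rel_bound rels i).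
Hypothesis unit_A : forall k, (ngens <= k)%N -> PA k = 1.
Hypothesis bnd_A : forall k, cnorm (PA k) + 1 <= bnd%:R.
Hypothesis stable : forall c, near_model c (size rels) ->
  exists phi : starhom A B, forall k, cnorm (phi (PA k) - sample_at c k) <= 2 ^- pi1 c.
Hypothesis rels_code : forall i, (i < size rels)%N ->
  code_poly (decode_poly (rel_term rels i)) = rel_term rels i.
Hypothesis gens_bounded : forall k, (k < ngens)%N ->
  exists2 i, (i < size rels)%N & rel_term rels i = code_var k.
Hypothesis universal : forall (C : cstar R) (z : nat -> C),
  (forall i, (i < size rels)%N ->
     cnorm (peval z (decode_poly (rel_term rels i))) <= rval R (rel_bound rels i)) ->
  (forall k, (ngens <= k)%N -> z k = 1) ->
  exists phi : starhom A C, forall k, phi (PA k) = z k.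
Hypothesis approximable : forall p m (e : R), 0 < e -> exists q : nat -> starpoly nat,
  let z k := if (k < ngens)%N then peval PB (q k) else 1 in
  (forall i, (i < size rels)%N ->
     cnorm (peval z (decode_poly (rel_term rels i))) < rval R (rel_bound rels i) + 2 ^- m)
  /\ cnorm (peval PA p) - e < cnorm (peval z p).

Lemma prov_sound j : prov j -> sem PA PB ngens bnd rels fm j.
Proof. exact: (provable_sound (fB := fB) approxB rels_A unit_A bnd_A stable). Qed.

Lemma dist_sound p x : proves_dist (code_poly p) code_zero x -> cnorm (peval PA p) <= x.
Proof.
move=> [r /prov_sound]; rewrite sem_dist /dist_sem (code_polyK p).
by rewrite /code_zero code_polyK peval_zero subr0; exact: le_trans.
Qed.

Lemma peval_sub (C : cstar R) (z : nat -> C) p q :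
  peval z (psub p q) = peval z p - peval z q.
Proof.
rewrite /psub /popp pevalD pevalM peval_gauss.
rewrite (_ : gauss R _ = -1) ?scaleN1r ?mulN1r // /gauss /= mul0r divr1.
by apply/eqP; rewrite eq_complex /= oppr0 !eqxx.
Qed.

Lemma dist_complete p x :
  cnorm (peval PA p) < x -> proves_dist (code_poly p) code_zero x.
Proof.
move=> lt_x.
(* Soundness in [A] keeps the completion nonzero. *)
have one : exists2 e : R, 0 < e &
    forall y, proves_dist (code_poly (pone nat)) code_zero y -> e <= y.
  by exists 1 => // y /dist_sound; rewrite peval_one cnorm1.
have [C [z zE]] := cstar_completion (prov_dst_cstar gens_bounded one).
have [i lt_i|k le_k|phi phiE] := @universal C z.
- rewrite zE; apply: prov_dst_le.
  by rewrite rels_code //; exact: (@dist_rel R ngens bnd rels fB fm i lt_i).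
- apply/eqP; rewrite -subr_eq0; apply/eqP/cnorm_eq0.
  have := zE (psub (PVar k) (pone nat)); rewrite peval_sub peval_one /= => ->.
  rewrite (dst_sub (prov_dst_cstar gens_bounded one)).
  exact: (prov_dst0 gens_bounded (@dist_unit R ngens bnd rels fB fm k le_k)).
- apply: (prov_dst_lt gens_bounded); rewrite -zE.
  rewrite -(peval_ext p phiE) -peval_starhom.
  exact: le_lt_trans (starhom_contractive phi _) lt_x.
Qed.

Let prov0 : prov 0 := provable0 _.

Lemma prov_term p : prov (jterm (code_poly p)).
Proof.
elim: p => [k|a b d|p pp q pq|p pp q pq|p pp] /=.
- exact: (provable_rule 17 k prov0 prov0).
- exact: (provable_rule 18 (npair (code_int a) (npair (code_int b) d)) prov0 prov0).
- by have := provable_rule 19 0 pp pq; rewrite /= /rule_termadd !termE.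
- by have := provable_rule 20 0 pp pq; rewrite /= /rule_termmul !termE.
- by have := provable_rule 21 0 pp pp; rewrite /= /rule_termstar !termE.
Qed.

(** The term [p'] is whatever the rules build; its meaning is recovered from soundness where it is
    used. *)
Lemma prov_sub c n : (forall k, prov (jterm (sample ngens c k))) ->
  exists p', prov (jsub c n p' (plip bnd (decode_poly n)).1 (plip bnd (decode_poly n)).2).
Proof.
move=> cP; elim/code_ind: n => [k|w|p q [p' pp] [q' pq]|p q [p' pp] [q' pq]|p [p' pp]|t b].
- exists (sample ngens c k); rewrite decode_var.
  by have := provable_rule 22 (npair c k) (cP k) prov0; rewrite /= /rule_subvar !termE !piK eqxx.
- exists (code_const w); rewrite decode_const /= !decode_intK.
  by have := provable_rule 23 (npair c w) prov0 prov0; rewrite /= /rule_subconst !piK.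
- exists (code_add p' q'); rewrite decodeD.
  by have := provable_rule 24 0 pp pq; rewrite /= /rule_subadd !subE eqxx.
- exists (code_mul p' q'); rewrite decodeM.
  by have := provable_rule 25 0 pp pq; rewrite /= /rule_submul !subE eqxx.
- exists (code_star p'); rewrite decode_star.
  by have := provable_rule 26 0 pp pp; rewrite /= /rule_substar !subE.
- exists code_zero; rewrite decode_junk.
  by have := provable_rule 27 (npair c (npair t b)) prov0 prov0; rewrite /= /rule_subjunk !piK.
Qed.

Lemma pow2_small (e : R) : 0 < e -> exists k, 2 ^- k < e :> R.
Proof.
by move=> e0; have [k hk] := geom_small ltr01 e0; exists k; rewrite mul1r exprVn in hk.
Qed.

Lemma prov_good c i : (forall k, prov (jterm (sample ngens c k))) ->
  (forall i', (i' < size rels)%N -> cnorm (peval (sample_at c) (decode_poly (rel_term rels i')))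
     < rval R (rel_bound rels i') + 2 ^- fm (pi1 c)) ->
  (i <= size rels)%N -> prov (jgood c i).
Proof.
move=> cP near; elim: i => [_|i IH lt_i].
  exact: (provable_rule 28 c prov0 prov0).
have [p' pp] := prov_sub (rel_term rels i) cP.
have := prov_sound pp; rewrite sem_sub => -[p'E p'K _].
have gap := near i lt_i; rewrite -subr_gt0 in gap.
(* The error 2^-k counts twice: once in the computed norm, once as the guard in the rule. *)
have [k hk] := pow2_small (divr_gt0 gap (ltr0n R 2)).
have := provable_rule 29 k (IH (ltnW lt_i)) pp.
rewrite [nth _ _ _]/= /rule_good !goodE !subE !eqxx lt_i !andTb (rle_rval R) !rvalD !rval_pow ifT //.
have := normB_approx approxB k p'K; rewrite p'E peval_psubst -/(sample_at c).
move=> /ltW; rewrite ler_norml => /andP[h1 h2].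
move: hk h1 h2; rewrite ltr_pdivlMr //.
set y := cnorm _; rewrite -/y; lra.
Qed.

Lemma low_complete n x : 0 <= x -> x < cnorm (evA n) ->
  exists u, prov (jlow n u) /\ x < rval R u.
Proof.
move=> x0 lt_x; set y := cnorm (evA n) in lt_x.
(* Four losses of at most d: the transfer to [B], the error of the computed norm, its guard in the
   rule, and the Lipschitz term. The fifth d leaves room for a rational above x. *)
pose d := (y - x) / 5; have d0 : 0 < d by rewrite divr_gt0 ?subr_gt0.
set E := (plip bnd (decode_poly n)).2.
(* Dividing by E + 1 also covers E = 0. The index m is fixed before the sample point, since it sets
   the tolerance there. *)
have [m hm] := pow2_small (divr_gt0 d0 (ltr0Sn R E)).
have [q [near qn]] := approximable (decode_poly n) (fm m) d0.
have [l lP] := code_nth_surj (fun k => code_poly (q k)) ngens.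
pose c := npair m l.
have sE k : sample ngens c k = if (k < ngens)%N then code_poly (q k) else code_one.
  by rewrite /sample /c piK; case: ifP => // /lP.
have cE k : sample_at c k = if (k < ngens)%N then peval PB (q k) else 1.
  rewrite sample_atE sE; case: ifP => _; first by rewrite code_polyK.
  by rewrite /code_one code_polyK peval_one.
have cP k : prov (jterm (sample ngens c k)).
  by rewrite sE; case: ifP => _; exact: prov_term.
have good : prov (jgood c (size rels)).
  apply: prov_good => // i lt_i; rewrite (peval_ext _ cE) /c piK; exact: near.
have [p' pp] := prov_sub n cP.
have := prov_sound pp; rewrite sem_sub => -[p'E p'K _].
have [k hk] := pow2_small d0.
have nB := normB_approx approxB k p'K.
move: nB; rewrite p'E peval_psubst -/(sample_at c) (peval_ext _ cE).
move=> /ltW; rewrite ler_norml => /andP[h1 h2].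
have [u /andP[xu uy]] : exists u, x < rval R u < y - 4 * d.
  apply: rval_dense => //; rewrite /d; lra.
exists u; split=> //.
have := provable_rule 31 (npair k u) good pp.
rewrite [nth _ _ _]/= /rule_low !goodE !subE !piK !eqxx !andTb (rle_rval R) !rvalD rvalM !rval_pow.
rewrite rval_npair divr1 /c ?piK ifT // -/E.
have hE : E%:R * 2 ^- m <= d.
  rewrite ltr_pdivlMr // in hm; apply: le_trans (ltW hm); rewrite mulrC ler_wpM2l //.
  by rewrite ler_nat.
move: qn h1 h2; rewrite -/y; set t := cnorm _; lra.
Qed.

(** The search must halt on every input, also on numbers that code no term. *)
Lemma dist_decode n : proves_dist n (code_poly (decode_poly n)) 0.
Proof.
have bounded p : exists x, proves_dist (code_poly p) code_zero x.
  exact: (@dist_bounded R ngens bnd rels fB fm gens_bounded p).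
elim/code_ind: n => [k|w|p q pp pq|p q pp pq|p pp|t b].
- by rewrite decode_var; exact: dist_refl.
- by rewrite decode_const /= !decode_intK !npairE; exact: dist_refl.
- rewrite decodeD; apply: distW (dist_add pp pq) _; by rewrite addr0.
- rewrite decodeM.
  (* A distance 0 survives multiplication only against some finite provable bound of the other
     factor. *)
  have [x px] := bounded (decode_poly p); have [y qy] := bounded (decode_poly q).
  apply: distW (dist_tri (dist_mull pp (dist_tri pq qy)) (dist_mulr pq px)) _.
  by rewrite mul0r mulr0 addr0.
- by rewrite decode_star; exact: dist_star.
- rewrite decode_junk; exists 0%N; last by rewrite rval0.
  by have := provable_rule 11 (npair t b) prov0 prov0; rewrite /= /rule_junk !piK.
Qed.

Lemma app_complete n k : exists q, prov (japp n k q).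
Proof.
pose e : R := 2 ^- k; have e0 : 0 < e by rewrite invr_gt0 exprn_gt0.
(* The upper bound exceeds the norm by at most e/4 and the lower one misses it by less than e/2, so
   they differ by less than e. *)
have e4 : 0 < e / 4 by rewrite divr_gt0.
have [r pr hr] : proves_dist n code_zero (cnorm (evA n) + e / 4).
  apply: distW (dist_tri (dist_decode n) (dist_complete (x := cnorm (evA n) + e / 4) _)) _.
    by rewrite ltrDl.
  by rewrite add0r.
have [u [pu hu]] : exists u, prov (jlow n u) /\ cnorm (evA n) - e / 4 < rval R u + e / 4.
  have [le0|lt0] := lerP (cnorm (evA n) - e / 4) 0.
    exists 0%N; split; first exact: (provable_rule 30 n prov0 prov0).
    by rewrite rval0; lra.
  have lt_e : cnorm (evA n) - e / 4 < cnorm (evA n) by rewrite gtrBl.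
  have [u [pu hu]] := low_complete (ltW lt0) lt_e.
  by exists u; split=> //; lra.
exists (npair (pi1 r + pi1 r) (pi2 r)).
have := provable_rule 32 k pr pu.
rewrite /= /rule_app !distE !lowE !eqxx /= (rlt_rval R) rvalD rval_pow ifT //.
by move: hr hu; rewrite -/e; lra.
Qed.

Lemma norm_computable : computable fB -> computable fm ->
  exists2 f : nat -> nat, computable f &
    forall p k, `|cnorm (peval PA p) - ratr (decode_rat (f (npair (code_poly p) k)))|
      < 2 ^- k.
Proof.
move=> cB cm.
pose M := norm_machine ngens bnd rels fB fm.
have cM : computable M by exact: machine_norm_computable.
(* The test accepts a derivation whose conclusion is an approximation judgement for the given term
   and precision, with any rational in the last slot. *)
pose t x := nat_of_bool (M (pi2 x) != japp (pi1 (pi1 x)) (pi2 (pi1 x)) (snd1 (M (pi2 x)))).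
have ct : computable t by rewrite /t /japp /snd1; computability.
have [n|g cg gP] := computable_search ct.
  have [q /machine_complete[w wE]] := app_complete (pi1 n) (pi2 n).
  by exists w; rewrite /t /M /norm_machine !piK wE /snd1 /japp !piK eqxx.
exists (fun n => snd1 (M (g n))); first by rewrite /snd1; computability.
move=> p k; set n := npair _ _.
have := prov_sound (machine_sound (rules ngens bnd rels fB fm) (g n)).
have := gP n; rewrite /t !piK -/(norm_machine _ _ _ _ _) -/(M _).
by case: eqP => // {1}-> _; rewrite sem_app /app_sem code_polyK.
Qed.

End NormApproximation.

(** * Rational points of B *)

Section Density.
Variables (R : realType) (C : cstar R) (P : presentation C).

(** The closure of the rational points is a C*-subalgebra containing the generators, hence
    everything. Complex scalars are reached through [gauss_approx]. *)
Lemma rational_points_dense (a : C) (e : R) : 0 < e ->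
  exists p, cnorm (a - peval P p) < e.
Proof.
pose S : set C := [set a | forall e : R, 0 < e -> exists p, cnorm (a - peval P p) < e].
suff : cstar_subalgebra S.
  move=> /(special_generates (p := P)) ST e0.
  have /(_ e e0)// : S a.
  rewrite ST // => n d d0; exists (PVar n).
  by rewrite /= subrr cnorm0.
have half (d : R) : 0 < d -> 0 < d / 2 by move=> ?; rewrite divr_gt0.
split.
- by move=> d d0; exists (pone nat); rewrite peval_one subrr cnorm0.
- move=> x y Sx Sy d /half d0; have [p hp] := Sx _ d0; have [q hq] := Sy _ d0.
  exists (PAdd p q); rewrite /= opprD addrACA (splitr d).
  exact: le_lt_trans (cnormD _ _) (ltrD hp hq).
- move=> c x Sx d /half d0.
  have x0 : 0 < cnorm x + 1 by rewrite ltr_wpDl ?cnorm_ge0.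
  have [N /(_ N N (leqnn N) (leqnn N)) hN] := gauss_approx_cvg c (divr_gt0 d0 x0).
  set g := gauss_approx c N in hN; have g0 : 0 < normc (gauss R g) + 1.
    by rewrite ltr_wpDl ?normc_ge0.
  have [p hp] := Sx _ (divr_gt0 d0 g0).
  exists (PMul (pgauss nat g) p); rewrite /= -scalerAl mul1r -/(gauss R g).
  have -> : c *: x - gauss R g *: peval P p =
      (c - gauss R g) *: x + gauss R g *: (x - peval P p).
    by rewrite scalerBl scalerBr addrA subrK.
  apply: le_lt_trans (cnormD _ _) _; rewrite !cnormZ (splitr d).
  rewrite ltr_pdivlMr // in hN; rewrite ltr_pdivlMr // in hp.
  apply: ler_ltD.
    apply: le_trans (ltW hN); rewrite normc_distC ler_wpM2l ?normc_ge0 //.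
    by rewrite lerDl.
  apply: le_lt_trans hp; rewrite mulrC ler_wpM2l ?cnorm_ge0 //.
  by rewrite lerDl.
- move=> x y Sx Sy d /half d0.
  have y0 : 0 < cnorm y + 1 by rewrite ltr_wpDl ?cnorm_ge0.
  have [p hp] := Sx _ (divr_gt0 d0 y0).
  have p0 : 0 < cnorm (peval P p) + 1 by rewrite ltr_wpDl ?cnorm_ge0.
  have [q hq] := Sy _ (divr_gt0 d0 p0).
  exists (PMul p q) => /=.
  have -> : x * y - peval P p * peval P q =
      (x - peval P p) * y + peval P p * (y - peval P q).
    by rewrite mulrBl mulrBr addrA subrK.
  apply: le_lt_trans (cnormD _ _) _; rewrite (splitr d).
  rewrite ltr_pdivlMr // in hp; rewrite ltr_pdivlMr // in hq.
  apply: ltrD; apply: le_lt_trans (cnormM _ _) _.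
    by apply: le_lt_trans hp; rewrite ler_wpM2l ?cnorm_ge0 // lerDl.
  by apply: le_lt_trans hq; rewrite mulrC ler_wpM2l ?cnorm_ge0 // lerDl.
- move=> x Sx d d0; have [p hp] := Sx _ d0; exists (PStar p).
  by rewrite /= -starB cnorm_star.
- move=> x xS d /half d0; have [y Sy hy] := xS _ d0; have [p hp] := Sy _ d0.
  exists p; rewrite (splitr d).
  exact: le_lt_trans (cdist_triangle y _ _) (ltrD hy hp).
Qed.

Lemma presentation_separable : separable C.
Proof.
exists (fun n => peval P (decode_poly n)) => a e /(rational_points_dense a)[p hp].
by exists (code_poly p); rewrite code_polyK.
Qed.

End Density.

Section Continuity.
Variables (R : realType) (B : cstar R) (z : nat -> B).

(** Continuity at the point [z], with one [d] for all variables; no common bound on the [z k] is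
    assumed. *)
Lemma peval_continuous (p : starpoly nat) (e : R) : 0 < e ->
  exists2 d : R, 0 < d & forall z' : nat -> B, (forall k, cnorm (z k - z' k) < d) ->
    cnorm (peval z p - peval z' p) < e.
Proof.
elim: p e => [k|a b c|p IHp q IHq|p IHp q IHq|p IHp] e e0.
- by exists e => // z' /(_ k).
- by exists 1 => // z' _; rewrite subrr cnorm0.
- have e2 : 0 < e / 2 by rewrite divr_gt0.
  have [d1 d10 h1] := IHp _ e2; have [d2 d20 h2] := IHq _ e2.
  exists (Num.min d1 d2); first by rewrite lt_min d10.
  move=> z' zz; rewrite /= opprD addrACA (splitr e).
  apply: le_lt_trans (cnormD _ _) (ltrD (h1 _ _) (h2 _ _)) => k;
    by have := zz k; rewrite lt_min => /andP[].
- have e2 : 0 < e / 2 by rewrite divr_gt0.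
  have q0 : 0 < cnorm (peval z q) + 1 by rewrite ltr_wpDl ?cnorm_ge0.
  have p0 : 0 < cnorm (peval z p) + 1 by rewrite ltr_wpDl ?cnorm_ge0.
  have [d1 d10 h1] := IHp _ (divr_gt0 e2 q0).
  have [d2 d20 h2] := IHq _ (divr_gt0 e2 p0).
  have [d3 d30 h3] := IHp _ ltr01.
  exists (Num.min d1 (Num.min d2 d3)); first by rewrite !lt_min d10 d20.
  move=> z' zz /=.
  have {}h1 : cnorm (peval z p - peval z' p) < e / 2 / (cnorm (peval z q) + 1).
    by apply: h1 => k; have := zz k; rewrite !lt_min => /and3P[].
  have {}h2 : cnorm (peval z q - peval z' q) < e / 2 / (cnorm (peval z p) + 1).
    by apply: h2 => k; have := zz k; rewrite !lt_min => /and3P[].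
  have {}h3 : cnorm (peval z p - peval z' p) < 1.
    by apply: h3 => k; have := zz k; rewrite !lt_min => /and3P[].
  have -> : peval z p * peval z q - peval z' p * peval z' q =
      (peval z p - peval z' p) * peval z q + peval z' p * (peval z q - peval z' q).
    by rewrite mulrBl mulrBr addrA subrK.
  apply: le_lt_trans (cnormD _ _) _; rewrite (splitr e).
  rewrite ltr_pdivlMr // in h1; rewrite ltr_pdivlMr // in h2.
  apply: ltrD; apply: le_lt_trans (cnormM _ _) _.
    by apply: le_lt_trans h1; rewrite ler_wpM2l ?cnorm_ge0 // lerDl.
  apply: le_lt_trans h2; rewrite mulrC ler_wpM2l ?cnorm_ge0 //.
  by have := cdist_norm (peval z p) (peval z' p); rewrite ler_norml => /andP[]; lra.
- have [d d0 h] := IHp _ e0; exists d => // z' /h.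
  by rewrite /= -starB cnorm_star.
Qed.

Lemma peval_continuous_all (p : nat -> starpoly nat) (e : nat -> R) (N : nat) :
  (forall i, (i < N)%N -> 0 < e i) ->
  exists2 d : R, 0 < d & forall z' : nat -> B, (forall k, cnorm (z k - z' k) < d) ->
    forall i, (i < N)%N -> cnorm (peval z (p i) - peval z' (p i)) < e i.
Proof.
elim: N => [|N IH] e0; first by exists 1.
have [|d d0 h] := IH; first by move=> i lt_i; rewrite e0 // ltnW.
have [d' d'0 h'] := peval_continuous (p N) (e0 N (ltnSn N)).
exists (Num.min d d'); first by rewrite lt_min d0.
move=> z' zz i; rewrite ltnS leq_eqVlt => /predU1P[->|lt_i].
  by apply: h' => k; have := zz k; rewrite lt_min => /andP[].
by apply: h => // k; have := zz k; rewrite lt_min => /andP[].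
Qed.

End Continuity.

(** * Transfer of norm conditions from an ultrapower of B to rational points of B *)

Section UltrapowerModels.
Variables (R : realType) (B : cstar R) (U : set_system nat) (UU : UltraFilter U).

Lemma peval_ultrapower (s : nat -> bounded_seq B) (p : starpoly nat) :
  exists2 t : bounded_seq B,
    peval (A := ultrapower B UU) (fun k => upi UU (s k)) p = upi UU t &
    forall n, val t n = peval (fun k => val (s k) n) p.
Proof.
elim: p => [k|a b d|p [t pt tE] q [r qr rE]|p [t pt tE] q [r qr rE]|p [t pt tE]].
- by exists (s k).
- exists (bscale (gauss R (a, b, d)) (bconst 1)) => //.
  exact: (upiZ UU (gauss R (a, b, d)) (bconst 1)).
- exists (badd t r); first by rewrite /= pt qr; exact: upiD.
  by move=> n /=; rewrite tE rE.
- exists (bmul t r); first by rewrite /= pt qr; exact: upiM.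
  by move=> n /=; rewrite tE rE.
- exists (bstar t); first by rewrite /= pt; exact: ustarE.
  by move=> n /=; rewrite tE.
Qed.

Lemma ultrapower_norm_near (s : nat -> bounded_seq B) (p : starpoly nat) (e : R) :
  0 < e -> U [set n | `|cnorm (peval (A := ultrapower B UU) (fun k => upi UU (s k)) p)
    - cnorm (peval (fun k => val (s k) n) p)| < e].
Proof.
move=> e0; have [t -> tE] := peval_ultrapower s p.
rewrite (_ : cnorm _ = ulim U t); last exact: unormE.
have /cvgrPdist_lt/(_ _ e0) := @ulim_cvg R B U UU t.
by apply: filterS => n /=; rewrite tE.
Qed.

End UltrapowerModels.

Section Transfer.
Variables (R : realType) (A B : cstar R) (PA : presentation A) (PB : presentation B).
Hypothesis locally_universal_B : locally_universal B.
Variables (ngens : nat).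
Hypothesis unit_A : forall k, (ngens <= k)%N -> PA k = 1.

(** Finitely many norm conditions hold together on a set of the ultrafilter, and such a set has an
    element. *)
Lemma transfer_point (p : nat -> starpoly nat) (e : nat -> R) (N : nat) :
  (forall i, (i < N)%N -> 0 < e i) ->
  exists2 z : nat -> B, (forall k, (ngens <= k)%N -> z k = 1) &
    forall i, (i < N)%N -> `|cnorm (peval PA (p i)) - cnorm (peval z (p i))| < e i.
Proof.
move=> e0.
have [U [UU [_ [Phi Phi_norm]]]] := locally_universal_B (presentation_separable PA).
(* From [ngens] on, the constant sequence 1 is chosen as representative, so that the unit generator
   is exactly 1 at every index. *)
pose s k : bounded_seq B := if (k < ngens)%N then repr (Phi (PA k) : upow B UU) else bconst 1.
have sE k : Phi (PA k) = upi UU (s k).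
  rewrite /s; case: ltnP => [lt_k|le_k]; first by rewrite /upi reprK.
  by rewrite unit_A // rmorph1.
have : U [set n | forall i, (i < N)%N ->
    `|cnorm (peval PA (p i)) - cnorm (peval (fun k => val (s k) n) (p i))| < e i].
  elim: N e0 => [|N IH] e0; first by apply: filterE.
  have {}IH := IH (fun i lt_i => e0 i (ltnW lt_i)).
  apply: filterS (filterI IH (ultrapower_norm_near UU s (p N) (e0 N (ltnSn N)))).
  move=> n /= [h1 h2] i; rewrite ltnS leq_eqVlt => /predU1P[->|]; last exact: h1.
  by rewrite -Phi_norm peval_starhom (peval_ext _ sE).
move=> /filter_ex[n /= h]; exists (fun k => val (s k) n) => // k le_k.
by rewrite /s ltnNge le_k.
Qed.

Lemma transfer_rational_point (p : nat -> starpoly nat) (e : nat -> R) (N : nat) :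
  (forall i, (i < N)%N -> 0 < e i) ->
  exists q : nat -> starpoly nat,
    let z k := if (k < ngens)%N then peval PB (q k) else 1 in
    forall i, (i < N)%N -> `|cnorm (peval PA (p i)) - cnorm (peval z (p i))| < e i.
Proof.
move=> e0.
(* Half of each tolerance pays for leaving the ultrapower, half for rounding to rational points. *)
have e20 i : (i < N)%N -> 0 < e i / 2 by move=> /e0 ?; rewrite divr_gt0.
have [z z1 zP] := transfer_point p e20.
have [d d0 dP] := peval_continuous_all z p e20.
have /choice[q qP] k := rational_points_dense PB (z k) d0.
exists q => z' i lt_i; rewrite (splitr (e i)).
apply: le_lt_trans (ler_distD (cnorm (peval z (p i))) _ _) (ltrD (zP i lt_i) _).
apply: le_lt_trans (cdist_norm _ _) (dP _ _ i lt_i) => k; rewrite /z'.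
by case: ltnP => [_|/z1 ->]; [exact: qP|rewrite subrr cnorm0].
Qed.

End Transfer.

(** * The relations of the presentation as a list of codes *)

Section RelationCodes.
Variables (R : realType) (S : relations).

Definition rel_poly (i : 'I_(nrel S)) : starpoly nat :=
  psubst (fun k : 'I_(ngen S) => PVar (k : nat)) (Defs.rel i).
Definition dyadic_code (d : nat * nat) : nat := npair d.1 (2 ^ d.2).-1.
(** Both kinds of relation take the form ||t|| <= c: polynomial relations with c = 0, generators
    with their dyadic bound. *)
Definition rel_codes : seq (nat * nat) :=
  [seq (code_poly (rel_poly i), 0%N) | i <- enum 'I_(nrel S)] ++
  [seq (code_var k, dyadic_code (Defs.bound k)) | k : 'I_(ngen S) <- enum 'I_(ngen S)].

Lemma rval_dyadic d : rval R (dyadic_code d) = dyadic R d.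
Proof. by rewrite rval_npair prednK ?expn_gt0 // natrX. Qed.

Lemma rel_codesP (P : nat -> nat -> Prop) :
  (forall i, (i < size rel_codes)%N -> P (rel_term rel_codes i) (rel_bound rel_codes i))
  <-> (forall i, P (code_poly (rel_poly i)) 0%N) /\
      (forall k : 'I_(ngen S), P (code_var k) (dyadic_code (Defs.bound k))).
Proof.
have nthE i : (i < size rel_codes)%N ->
    (rel_term rel_codes i, rel_bound rel_codes i) = nth (0%N, 0%N) rel_codes i.
  by move=> lt_i; rewrite /rel_term /rel_bound !(nth_map (0%N, 0%N)) // -surjective_pairing.
split=> [h | [h1 h2] i lt_i].
  have hP r : r \in rel_codes -> P r.1 r.2.
    move=> rS; have lt_r : (index r rel_codes < size rel_codes)%N by rewrite index_mem.
    by have := h _ lt_r; have := nthE _ lt_r; rewrite nth_index //; case: r {rS lt_r} => t c [-> ->].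
  split=> j.
    apply: (hP (_, _)); rewrite mem_cat; apply/orP; left.
    by apply: map_f; rewrite mem_enum.
  apply: (hP (_, _)); rewrite mem_cat; apply/orP; right.
  by apply: (map_f (fun k : 'I__ => (code_var k, dyadic_code (Defs.bound k)))); rewrite mem_enum.
have : nth (0%N, 0%N) rel_codes i \in rel_codes by exact: mem_nth.
rewrite -nthE // mem_cat => /orP[] /mapP[j _ [-> ->]]; [exact: h1|exact: h2].
Qed.

Lemma rel_codes_gen (k : nat) : (k < ngen S)%N ->
  exists2 i, (i < size rel_codes)%N & rel_term rel_codes i = code_var k.
Proof.
move=> lt_k; pose r := (code_var k, dyadic_code (Defs.bound (Ordinal lt_k))).
have rS : r \in rel_codes.
  rewrite mem_cat; apply/orP; right; apply/mapP.
  by exists (Ordinal lt_k); rewrite ?mem_enum.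
exists (index r rel_codes); first by rewrite index_mem.
by rewrite /rel_term (nth_map (0%N, 0%N)) ?index_mem // nth_index.
Qed.

Lemma satisfies_codes (C : cstar R) (z : nat -> C) (e : R) :
  satisfies_upto (fun k : 'I_(ngen S) => z k) e <->
  forall i, (i < size rel_codes)%N ->
    cnorm (peval z (decode_poly (rel_term rel_codes i)))
      <= rval R (rel_bound rel_codes i) + e.
Proof.
rewrite (rel_codesP (fun t c => cnorm (peval z (decode_poly t)) <= rval R c + e)).
have E1 i : peval z (decode_poly (code_poly (rel_poly i))) =
    peval (fun k : 'I_(ngen S) => z k) (Defs.rel i).
  by rewrite code_polyK peval_psubst.
split=> -[h1 h2]; split=> i.
- by rewrite E1 rval0 add0r; exact: h1.
- by rewrite decode_var rval_dyadic; exact: h2.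
- by have := h1 i; rewrite E1 rval0 add0r.
- by have := h2 i; rewrite decode_var rval_dyadic.
Qed.

Lemma rel_codes_canonical i : (i < size rel_codes)%N ->
  code_poly (decode_poly (rel_term rel_codes i)) = rel_term rel_codes i.
Proof.
move: i; apply/(rel_codesP (fun t _ => code_poly (decode_poly t) = t)).
by split=> i; rewrite ?code_polyK ?decode_var.
Qed.

End RelationCodes.

Lemma bounded_with_unit (R : realType) (A : cstar R) (j : nat) (x : 'I_j -> A) :
  exists b : nat, forall k, cnorm (with_unit x k) + 1 <= b%:R.
Proof.
(* The sum dominates each generator; the summand 2 covers the required + 1 and the unit, where 1 + 1
   = 2. *)
exists ((\sum_(i < j) Num.bound (cnorm (x i))).+2)%N => k; rewrite /with_unit.
case: insubP => [i _ _|_]; last by rewrite cnorm1 -[1 + 1]/(2%:R) ler_nat.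
rewrite -natr1 lerD2r -natr1; have := archi_boundP (cnorm_ge0 (x i)).
move=> /ltW/le_trans; apply; rewrite natr1 ler_nat (bigD1 i) //=.
by rewrite -addnS leq_addr.
Qed.

Theorem theorem2p13 (R : realType) (B : cstar R) (PB : presentation B)
    (HB : locally_universal B) (HPB : computable_presentation PB)
    (A : cstar R) (PA : presentation A) (HPA : computably_weakly_stable PA) :
  computable_presentation PA.
Proof.
have [S [x [[[x_sat x_univ] PAE] [fm cm stab]]]] := HPA.
have [fB cB approxB] := HPB.
have [bnd bndP] := bounded_with_unit x.
have PAx (k : 'I_(ngen S)) : PA k = x k by rewrite PAE /with_unit valK.
have PA1 k : (ngen S <= k)%N -> PA k = 1.
  by move=> le_k; rewrite PAE /with_unit insubN // -leqNgt.
have rels_A i : (i < size (rel_codes S))%N ->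
    cnorm (peval PA (decode_poly (rel_term (rel_codes S) i)))
      <= rval R (rel_bound (rel_codes S) i).
  rewrite -[leRHS]addr0; apply/satisfies_codes: i.
  by rewrite (_ : (fun k : 'I__ => PA k) = x) //; apply/funext.
apply: (norm_computable (B := B) (PB := PB) (ngens := ngen S) (bnd := bnd)
  (rels := rel_codes S) (fB := fB) (fm := fm)) => //.
- by move=> k; rewrite PAE.
- move=> c near.
  have /satisfies_codes/stab[phi phiP] := near.
  exists phi => k; have [le_k|lt_k] := leqP (ngen S) k.
    rewrite PA1 // rmorph1 sample_atE.
    have -> : sample (ngen S) c k = code_one by rewrite /sample ltnNge le_k.
    by rewrite /code_one code_polyK peval_one subrr cnorm0 invr_ge0 exprn_ge0.
  by have := phiP (Ordinal lt_k); rewrite -PAx => /ltW.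
- exact: rel_codes_canonical.
- exact: rel_codes_gen.
- move=> C z z_sat z1.
  have /x_univ[phi [phiE _]] : satisfies_upto (fun k : 'I_(ngen S) => z k) 0.
    by apply/satisfies_codes => i /z_sat; rewrite addr0.
  exists phi => k; have [le_k|lt_k] := leqP (ngen S) k.
    by rewrite PA1 // rmorph1 z1.
  by rewrite (PAx (Ordinal lt_k)) phiE.
- move=> p m e e0.
  pose N := size (rel_codes S).
  (* The term [p] is appended at index N to the relations, so that one point of [B] serves the
     relations and the norm of [p] together. *)
  pose ps i := if (i < N)%N then decode_poly (rel_term (rel_codes S) i) else p.
  pose es i : R := if (i < N)%N then 2 ^- m else e.
  have es0 i : (i < N.+1)%N -> 0 < es i.
    by rewrite /es; case: ifP => // _ _; rewrite invr_gt0 exprn_gt0.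
  have [q qP] := transfer_rational_point PB HB PA1 ps es0.
  exists q; split=> [i lt_i|].
    have := qP i (ltnW lt_i); rewrite /ps /es lt_i ltr_norml => /andP[h _].
    by have := rels_A i lt_i; move: h; set u := cnorm _; set v := cnorm _; lra.
  have := qP N (ltnSn N); rewrite /ps /es ltnn ltr_norml => /andP[_ h].
  by move: h; set u := cnorm _; set v := cnorm _; lra.
Qed.
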